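(* Let $n\in\mathbb{N}$. For all choices $C,C'\in\mathcal{C}^n$ and all choices of twists $\tau_C,\tau_{C'}$ (maps $N_2(\mathcal{G}^n\times\mathcal{Z})\to\mathbb{Z}/4\mathbb{Z}$ with $d\tau_C=\psi_C$ and $d\tau_{C'}=\psi_{C'}$), there is an isomorphism of algebras $$\left(OH^n_C\otimes_{\mathbb{Z}}\mathbb{Z}[i]\right)_{\tau_C}\simeq\left(OH^n_{C'}\otimes_{\mathbb{Z}}\mathbb{Z}[i]\right)_{\tau_{C'}}.$$
   Context: Matchings. $B^n$ is the set of crossingless matchings of $2n$ points on a horizontal line by non-crossing arcs placed below the line. For $b\in B^n$, $W(b)$ is the reflection of $b$ across the line, and $W(b)a$ is the gluing of $W(b)$ on top of $a$, a disjoint union of circles; $|W(b)a|$ is the number of circles. $W(c)bW(b)a$ denotes the disjoint union of $W(c)b$ placed on top of $W(b)a$. Odd arc algebra. For a disjoint union $S$ of circles, $V(S)$ is the free abelian group on the components of $S$, each of degree $2$, and $OF(S)=\bigwedge^*V(S)\{-|S|\}$, where $|S|$ is the number of components and $\{m\}$ shifts the degree up by $m$. Put $b(OH^n)a:=OF(W(b)a)\{n\}$ and $OH^n=\bigoplus_{a,b\in B^n}b(OH^n)a$. For $a,b,c\in B^n$, a choice $C_{cba}$ is a cobordism $W(c)bW(b)a\to W(c)a$ obtained by contracting, by one saddle each, every arc of $b$ with its mirror image in $W(b)$ (replacing the two arcs by two vertical strands), together with (i) an order in which these $n$ saddles are performed, no arc being contracted before an arc surrounding it, and (ii) for each saddle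 that splits a circle into two, an orientation, i.e. an ordering $b_1\to b_2$ of the two resulting circles. $\mathcal{C}^n$ is the set of all choices $C=\{C_{cba}\mid a,b,c\in B^n\}$. $OF$ of such a cobordism (or of a composite of such, possibly with identity components) is the composite of the maps of the saddles: a merge of $a_1,a_2$ acts by the map of exterior algebras identifying $a_1$ with $a_2$; a split of $a$ into $b_1\to b_2$ replaces each occurrence of $a$ by $b_1$ and then multiplies on the left by $(b_1-b_2)\wedge$. The product of $x\in c(OH^n)b$ and $y\in b(OH^n)a$ is $xy:=OF(C_{cba})(x\wedge y)\in c(OH^n)a$; the product $d(OH^n)c\otimes b(OH^n)a\to OH^n$ is zero if $c\neq b$. $OH^n_C$ is $OH^n$ with this (nonassociative) multiplication. Write $s(W(c)b,W(b)a)$ for the number of splits in $C_{cba}$ (independent of $C$). Grading. $\mathcal{G}^n$ is the groupoid with object set $B^n$ and exactly one morphism $a\to b$ for all $a,b$, denoted $W(b)a$, with $W(c)b\circ W(b)a=W(c)a$. $\mathcal{Z}$ is the group $\mathbb{Z}$ viewed as a one-object category. $OH^n_C$ is graded by $\mathcal{G}^n\times\mathcal{Z}$: a homogeneous $x\in b(OH^n)a$ of degree $k$ has degree $|x|=(W(b)a,k)$. $N_m(\mathcal{G})$ is the set of sequences of $m$ composable morphisms of $\mathcal{G}$. For a map $\tau$ on $N_2$, $d\tau(g,h,k)=\tau(g,h)-\tau(g,hk)+\tau(gh,k)-\tau(h,k)$. Associators. $\varphi^{com}\big((W(d)c,k),(W(c)b,l),(W(b)a,m)\big)=(k-n+|W(d)c|)\,s(W(c)b,W(b)a)\in\mathbb{Z}/4\mathbb{Z}$.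 For each $C\in\mathcal{C}^n$, $\varphi_C^{ch}:N_3(\mathcal{G}^n)\to\mathbb{Z}/2\mathbb{Z}$ is the unique map such that for all $a,b,c,d\in B^n$ $$OF(C_{dba}\circ(C_{dcb}\sqcup\mathrm{Id}_{W(b)a}))=(-1)^{\varphi_C^{ch}(W(d)c,W(c)b,W(b)a)}OF(C_{dca}\circ(\mathrm{Id}_{W(d)c}\sqcup C_{cba})),$$ and $\psi_C:=2\varphi_C^{ch}+\varphi^{com}:N_3(\mathcal{G}^n\times\mathcal{Z})\to\mathbb{Z}/4\mathbb{Z}$, where $\varphi_C^{ch}$ is regarded as a map on $N_3(\mathcal{G}^n\times\mathcal{Z})$ by forgetting the integers. Twist. $\mathbb{Z}[i]$ is the ring of Gaussian integers. For $\tau:N_2(\mathcal{G}^n\times\mathcal{Z})\to\mathbb{Z}/4\mathbb{Z}$, the twisted algebra $(OH^n_C\otimes_{\mathbb{Z}}\mathbb{Z}[i])_{\tau}$ has the same underlying module with product $x*_\tau y:=i^{\tau(|x|,|y|)}xy$ for homogeneous $x,y$ of composable degrees (zero for non-composable degrees). *)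

(* Defs.v *)
From HB Require Import structures.
From mathcomp Require Import all_boot all_order all_algebra.
From mathcomp Require Import complex.

Set Implicit Arguments.
Unset Strict Implicit.
Unset Printing Implicit Defensive.

Import GRing.Theory.
Local Open Scope ring_scope.

(* Gaussian integers. The library puts a ring structure on [R[i]] only when R  *)
(* is a field, so the ring structure is declared here on an alias of [int[i]]. *)

Definition gaussInt : Type := complex int.
Definition gaussI : gaussInt := Complex 0 1.

HB.instance Definition _ := GRing.Zmodule.on gaussInt.

Fact gaussInt_mul1 : left_id (Complex 1 0 : gaussInt) (@ComplexField.mulc int).
Proof. by case=> a b; rewrite /= !mul1r !mul0r subr0 addr0. Qed.

Fact gaussInt_mulDl :
  left_distributive (@ComplexField.mulc int) (+%R : gaussInt -> _ -> _).
Proof.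
case=> [a b] [c d] [e f]; congr Complex; rewrite !mulrDl.
  by rewrite opprD addrACA.
by rewrite addrACA.
Qed.

Fact gaussInt_1neq0 : (Complex 1 0 : gaussInt) != 0.
Proof. by []. Qed.

HB.instance Definition _ := GRing.Zmodule_isComNzRing.Build gaussInt
  (@ComplexField.mulcA int) (@ComplexField.mulcC int)
  gaussInt_mul1 gaussInt_mulDl gaussInt_1neq0.

(* The exterior algebra over R of the free R-module on a finite type I. The    *)
(* function x stands for the sum over A of x(A) e_A, where e_A is the exterior *)
(* product, in the order of [enum I], of the generators belonging to A.        *)

Section Exterior.
Variable R : comNzRingType.

Definition ext (I : finType) := {ffun {set I} -> R^o}.

Section Product.
Variable I : finType.

Definition ext_basis (A : {set I}) : ext I := [ffun B : {set I} => (B == A)%:R].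

Definition ext_gen (i : I) : ext I := ext_basis [set i].

(* e_A e_B = (-1)^(inversions A B) e_(A :|: B) for disjoint A and B. *)
Definition inversions (A B : {set I}) : nat :=
  #|[set ij : I * I | [&& ij.1 \in A, ij.2 \in B &
                          (enum_rank ij.2 < enum_rank ij.1)%N]]|.

Definition wedge (x y : ext I) : ext I :=
  [ffun D : {set I} => \sum_(A : {set I} | A \subset D)
               (-1) ^+ inversions A (D :\: A) * (x A * y (D :\: A))].

Definition ext_part (j : nat) (x : ext I) : ext I :=
  [ffun A : {set I} => if #|A| == j then x A else 0].
End Product.

(* The algebra map induced by a map of the generators. *)
Definition ext_map (I J : finType) (f : I -> J) (x : ext I) : ext J :=
  \sum_(A : {set I})
    x A *: \big[@wedge J / ext_basis set0]_(i <- enum A) ext_gen (f i).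

End Exterior.

(* Points on the line are numbered from left to right, starting from 0, and a  *)
(* matching is the involution exchanging the two ends of every arc.            *)

Definition is_matching n (b : {ffun 'I_(2 * n) -> 'I_(2 * n)}) : bool :=
  [forall i, (b (b i) == i) && (b i != i)] &&
  [forall i : 'I_(2 * n), forall j : 'I_(2 * n),
     ~~ [&& (i < j)%N, (j < b i)%N & (b i < b j)%N]].

Definition matching n :=
  {b : {ffun 'I_(2 * n) -> 'I_(2 * n)} | is_matching b}.

Definition partner n (b : matching n) (i : 'I_(2 * n)) : 'I_(2 * n) := val b i.

(* Stacks. Matchings m 0, ..., m k.+1 give the diagram                         *)
(*   W(m k.+1) (m k) ... W(m 2) (m 1) W(m 1) (m 0)                             *)
(* with k.+1 lines, numbered from 0 at the bottom: the arcs of m r hang below  *)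
(* line r and those of W(m r.+1) stand on it. A saddle (l, i), for 1 <= l <= k,*)
(* contracts the arc of m l through i (between lines l.-1 and l) with its      *)
(* mirror image. A list s of saddles encodes the diagram in which all saddles  *)
(* of s have been performed. A circle is represented by one of its points, its *)
(* [root]; vertical strands are not shrunk, so that contracted lines persist   *)
(* as parallel copies.                                                         *)

Section Stack.
Variables (n k : nat) (m : nat -> matching n).

Definition point : finType := ('I_k.+1 * 'I_(2 * n))%type.
Definition saddle : Type := (nat * 'I_(2 * n))%type.

Definition contracted (s : seq saddle) (l : nat) (i : 'I_(2 * n)) : bool :=
  ((l, i) \in s) || ((l, partner (m l) i) \in s).

Definition below (s : seq saddle) (u : point) : point :=
  if contracted s u.1 u.2 then (inord u.1.-1, u.2)
  else (u.1, partner (m u.1) u.2).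

Definition above (s : seq saddle) (u : point) : point :=
  if contracted s u.1.+1 u.2 then (inord u.1.+1, u.2)
  else (u.1, partner (m u.1.+1) u.2).

Definition adjacent (s : seq saddle) : rel point :=
  [rel u v | (v == below s u) || (v == above s u)].

Definition circles (s : seq saddle) : finType :=
  {u : point | u \in codom (fingraph.root (adjacent s))}.

Definition circle_at (s : seq saddle) (u : point) : circles s :=
  exist _ (fingraph.root (adjacent s) u) (codom_f (fingraph.root (adjacent s)) u).

(* The saddle x = (l, i) splits the circle meeting both strands of the arc and *)
(* of its mirror image, or merges the two circles they belong to.              *)
Definition is_split (s : seq saddle) (x : saddle) : bool :=
  connect (adjacent s) (inord x.1.-1, x.2) (inord x.1, x.2).

(* An oriented saddle ((l, i), o): if o then a split is ordered from the circle*)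
(* through the strand at i to the one through the strand at the other end of   *)
(* the arc; otherwise the order is reversed.                                   *)
Definition oriented_saddle : Type := (saddle * bool)%type.

Definition strands (s : seq saddle) (x : oriented_saddle) :
    circles (x.1 :: s) * circles (x.1 :: s) :=
  let at_i := circle_at (x.1 :: s) (inord x.1.1, x.1.2) in
  let at_bi := circle_at (x.1 :: s) (inord x.1.1, partner (m x.1.1) x.1.2) in
  if x.2 then (at_i, at_bi) else (at_bi, at_i).

Variable R : comNzRingType.

Definition saddle_map (s : seq saddle) (x : oriented_saddle)
    (v : ext R (circles s)) : ext R (circles (x.1 :: s)) :=
  if is_split s x.1 then
    let a := circle_at s (inord x.1.1, x.1.2) in
    let: (b1, b2) := strands s x in
    wedge (ext_gen R b1 - ext_gen R b2)
      (ext_map (fun X => if X == a then b1 else circle_at (x.1 :: s) (val X)) v)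
  else ext_map (fun X => circle_at (x.1 :: s) (val X)) v.

Fixpoint performed (s : seq saddle) (xs : seq oriented_saddle) : seq saddle :=
  if xs is x :: xs' then performed (x.1 :: s) xs' else s.

Fixpoint saddle_maps (xs : seq oriented_saddle) (s : seq saddle) :
    ext R (circles s) -> ext R (circles (performed s xs)) :=
  match xs return ext R (circles s) -> ext R (circles (performed s xs)) with
  | [::] => fun v => v
  | x :: xs' => fun v => saddle_maps xs' (saddle_map x v)
  end.

Fixpoint split_count (s : seq saddle) (xs : seq oriented_saddle) : nat :=
  if xs is x :: xs' then (is_split s x.1 + split_count (x.1 :: s) xs')%N else 0.

End Stack.

(* W(b)a as a stack with a single line. *)

Definition chain n (a : matching n) (bs : seq (matching n)) (r : nat) :=
  nth a (a :: bs) r.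

Definition circ n (b a : matching n) : finType := circles 0 (chain a [:: b]) [::].

Definition circ_at n (b a : matching n) (i : 'I_(2 * n)) : circ b a :=
  circle_at (chain a [:: b]) [::] (ord0 : 'I_1, i).

(* A choice for C_cba only refers to the arcs of b; an arc is given by its     *)
(* left end. The orientation is recorded for every arc and is not used for the *)
(* saddles that turn out to be merges.                                         *)

Definition arcs n (b : matching n) : seq 'I_(2 * n) :=
  [seq i : 'I_(2 * n) <- enum 'I_(2 * n) | (i < partner b i)%N].

Definition surrounds n (b : matching n) (i j : 'I_(2 * n)) : bool :=
  (i < j)%N && (partner b j < partner b i)%N.

Record choice n (b : matching n) := Choice {
  order : seq 'I_(2 * n);
  orientation : 'I_(2 * n) -> bool;
  order_arcs : perm_eq order (arcs b);
  order_surrounds : {in order &, forall i j,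
    surrounds b i j -> (index i order < index j order)%N}
}.

Definition choices n := forall c b a : matching n, choice b.

(* The saddles of a choice, performed between lines l.-1 and l of a stack. *)
Definition saddles n (b : matching n) (C : choice b) (l : nat) :
    seq (oriented_saddle n) :=
  [seq ((l, i), orientation C i) | i <- order C].

Section OddArcAlgebra.
Variables (n : nat) (R : comNzRingType).

(* The map OF(W(c)b) (x) OF(W(b)a) -> OF(W(c)a) given by OF(C_cba). *)

Definition OF2 (C : choices n) (c b a : matching n)
    (x : ext R (circ c b)) (y : ext R (circ b a)) : ext R (circ c a) :=
  let m := chain a [:: b; c] in
  let line r (d e : matching n) (X : circ d e) :=
    circle_at (k := 1) m [::] (inord r, (val X).2) in
  ext_map (fun X => circ_at c a (val X).2)
    (saddle_maps (saddles (C c b a) 1)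
      (wedge (ext_map (line 1%N c b) x) (ext_map (line 0%N b a) y))).

(* OF of a composite W(d)c W(c)b W(b)a -> W(d)a, given by its saddles. *)
Definition OF3 (d c b a : matching n) (xs : seq (oriented_saddle n))
    (v : ext R (circles 2 (chain a [:: b; c; d]) [::])) : ext R (circ d a) :=
  ext_map (fun X => circ_at d a (val X).2) (saddle_maps xs v).

(* C_dba o (C_dcb u Id) and C_dca o (Id u C_cba). *)
Definition contract_upper_first (C : choices n) (d c b a : matching n) :=
  saddles (C d c b) 2 ++ saddles (C d b a) 1.
Definition contract_lower_first (C : choices n) (d c b a : matching n) :=
  saddles (C c b a) 1 ++ saddles (C d c a) 2.

End OddArcAlgebra.

Definition splits n (C : choices n) (c b a : matching n) : nat :=
  split_count 1 (chain a [:: b; c]) [::] (saddles (C c b a) 1).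

(* Since there is exactly one morphism between any two objects of the groupoid,*)
(* composable sequences of m morphisms are sequences of m.+1 matchings.        *)
(* [tau c b a k l] is tau ((W(c)b, k), (W(b)a, l)), and so on.                 *)

Definition cochain2 n :=
  matching n -> matching n -> matching n -> int -> int -> 'Z_4.
Definition cochain3 n :=
  matching n -> matching n -> matching n -> matching n ->
  int -> int -> int -> 'Z_4.

Definition coboundary n (tau : cochain2 n) : cochain3 n :=
  fun d c b a k l m =>
    tau d c b k l - tau d c a k (l + m) + tau d b a (k + l) m - tau c b a l m.

Definition phi_com n (C : choices n) : cochain3 n :=
  fun d c b a k l m =>
    ((k - n%:Z + #|circ d c|%:Z) * (splits C c b a)%:Z)%:~R.

Definition is_phi_ch n (C : choices n)
    (phi : matching n -> matching n -> matching n -> matching n -> 'Z_2) :=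
  forall (a b c d : matching n)
         (v : ext int (circles 2 (chain a [:: b; c; d]) [::])),
    OF3 (contract_upper_first C d c b a) v =
      (-1) ^+ phi d c b a *: OF3 (contract_lower_first C d c b a) v.

Definition psi n (C : choices n)
    (phi : matching n -> matching n -> matching n -> matching n -> 'Z_2) :
    cochain3 n :=
  fun d c b a k l m => (2 * phi d c b a)%N%:R + phi_com C d c b a k l m.

(* OH^n (x) Z[i] is the free Z[i]-module on the triples (c, b, A), where A is  *)
(* a set of circles of W(c)b, that is a basis element of c(OH^n)b.             *)

Definition OH_basis n : finType :=
  {p : matching n * matching n & {set circ p.1 p.2}}.

Definition OH n := {ffun OH_basis n -> gaussInt^o}.

Definition OH_comp n (c b : matching n) (x : OH n) : ext gaussInt (circ c b) :=
  [ffun A => x (Tagged (fun p => {set circ p.1 p.2}) (A : {set circ (c, b).1 (c, b).2}))].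

(* The degree of the products of j generators in c(OH^n)b. *)
Definition OH_degree n (c b : matching n) (j : nat) : int :=
  2 * j%:Z - #|circ c b|%:Z + n%:Z.

Definition twisted_comp n (C : choices n) (tau : cochain2 n)
    (c b a : matching n)
    (x : ext gaussInt (circ c b)) (y : ext gaussInt (circ b a)) :
    ext gaussInt (circ c a) :=
  \sum_(j < #|circ c b|.+1) \sum_(l < #|circ b a|.+1)
    gaussI ^+ tau c b a (OH_degree c b j) (OH_degree b a l) *:
      OF2 C (ext_part j x) (ext_part l y).

Definition twisted_mul n (C : choices n) (tau : cochain2 n) (x y : OH n) : OH n :=
  [ffun u => (\sum_(b : matching n)
     twisted_comp C tau (OH_comp (tag u).1 b x) (OH_comp b (tag u).2 y))
     (tagged u)].

(* Main.v *)
Require Import Defs.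
From HB Require Import structures.
From mathcomp Require Import all_boot all_order all_algebra.
From mathcomp Require Import all_fingroup zify ring.

Set Implicit Arguments.
Unset Strict Implicit.
Unset Printing Implicit Defensive.

Import GRing.Theory.
Local Open Scope ring_scope.

(* OF(C_cba) sends x and y to P x y, where P is the product, over the arcs of b *)
(* that give splits, of the differences of the circles of W(c)a at their ends.  *)
(* Changing the choices multiplies P by a sign eps, and wherever the triple     *)
(* products do not vanish, phi - phi' is the coboundary of eps. The cochain     *)
(* tau - tau' has the coboundary 2 (phi - phi'), which does not depend on the   *)
(* integer degrees; hence it is the sum of 2 e, where e is a cochain that does  *)
(* not depend on them either, and a coboundary. The cochain e + eps mod 2 is    *)
(* only closed where triple products do not vanish, and it is only needed where *)
(* P does not vanish. There it is a coboundary, up to a single possible         *)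
(* obstruction, its common value at the (t, A, t) with t one saddle away from   *)
(* the matching A that pairs 2i with 2i + 1. This obstruction is removed by an  *)
(* involution of the exterior algebras, circle_twist, which is multiplicative   *)
(* up to signs.                                                                 *)

(** * Exterior algebras *)

(** One element governs each product. Label every circle of an intermediate diagram by the circle of
    $W(c)a$ through one of its points. Behind the factors of the splits still to come, the choice of
    the point does not matter. Hence $OF(C_{cba})(x\wedge y)=P\wedge x\wedge y$ after relabelling,
    with $P$ = [split_prod] ([saddle_maps_label], [OF2_closed]). The factors of $P$ for $C$ and for
    $C'$ span the same lattice, so their products differ by a sign [eps] ([wprod_same_span],
    [epsP]). Where the composites to $W(d)a$ are nonzero, $\varphi-\varphi'=d\,$[eps] ([phi_eps]).

    The isomorphism multiplies degree $k$ of $c(OH^n)b$ by $i^{la(c,b,k)}(-1)^{mu(c,b)}$, possibly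
    after an involution. The terms $\varphi^{com}$ of $C$ and $C'$ agree, so $\tau-\tau'$ has the
    degree-free coboundary $2(\varphi-\varphi')$. As $H^2(\mathbb{Z})=0$, it is $2e_0+d\,la$ with
    $e_0$ degree-free ([coboundary_degree_free]). It remains to write $e_0+$[eps] as $d\,mu$ modulo
    2 wherever $P\neq0$.

    That cochain is closed only on quadruples with nonzero composite. Let $n-|W(b)a|$ be the
    distance of two matchings. Counting circles shows that it satisfies the triangle inequality,
    with equality through $b$ exactly when $(c,b,a)$ has no splits ([ncirc_splits]). Let $A$ pair
    $2i$ with $2i+1$, and let $B$ be the matching of the other neighbours. Every matching lies on a
    geodesic from $A$ to $B$ ([ncirc_A_B]), which yields many nonzero products. Normalised to vanish
    on all $(c,b,A)$, the cochain vanishes on triples without splits ([gauged_unit]). On steps of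
    length one it vanishes or equals the value at some $(t,A,t)$ ([gauged_cover]), and that value is
    the same for all $t$ ([gauged_transposition]). If it is 0, induction along geodesics finishes
    ([gauged_nz3]). If it is 1, the involution [circle_twist] corrects it: it is multiplicative up
    to the cocycle [twist_sign], whose value at $(t,A,t)$ is 1 ([twist_OF2], [twist_sign_tAt]). *)

Section ExtAlgebra.
Variable R : comNzRingType.
Implicit Types I J : finType.

Lemma scaleRo (a b : R) : a *: (b : R^o) = a * b. Proof. by []. Qed.

Lemma ext_basis_sum I (x : ext R I) :
  x = \sum_(A : {set I}) x A *: ext_basis R A.
Proof.
apply/ffunP=> B; rewrite sum_ffunE (bigD1 B) //= !ffunE eqxx scaleRo mulr1.
by rewrite big1 ?addr0 // => A AB; rewrite !ffunE eq_sym (negPf AB) scaleRo mulr0.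
Qed.

Section Wedge.
Variable I : finType.
Implicit Types (x y z : ext R I) (A B D : {set I}) (a b : R) (i j k : I) (l : seq (ext R I)).

Lemma wedgeDl x y z : wedge (x + y) z = wedge x z + wedge y z.
Proof.
apply/ffunP=> D; rewrite !ffunE -big_split; apply: eq_bigr => A _ /=.
by rewrite !ffunE mulrDl mulrDr.
Qed.

Lemma wedgeDr x y z : wedge x (y + z) = wedge x y + wedge x z.
Proof.
apply/ffunP=> D; rewrite !ffunE -big_split; apply: eq_bigr => A _ /=.
by rewrite !ffunE !mulrDr.
Qed.

Lemma wedgeZl a x y : wedge (a *: x) y = a *: wedge x y.
Proof.
apply/ffunP=> D; rewrite !ffunE scaler_sumr; apply: eq_bigr => A _ /=.
by rewrite !ffunE !scaleRo -mulrA mulrCA.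
Qed.

Lemma wedgeZr a x y : wedge x (a *: y) = a *: wedge x y.
Proof.
apply/ffunP=> D; rewrite !ffunE scaler_sumr; apply: eq_bigr => A _ /=.
by rewrite !ffunE !scaleRo (mulrCA (x A)) (mulrCA _ a).
Qed.

Lemma wedge0l x : wedge 0 x = 0.
Proof. by have := wedgeZl 0 0 x; rewrite !scale0r. Qed.

Lemma wedge0r x : wedge x 0 = 0.
Proof. by have := wedgeZr 0 x 0; rewrite !scale0r. Qed.

Lemma wedgeNl x y : wedge (- x) y = - wedge x y.
Proof. by rewrite -scaleN1r wedgeZl scaleN1r. Qed.

Lemma wedgeNr x y : wedge x (- y) = - wedge x y.
Proof. by rewrite -scaleN1r wedgeZr scaleN1r. Qed.

Lemma wedgeBr x y z : wedge x (y - z) = wedge x y - wedge x z.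
Proof. by rewrite wedgeDr wedgeNr. Qed.

Lemma wedge_suml (T : Type) (r : seq T) (P : pred T) (F : T -> ext R I) y :
  wedge (\sum_(t <- r | P t) F t) y = \sum_(t <- r | P t) wedge (F t) y.
Proof.
by apply: (big_morph (fun x => wedge x y)) => [u v|]; rewrite ?wedgeDl ?wedge0l.
Qed.

Lemma wedge_sumr (T : Type) (r : seq T) (P : pred T) (F : T -> ext R I) y :
  wedge y (\sum_(t <- r | P t) F t) = \sum_(t <- r | P t) wedge y (F t).
Proof.
by apply: (big_morph (wedge y)) => [u v|]; rewrite ?wedgeDr ?wedge0r.
Qed.

Lemma wedge_basis A B :
  wedge (ext_basis R A) (ext_basis R B) =
  if [disjoint A & B] then (-1) ^+ inversions A B *: ext_basis R (A :|: B) else 0.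
Proof.
apply/ffunP=> D; rewrite ffunE.
transitivity (if (A \subset D) && (D :\: A == B)
              then (-1) ^+ inversions A B else 0 : R).
  case AD: (A \subset D) => /=; last first.
    apply: big1 => A' A'D; rewrite !ffunE.
    by case: eqP A'D => [->|]; rewrite ?AD // mul0r mulr0.
  rewrite (bigD1 A) //= !ffunE eqxx mul1r big1 ?addr0; last first.
    by move=> A' /andP[_ nA]; rewrite !ffunE (negPf nA) mul0r mulr0.
  by case: eqP => [->|]; rewrite ?mulr1 ?mulr0.
have -> : (A \subset D) && (D :\: A == B) = [disjoint A & B] && (D == A :|: B).
  apply/andP/andP => [[sAD /eqP<-]|[dAB /eqP->]].
    split; first by rewrite disjoint_sym disjoints_subset setDE subsetIr.
    apply/eqP/setP=> u; rewrite !inE; have := subsetP sAD u.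
    by case: (u \in A) => [->|] //.
  split; first exact: subsetUl.
  rewrite setDUl setDv set0U; apply/eqP/setDidPl; by rewrite disjoint_sym.
case: [disjoint A & B] => /=; rewrite !ffunE //.
by case: eqP => _; rewrite scaleRo ?mulr1 ?mulr0.
Qed.

Lemma inversionsUr A B D :
  [disjoint B & D] -> inversions A (B :|: D) = (inversions A B + inversions A D)%N.
Proof.
move=> dBD; rewrite /inversions -cardsUI.
rewrite (_ : _ :&: _ = set0) ?cards0 ?addn0.
  apply: eq_card => ij; rewrite !inE; set r := (_ < _)%N.
  by case: (_ \in A); case: r; rewrite ?andbT ?andbF.
apply/setP=> ij; rewrite !inE; apply/negP=> /andP[/and3P[_ B2 _] /and3P[_ D2 _]].
by rewrite (disjointFr dBD) in D2.
Qed.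

Lemma inversionsUl A B D :
  [disjoint A & B] -> inversions (A :|: B) D = (inversions A D + inversions B D)%N.
Proof.
move=> dAB; rewrite /inversions -cardsUI.
rewrite (_ : _ :&: _ = set0) ?cards0 ?addn0.
  apply: eq_card => ij; rewrite !inE; set r := (_ < _)%N.
  by case: (_ \in D); case: r; rewrite ?andbT ?andbF.
apply/setP=> ij; rewrite !inE; apply/negP=> /andP[/and3P[A1 _ _] /and3P[B1 _ _]].
by rewrite (disjointFr dAB) in B1.
Qed.

Lemma wedge_basisA A B D :
  wedge (ext_basis R A) (wedge (ext_basis R B) (ext_basis R D)) =
  wedge (wedge (ext_basis R A) (ext_basis R B)) (ext_basis R D).
Proof.
rewrite !wedge_basis.
case dBD: [disjoint B & D]; case dAB: [disjoint A & B];
  rewrite ?wedge0l ?wedge0r ?wedgeZl ?wedgeZr ?wedge_basis //.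
- have -> : [disjoint A & B :|: D] = [disjoint A :|: B & D].
    rewrite -!setI_eq0 setIUr setIUl.
    by move: dAB dBD; rewrite -!setI_eq0 => /eqP-> /eqP->; rewrite set0U setU0.
  case: ifP => [_|_]; last by rewrite !scaler0.
  rewrite !scalerA -!exprD setUA inversionsUr // inversionsUl //.
  by rewrite [in LHS]addnC -addnA.
- rewrite -setI_eq0 setIUr setU_eq0 setI_eq0 dAB /= scaler0 //.
- rewrite -setI_eq0 setIUl setU_eq0 !setI_eq0 dBD andbF scaler0 //.
Qed.

Lemma wedgeA : associative (@wedge R I).
Proof.
move=> x y z; rewrite (ext_basis_sum x) !wedge_suml.
apply: eq_bigr => A _; rewrite !wedgeZl; congr (_ *: _).
rewrite (ext_basis_sum y) wedge_suml !wedge_sumr wedge_suml.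
apply: eq_bigr => B _; rewrite !(wedgeZl, wedgeZr); congr (_ *: _).
rewrite (ext_basis_sum z) !wedge_sumr.
apply: eq_bigr => D _; rewrite !wedgeZr; congr (_ *: _).
exact: wedge_basisA.
Qed.

Lemma wedge1l : left_id (ext_basis R set0) (@wedge R I).
Proof.
move=> x; rewrite (ext_basis_sum x) wedge_sumr; apply: eq_bigr => A _.
rewrite wedgeZr wedge_basis -setI_eq0 set0I eqxx set0U /inversions.
rewrite (_ : [set _ | _] = set0) ?cards0 ?scale1r //.
by apply/setP=> u; rewrite !inE.
Qed.

Lemma wedge1r : right_id (ext_basis R set0) (@wedge R I).
Proof.
move=> x; rewrite (ext_basis_sum x) wedge_suml; apply: eq_bigr => A _.
rewrite wedgeZl wedge_basis -setI_eq0 setI0 eqxx setU0 /inversions.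
rewrite (_ : [set _ | _] = set0) ?cards0 ?scale1r //.
by apply/setP=> u; rewrite !inE andbF.
Qed.

HB.instance Definition _ :=
  Monoid.isLaw.Build (ext R I) (ext_basis R set0) (@wedge R I) wedgeA wedge1l wedge1r.

Lemma inversions1 i B :
  inversions [set i] B = #|[set j in B | (enum_rank j < enum_rank i)%N]|.
Proof.
rewrite /inversions -[RHS](card_imset _ (_ : injective (pair i))); last by move=> ? ? [].
apply: eq_card => -[i' j]; rewrite inE /=; apply/and3P/imsetP => [[]|[j' jP [-> ->]]].
  by rewrite inE => /eqP-> jB ltj; exists j; rewrite // inE jB.
by move: jP; rewrite !inE => /andP[-> ->].
Qed.

Definition deg1 (x : ext R I) :=
  exists v : I -> R, x = \sum_i v i *: ext_gen R i.

Lemma deg1_gen i : deg1 (ext_gen R i).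
Proof.
exists (fun j => (j == i)%:R); rewrite (bigD1 i) //= eqxx scale1r big1 ?addr0 //.
by move=> j /negPf->; rewrite scale0r.
Qed.

Lemma deg1D x y : deg1 x -> deg1 y -> deg1 (x + y).
Proof.
move=> [v ->] [w ->]; exists (fun i => v i + w i); rewrite -big_split.
by apply: eq_bigr => i _; rewrite scalerDl.
Qed.

Lemma deg1Z a x : deg1 x -> deg1 (a *: x).
Proof.
move=> [v ->]; exists (fun i => a * v i); rewrite scaler_sumr.
by apply: eq_bigr => i _; rewrite scalerA.
Qed.

Lemma deg1_0 : deg1 0.
Proof. by exists (fun=> 0); rewrite big1 // => i _; rewrite scale0r. Qed.

Lemma deg1N x : deg1 x -> deg1 (- x).
Proof. by move=> dx; rewrite -scaleN1r; apply: deg1Z. Qed.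

Lemma deg1B x y : deg1 x -> deg1 y -> deg1 (x - y).
Proof. by move=> dx dy; apply/deg1D/deg1N. Qed.

Lemma deg1_sum (T : Type) (r : seq T) (P : pred T) (F : T -> ext R I) :
  (forall t, P t -> deg1 (F t)) -> deg1 (\sum_(t <- r | P t) F t).
Proof. by apply: big_ind => //; [exact: deg1_0 | exact: deg1D]. Qed.

Lemma wedge_gen_gen i j : i != j ->
  wedge (ext_gen R i) (ext_gen R j) =
  (-1) ^+ (enum_rank j < enum_rank i)%N *: ext_basis R [set i; j].
Proof.
move=> nij; rewrite wedge_basis disjoints1 inE nij inversions1.
congr (_ ^+ _ *: _); case: ltnP => [lt|le].
  rewrite -[RHS](cards1 j); apply: eq_card => k; rewrite !inE.
  by case: eqP => //= ->; rewrite lt.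
rewrite -[RHS](cards0 I); apply: eq_card => k; rewrite !inE.
by case: eqP => //= ->; rewrite ltnNge le.
Qed.

Lemma wedge_gen_sqr i : wedge (ext_gen R i) (ext_gen R i) = 0.
Proof. by rewrite wedge_basis disjoints1 inE eqxx. Qed.

Lemma wedge_gen_anti i j :
  wedge (ext_gen R i) (ext_gen R j) = - wedge (ext_gen R j) (ext_gen R i).
Proof.
case: (eqVneq i j) => [->|nij]; first by rewrite wedge_gen_sqr oppr0.
rewrite !wedge_gen_gen // 1?eq_sym // setUC -scaleNr; congr (_ *: _).
have: enum_rank i != enum_rank j by rewrite (inj_eq enum_rank_inj).
by rewrite -val_eqE /=; case: ltngtP => // _ _; rewrite ?expr0 ?expr1 ?opprK.
Qed.

Lemma deg1_anti x y : deg1 x -> deg1 y -> wedge x y = - wedge y x.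
Proof.
move=> [v ->] [w ->]; rewrite !wedge_suml -sumrN.
under eq_bigr do rewrite wedge_sumr.
rewrite exchange_big /=; apply: eq_bigr => j _.
rewrite wedge_sumr -sumrN; apply: eq_bigr => i _.
by rewrite !wedgeZl !wedgeZr wedge_gen_anti !scalerN !scalerA mulrC.
Qed.

Lemma deg1_sqr x : deg1 x -> wedge x x = 0.
Proof.
move=> [v ->]; elim: (index_enum I) => [|i r IH]; first by rewrite big_nil wedge0l.
rewrite big_cons; set S := \sum_(_ <- r) _ in IH *.
have dg : deg1 (v i *: ext_gen R i) by apply/deg1Z/deg1_gen.
have dS : deg1 S by apply: deg1_sum => j _; apply/deg1Z/deg1_gen.
rewrite wedgeDl !wedgeDr IH addr0 (deg1_anti dS dg) wedgeZl wedgeZr wedge_gen_sqr.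
by rewrite !scaler0 add0r subrr.
Qed.

Definition wprod (l : seq (ext R I)) : ext R I :=
  \big[@wedge R I / ext_basis R set0]_(x <- l) x.

Lemma wprod_nil : wprod [::] = ext_basis R set0.
Proof. exact: big_nil. Qed.

Lemma wprod_cons x l : wprod (x :: l) = wedge x (wprod l).
Proof. exact: big_cons. Qed.

Lemma wprod_cat l1 l2 : wprod (l1 ++ l2) = wedge (wprod l1) (wprod l2).
Proof. exact: big_cat. Qed.

Lemma wprod_rcons l x : wprod (rcons l x) = wedge (wprod l) x.
Proof. by rewrite -cats1 wprod_cat wprod_cons wprod_nil wedge1r. Qed.

Definition all_deg1 (l : seq (ext R I)) := forall x, x \in l -> deg1 x.

Lemma all_deg1_cons x l : all_deg1 (x :: l) -> deg1 x /\ all_deg1 l.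
Proof.
by move=> dl; split=> [|y ly]; apply: dl; rewrite inE ?eqxx // ly orbT.
Qed.

Lemma wprod_move x l : deg1 x -> all_deg1 l ->
  wedge x (wprod l) = (-1) ^+ size l *: wedge (wprod l) x.
Proof.
move=> dx; elim: l => [|y l IH] dl; first by rewrite wprod_nil wedge1l wedge1r scale1r.
have [dy {}dl] := all_deg1_cons dl.
rewrite wprod_cons wedgeA (deg1_anti dx dy) wedgeNl -wedgeA IH // wedgeZr.
by rewrite -wedgeA exprS -scalerA scaleN1r.
Qed.

Lemma wprod_mem x l : all_deg1 l -> x \in l -> wedge (wprod l) x = 0.
Proof.
elim: l => // y l IH dl; have [dy {}dl] := all_deg1_cons dl.
rewrite inE wprod_cons -wedgeA; have [->|_ /=] := eqVneq x y; last first.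
  by move=> xl; rewrite IH ?wedge0r.
move=> _; have := wprod_move dy dl; move/(congr1 (fun z => (-1) ^+ size l *: z)).
rewrite signrZK => <-.
by rewrite wedgeZr wedgeA deg1_sqr // wedge0l scaler0.
Qed.

Lemma ext_gen_basis i B : i \notin B ->
  wedge (ext_gen R i) (ext_basis R B) =
  (-1) ^+ #|[set j in B | (enum_rank j < enum_rank i)%N]| *: ext_basis R (i |: B).
Proof. by move=> iB; rewrite wedge_basis disjoints1 iB inversions1. Qed.

(** Up to sign a basis element is a generator times a smaller basis element. *)
Lemma ext_ind (P : ext R I -> Prop) :
  (forall a x y, P x -> P y -> P (a *: x + y)) -> P (ext_basis R set0) ->
  (forall i x, P x -> P (wedge (ext_gen R i) x)) -> forall x, P x.
Proof.
move=> Plin P1 Pgen x.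
have P0 : P 0 by have := Plin (-1) _ _ P1 P1; rewrite scaleN1r addNr.
rewrite (ext_basis_sum x); apply: big_ind => // [u v Pu Pv|A _].
  by have := Plin 1 _ _ Pu Pv; rewrite scale1r.
suff PA : P (ext_basis R A) by have := Plin (x A) _ _ PA P0; rewrite addr0.
have [m] := ubnP #|A|; elim: m A => // m IH A ltA.
have [->|/set0Pn[i iA]] := eqVneq A set0 => //.
have := @ext_gen_basis i (A :\ i); rewrite !inE eqxx setD1K // => /(_ isT).
move/(congr1 (fun z => (-1) ^+ #|[set j in A :\ i | (enum_rank j < enum_rank i)%N]| *: z)).
rewrite signrZK => <-.
rewrite -[_ *: _]addr0; apply: Plin => //; apply: Pgen; apply: IH.
by move: ltA; rewrite (cardsD1 i) iA.
Qed.

End Wedge.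

Section Hom.
Variables I J : finType.
Implicit Types (x y : ext R I) (i : I).

(** Generators may go to arbitrary elements, not only to generators as in [ext_map]; [circle_twist]
    needs this. It is an algebra map once the images are linear forms. *)
Definition ext_hom (g : I -> ext R J) (x : ext R I) : ext R J :=
  \sum_(A : {set I}) x A *: wprod [seq g i | i <- enum A].

Lemma ext_mapE (f : I -> J) x : ext_map f x = ext_hom (fun i => ext_gen R (f i)) x.
Proof. by apply: eq_bigr => A _; rewrite /wprod big_map. Qed.

Variable g : I -> ext R J.

Lemma ext_homD x y : ext_hom g (x + y) = ext_hom g x + ext_hom g y.
Proof. by rewrite -big_split; apply: eq_bigr => A _; rewrite ffunE scalerDl. Qed.

Lemma ext_homZ a x : ext_hom g (a *: x) = a *: ext_hom g x.
Proof. by rewrite scaler_sumr; apply: eq_bigr => A _; rewrite ffunE scalerA. Qed.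

Lemma ext_homN x : ext_hom g (- x) = - ext_hom g x.
Proof. by rewrite -scaleN1r ext_homZ scaleN1r. Qed.

Lemma ext_homB x y : ext_hom g (x - y) = ext_hom g x - ext_hom g y.
Proof. by rewrite ext_homD ext_homN. Qed.

HB.instance Definition _ := GRing.isLinear.Build R (ext R I) (ext R J) *:%R (ext_hom g)
  (fun k x y => etrans (ext_homD _ _) (congr1 (+%R^~ _) (ext_homZ _ _))).

Lemma ext_hom0 : ext_hom g 0 = 0.
Proof. by rewrite /ext_hom big1 // => A _; rewrite ffunE scale0r. Qed.

Lemma ext_hom_sum (T : Type) (r : seq T) (P : pred T) (F : T -> ext R I) :
  ext_hom g (\sum_(t <- r | P t) F t) = \sum_(t <- r | P t) ext_hom g (F t).
Proof. by apply: (big_morph (ext_hom g)) => [u v|]; rewrite ?ext_homD ?ext_hom0. Qed.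

Lemma ext_hom_basis A : ext_hom g (ext_basis R A) = wprod [seq g i | i <- enum A].
Proof.
rewrite /ext_hom (bigD1 A) //= ffunE eqxx scale1r big1 ?addr0 // => B /negPf nBA.
by rewrite ffunE nBA scale0r.
Qed.

Lemma ext_hom1 : ext_hom g (ext_basis R set0) = ext_basis R set0.
Proof. by rewrite ext_hom_basis enum_set0 wprod_nil. Qed.

Lemma ext_hom_gen i : ext_hom g (ext_gen R i) = g i.
Proof. by rewrite ext_hom_basis enum_set1 wprod_cons wprod_nil wedge1r. Qed.

Hypothesis g1 : forall i, deg1 (g i).

Lemma all_deg1_map (l : seq I) : all_deg1 [seq g i | i <- l].
Proof. by move=> x /mapP[i _ ->]; apply: g1. Qed.

(** If [i] lies in [B], both sides vanish by repetition of a linear form. Otherwise moving [g i]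
    past the images of the elements of [B] that precede [i] produces the sign of [inversions]. *)
Lemma ext_hom_gen_basis i B :
  ext_hom g (wedge (ext_gen R i) (ext_basis R B)) =
  wedge (g i) (ext_hom g (ext_basis R B)).
Proof.
rewrite ext_hom_basis; have [iB|iB] := boolP (i \in B).
  rewrite wedge_basis disjoints1 iB ext_hom0; symmetry.
  by rewrite wprod_move ?wprod_mem ?scaler0 ?map_f ?mem_enum //; apply: all_deg1_map.
rewrite ext_gen_basis // ext_homZ ext_hom_basis.
have [l1 [l2 def_I]] : exists l1 l2, enum I = l1 ++ i :: l2.
  have /splitPr[l1 l2] : i \in enum I by rewrite mem_enum.
  by exists l1, l2.
have := enum_uniq I; rewrite def_I cat_uniq /= => /and3P[_ /norP[i1 l12] /andP[i2 _]].
have enumF (D : {set I}) : enum D = filter (mem D) (enum I) by rewrite enumT.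
have filtF l : i \notin l -> filter (mem (i |: B)) l = filter (mem B) l.
  move=> il; apply: eq_in_filter => j jl; rewrite !inE.
  by case: eqP jl il => // -> ->.
rewrite !enumF def_I !filter_cat /= !inE eqxx (negPf iB) /= !filtF //.
rewrite !map_cat map_cons !wprod_cat wprod_cons [in RHS]wedgeA [in RHS](wprod_move (g1 i)) //; last first.
  exact: all_deg1_map.
rewrite wedgeZl -wedgeA size_map; congr ((-1) ^+ _ *: _).
rewrite cardE enumF def_I filter_cat size_cat /= inE (negPf iB) /=.
have rankE j : nat_of_ord (enum_rank j) = index j (enum I).
  by rewrite -{2}(nth_enum_rank j j) index_uniq ?enum_uniq // -cardE.
have -> : [seq x <- l2 | x \in [set j in B | (enum_rank j < enum_rank i)%N]] = [::].
  apply/eqP; rewrite -[_ == _]negbK -has_filter; apply/hasPn => j jl2.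
  rewrite inE !rankE def_I !index_cat (negPf i1) /= eqxx addn0 negb_and -leqNgt.
  by rewrite (_ : j \in l1 = false) ?leq_addr ?orbT //; apply/negP => jl1; case/negP: (hasPn l12 j jl2).
rewrite addn0; congr size; apply: eq_in_filter => j jl1; rewrite !inE !rankE def_I.
by rewrite !index_cat jl1 (negPf i1) /= eqxx addn0 index_mem jl1 andbT.
Qed.

Lemma ext_hom_genM i y :
  ext_hom g (wedge (ext_gen R i) y) = wedge (g i) (ext_hom g y).
Proof.
rewrite (ext_basis_sum y) wedge_sumr !ext_hom_sum wedge_sumr.
apply: eq_bigr => B _.
by rewrite wedgeZr !ext_homZ wedgeZr ext_hom_gen_basis.
Qed.

Lemma ext_homM x y :
  ext_hom g (wedge x y) = wedge (ext_hom g x) (ext_hom g y).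
Proof.
elim/ext_ind: x => [a u v IHu IHv||i u IHu].
- by rewrite wedgeDl wedgeZl !(ext_homD, ext_homZ) wedgeDl wedgeZl IHu IHv.
- by rewrite ext_hom1 !wedge1l.
- by rewrite -wedgeA !ext_hom_genM IHu wedgeA.
Qed.

Lemma ext_hom_wprod (l : seq (ext R I)) :
  ext_hom g (wprod l) = wprod [seq ext_hom g x | x <- l].
Proof.
elim: l => [|x l IH]; first by rewrite !wprod_nil ext_hom1.
by rewrite map_cons !wprod_cons ext_homM IH.
Qed.

Lemma ext_hom_deg1 x : deg1 x -> deg1 (ext_hom g x).
Proof.
move=> [v ->]; rewrite ext_hom_sum; apply: deg1_sum => i _.
by rewrite ext_homZ ext_hom_gen; apply: deg1Z.
Qed.

End Hom.

Lemma eq_ext_hom I J (g h : I -> ext R J) : g =1 h -> ext_hom g =1 ext_hom h.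
Proof.
by move=> gh x; apply: eq_bigr => A _; congr (_ *: wprod _); apply: eq_map.
Qed.

Lemma ext_hom_comp I J K (g : I -> ext R J) (h : J -> ext R K) x :
  (forall i, deg1 (g i)) -> (forall j, deg1 (h j)) ->
  ext_hom h (ext_hom g x) = ext_hom (fun i => ext_hom h (g i)) x.
Proof.
move=> g1 h1; have hg1 i : deg1 (ext_hom h (g i)) by apply: ext_hom_deg1.
elim/ext_ind: x => [a u v IHu IHv||i u IHu].
- by rewrite !(ext_homD, ext_homZ) IHu IHv.
- by rewrite !ext_hom1.
- by rewrite !ext_hom_genM // ext_homM // IHu.
Qed.

Lemma ext_hom_id I (x : ext R I) : ext_hom (ext_gen R (I := I)) x = x.
Proof.
have g1 := @deg1_gen I.
elim/ext_ind: x => [a u v IHu IHv||i u IHu].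
- by rewrite !(ext_homD, ext_homZ) IHu IHv.
- by rewrite !ext_hom1.
- by rewrite !ext_hom_genM // IHu.
Qed.

(** Only the images of the generators modulo the annihilator of [w] matter. In the induction the
    first factor is absorbed into [w], which keeps killing the differences because linear forms
    anticommute. *)
Lemma wedge_ext_hom_eq I J (g h : I -> ext R J) (w : ext R J) x :
  (forall i, deg1 (g i)) -> (forall i, deg1 (h i)) ->
  (forall i, wedge w (g i - h i) = 0) ->
  wedge w (ext_hom g x) = wedge w (ext_hom h x).
Proof.
move=> g1 h1; elim/ext_ind: x w => [a u v IHu IHv|| i u IHu] w gh.
- by rewrite !(ext_homD, ext_homZ) !(wedgeDr, wedgeZr) IHu // IHv.
- by rewrite !ext_hom1.
- have gh_i : wedge w (g i) = wedge w (h i).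
    by apply/eqP; rewrite -subr_eq0 -wedgeBr gh.
  rewrite !ext_hom_genM // !wedgeA gh_i; apply: IHu => j.
  rewrite -wedgeA (deg1_anti (h1 i) (deg1B (g1 j) (h1 j))).
  by rewrite wedgeNr wedgeA gh wedge0l oppr0.
Qed.

Lemma wedge_kill I (w x e : ext R I) :
  deg1 e -> wedge w e = 0 -> wedge (wedge w x) e = 0.
Proof.
move=> de; elim/ext_ind: x w => [a u v IHu IHv||i u IHu] w we.
- by rewrite wedgeDr wedgeZr wedgeDl wedgeZl IHu // IHv // scaler0 addr0.
- by rewrite wedge1r.
- rewrite wedgeA; apply: IHu; rewrite -wedgeA (deg1_anti (deg1_gen i) de).
  by rewrite wedgeNr wedgeA we wedge0l oppr0.
Qed.

Lemma wedge_ext_hom_eq2 I1 I2 J (g h : I1 -> ext R J) (g' h' : I2 -> ext R J)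
  (w : ext R J) x y :
  (forall i, deg1 (g i)) -> (forall i, deg1 (h i)) ->
  (forall i, deg1 (g' i)) -> (forall i, deg1 (h' i)) ->
  (forall i, wedge w (g i - h i) = 0) -> (forall i, wedge w (g' i - h' i) = 0) ->
  wedge w (wedge (ext_hom g x) (ext_hom g' y)) =
  wedge w (wedge (ext_hom h x) (ext_hom h' y)).
Proof.
move=> g1 h1 g1' h1' gh gh'; rewrite !wedgeA (wedge_ext_hom_eq x g1 h1 gh).
apply: wedge_ext_hom_eq => // i.
exact: wedge_kill (deg1B (g1' i) (h1' i)) (gh' i).
Qed.

End ExtAlgebra.

(** * Products of linear forms with a given span *)

Section Span.
Variables (R : comNzRingType) (I : finType).
Implicit Types (x y e f : ext R I) (l E F : seq (ext R I)).

Fixpoint lspan l x : Prop :=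
  if l is e :: l' then exists a y, lspan l' y /\ x = a *: e + y else x = 0.

Lemma lspan0 l : lspan l 0.
Proof. by elim: l => //= e l IH; exists 0, 0; rewrite scale0r addr0. Qed.

Lemma lspanD l x y : lspan l x -> lspan l y -> lspan l (x + y).
Proof.
elim: l x y => [|e l IH] x y /= => [-> ->|[a [u [Su ->]]] [b [v [Sv ->]]]].
  by rewrite addr0.
by exists (a + b), (u + v); rewrite scalerDl addrACA; split=> //; apply: IH.
Qed.

Lemma lspanZ l a x : lspan l x -> lspan l (a *: x).
Proof.
elim: l x => [|e l IH] x /= => [->|[b [u [Su ->]]]]; first by rewrite scaler0.
by exists (a * b), (a *: u); rewrite scalerDr scalerA; split=> //; apply: IH.
Qed.

Lemma lspanN l x : lspan l x -> lspan l (- x).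
Proof. by move=> Sx; rewrite -scaleN1r; apply: lspanZ. Qed.

Lemma lspanB l x y : lspan l x -> lspan l y -> lspan l (x - y).
Proof. by move=> Sx Sy; apply/lspanD/lspanN. Qed.

Lemma lspan_sum (T : Type) (r : seq T) (P : pred T) (G : T -> ext R I) l :
  (forall t, P t -> lspan l (G t)) -> lspan l (\sum_(t <- r | P t) G t).
Proof. by apply: big_ind => //; [exact: lspan0 | move=> *; exact: lspanD]. Qed.

Lemma lspan_consr l e x : lspan l x -> lspan (e :: l) x.
Proof. by move=> Sx; exists 0, x; rewrite scale0r add0r. Qed.

Lemma lspan_mem l x : x \in l -> lspan l x.
Proof.
elim: l => // e l IH; rewrite inE => /orP[/eqP->|/IH]; last exact: lspan_consr.
by exists 1, 0; rewrite scale1r addr0; split=> //; apply: lspan0.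
Qed.

Lemma lspan_trans l1 l2 x : (forall y, y \in l1 -> lspan l2 y) -> lspan l1 x -> lspan l2 x.
Proof.
elim: l1 x => [|e l1 IH] x l12 /= => [->|[a [u [Su ->]]]]; first exact: lspan0.
apply: lspanD; first by apply/lspanZ/l12; rewrite inE eqxx.
by apply: IH Su => y yl; apply: l12; rewrite inE yl orbT.
Qed.

Lemma lspan_sub l1 l2 x : {subset l1 <= l2} -> lspan l1 x -> lspan l2 x.
Proof. by move=> l12; apply: lspan_trans => y /l12; apply: lspan_mem. Qed.

Lemma lspan_deg1 l x : all_deg1 l -> lspan l x -> deg1 x.
Proof.
elim: l x => [|e l IH] x dl /= => [->|[a [u [Su ->]]]]; first exact: deg1_0.
have [de {}dl] := all_deg1_cons dl.
by apply: deg1D; [apply: deg1Z | apply: IH].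
Qed.

Lemma wprod_span l x : all_deg1 l -> lspan l x -> wedge (wprod l) x = 0.
Proof.
move=> dl Sx; have: forall y, lspan l y -> {subset l <= l} ->
  wedge (wprod l) y = 0; last by apply.
move: {1 2}l => l'; elim: l' => [|e l' IH] y /= => [-> _|[a [u [Su ->]]] sl].
  exact: wedge0r.
rewrite wedgeDr wedgeZr wprod_mem //; last by apply: sl; rewrite inE eqxx.
by rewrite scaler0 add0r IH // => z zl; apply: sl; rewrite inE zl orbT.
Qed.

Lemma wprod_span_cons e E F : deg1 e -> all_deg1 E ->
  (forall f, f \in F -> lspan (e :: E) f) ->
  exists (F' : seq (ext R I)) (Y : seq (R * seq (ext R I))),
  [/\ size F' = size F, forall f, f \in F' -> lspan E f,
      forall p, p \in Y -> (size p.2).+1 = size F /\ (forall f, f \in p.2 -> lspan E f)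
    & wprod F = wprod F' + wedge e (\sum_(p <- Y) p.1 *: wprod p.2)].
Proof.
move=> de dE; elim: F => [|f F IH] FE.
  by exists [::], [::]; rewrite big_nil wedge0r addr0; split.
case: IH => [h hF|F' [Y [sF' F'E YE defF]]]; first by apply: FE; rewrite inE hF orbT.
have [a [f' [f'E def_f]]] := FE f (mem_head _ _).
exists (f' :: F'), ((a, F') :: [seq (- p.1, f' :: p.2) | p <- Y]); split=> /=.
- by rewrite sF'.
- by move=> h; rewrite inE => /orP[/eqP->|/F'E].
- move=> p; rewrite inE => /orP[/eqP->|/mapP[q /YE[sq qE] ->]] /=.
    by rewrite sF'.
  by rewrite sq; split=> // h; rewrite inE => /orP[/eqP->|/qE].
have df' := lspan_deg1 dE f'E.
rewrite !wprod_cons big_cons big_map /= defF def_f wedgeDl !wedgeDr wedgeZl.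
rewrite (wedgeZl a e (wedge e _)) wedgeA deg1_sqr // wedge0l scaler0 addr0.
rewrite addrC -addrA wedgeZr; congr (_ + _); rewrite addrC; congr (_ + _).
rewrite wedgeA (deg1_anti df' de) wedgeNl -wedgeA -wedgeNr.
congr (wedge e _); rewrite wedge_sumr -sumrN.
by apply: eq_bigr => p _; rewrite wprod_cons wedgeZr scaleNr.
Qed.

(* A wedge product of vectors of the lspan of E expands, factor by factor, into *)
(* multiples of the product of E, with no term left once there are too many.   *)
Lemma wprod_span_multiple E F : all_deg1 E -> (forall f, f \in F -> lspan E f) ->
  ((size E < size F)%N -> wprod F = 0) /\
  (size E = size F -> exists k, wprod F = k *: wprod E).
Proof.
elim: E F => [|e E IH] F dE FE.
  case: F FE => [|f F] FE; split=> //= _; first by exists 1; rewrite scale1r.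
  by rewrite wprod_cons (FE f (mem_head _ _)) wedge0l.
have [de {}dE] := all_deg1_cons dE.
have [F' [Y [sF' F'E YE ->]]] := wprod_span_cons de dE FE.
have [F'0 _] := IH F' dE F'E; rewrite sF' in F'0.
split=> /= szF.
  rewrite F'0 1?ltnW // add0r big_seq big1 ?wedge0r // => p pY.
  have [sp pE] := YE p pY; have [p0 _] := IH p.2 dE pE.
  by rewrite p0 ?scaler0 // -ltnS sp.
rewrite F'0 -?szF // add0r.
suff [k ->] : exists k, \sum_(p <- Y) p.1 *: wprod p.2 = k *: wprod E.
  by exists k; rewrite wedgeZr wprod_cons.
rewrite big_seq; apply: (big_ind (fun u => exists k, u = k *: wprod E)).
- by exists 0; rewrite scale0r.
- by move=> _ _ [k ->] [k' ->]; exists (k + k'); rewrite scalerDl.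
move=> p pY; have [sp pE] := YE p pY.
have [_ [|k ->]] := IH p.2 dE pE; first by apply: succn_inj; rewrite sp.
by exists (p.1 * k); rewrite scalerA.
Qed.

End Span.

(** The products are integer multiples of each other, by [k] and [k']. If they are nonzero,
    torsion-freeness gives [k' * k = 1], so [k] is a unit of $\mathbb{Z}$. *)
Lemma wprod_same_span (I : finType) (E F : seq (ext int I)) :
  all_deg1 E -> all_deg1 F -> size E = size F ->
  (forall f, f \in F -> lspan E f) -> (forall e, e \in E -> lspan F e) ->
  exists s : bool, wprod F = (-1) ^+ s *: wprod E.
Proof.
move=> dE dF szEF FE EF.
have [_ /(_ szEF)[k Fk]] := wprod_span_multiple dE FE.
have [_ /(_ (esym szEF))[k' Ek]] := wprod_span_multiple dF EF.
have [E0|/eqP nzE] := eqVneq (wprod E) 0; first by exists false; rewrite Fk E0 !scaler0.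
have k'k : k' * k = 1.
  case: (eqVneq (k' * k) 1) => // nk; case: nzE; apply/ffunP=> A; rewrite !ffunE.
  move: Ek; rewrite Fk scalerA => /ffunP/(_ A); rewrite ffunE scaleRo => EkA.
  apply/eqP; apply: contraNT nk => nzA; apply/eqP/(mulIf nzA).
  by rewrite mul1r -EkA.
have kE : k = 1 \/ k = -1.
  have: (`|k'| * `|k|)%N == 1%N by rewrite -abszM k'k.
  by rewrite muln_eq1 => /andP[_]; case: k {Fk Ek k'k} => -[|[|m]] //= _; [left|right].
by rewrite Fk; case: kE => ->; [exists false | exists true].
Qed.

Lemma ext_eq_oppr (I : finType) (x : ext int I) : x = - x -> x = 0.
Proof.
move=> /ffunP xN; apply/ffunP=> A; have := xN A; rewrite !ffunE => xA.
have /eqP : x A *+ 2 == 0 by rewrite mulr2n {1}xA addNr.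
by move=> /eqP; rewrite Num.Theory.mulrn_eq0 => /eqP.
Qed.

Lemma signz_eq (I : finType) (x : ext int I) (s t : bool) :
  x != 0 -> (-1) ^+ s *: x = (-1) ^+ t *: x -> s = t.
Proof.
move=> nx; case: s t => -[] //; rewrite expr0 expr1 scale1r scaleN1r => xN.
  by rewrite (ext_eq_oppr (esym xN)) eqxx in nx.
by rewrite (ext_eq_oppr xN) eqxx in nx.
Qed.

Section NonZero.
Variables (R : comNzRingType) (I : finType).

Lemma ext_basis_neq0 (A : {set I}) : ext_basis R A != 0.
Proof.
apply/eqP=> /ffunP/(_ A); rewrite !ffunE eqxx => /eqP.
by rewrite oner_eq0.
Qed.

Lemma ext_gen_diff_neq0 (u v : I) : u != v -> ext_gen R u - ext_gen R v != 0.
Proof.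
move=> nuv; apply/eqP=> /ffunP/(_ [set u]); rewrite !ffunE eqxx (inj_eq set1_inj).
by rewrite (negPf nuv) subr0 => /eqP; rewrite oner_eq0.
Qed.

(** The product of all differences with the generator of [j0] is a multiple of [wprod E], and
    multiplying it by that generator gives the top basis element up to sign. *)
Lemma wprod_tree_neq0 (E : seq (ext R I)) (j0 : I) :
  all_deg1 E -> size E = #|I|.-1 ->
  (forall j, lspan E (ext_gen R j - ext_gen R j0)) -> wprod E != 0.
Proof.
move=> dE szE spE; pose g j := ext_gen R j - ext_gen R j0.
have g1 j : deg1 (g j) by apply: deg1B; apply: deg1_gen.
have [|_ [|k]] := @wprod_span_multiple _ _ E [seq g j | j <- enum [set~ j0]] dE.
- by move=> _ /mapP[j _ ->]; apply: spE.
- by rewrite size_map -cardE cardsC1 szE.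
rewrite -ext_hom_basis => gk; apply/eqP=> E0.
move: gk; rewrite E0 scaler0 => /(congr1 (wedge (ext_gen R j0))).
rewrite (wedge_ext_hom_eq (h := ext_gen R (I := I)) _ g1); first last.
- by move=> j; rewrite /g addrAC subrr add0r wedgeNr wedge_gen_sqr oppr0.
- exact: deg1_gen.
rewrite ext_hom_id ext_gen_basis ?inE ?eqxx // wedge0r => /(canRL (signrZK _)).
by rewrite scaler0 => /eqP; rewrite (negPf (ext_basis_neq0 _)).
Qed.
End NonZero.

(** * Base change of exterior algebras *)

Section BaseChange.
Variables (R S : comNzRingType) (f : {rmorphism R -> S}).
Implicit Types I J : finType.

(** Signs are determined over the integers and then carried to the Gaussian integers, which have
    further units. *)
Definition ext_base I (x : ext R I) : ext S I := [ffun A : {set I} => f (x A)].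

Lemma ext_baseD I (x y : ext R I) : ext_base (x + y) = ext_base x + ext_base y.
Proof. by apply/ffunP=> A; rewrite !ffunE rmorphD. Qed.

Lemma ext_base0 I : ext_base (0 : ext R I) = 0.
Proof. by apply/ffunP=> A; rewrite !ffunE rmorph0. Qed.

Lemma ext_baseB I (x y : ext R I) : ext_base (x - y) = ext_base x - ext_base y.
Proof. by apply/ffunP=> A; rewrite !ffunE rmorphB. Qed.

Lemma ext_baseZ I a (x : ext R I) : ext_base (a *: x) = f a *: ext_base x.
Proof. by apply/ffunP=> A; rewrite !ffunE /= rmorphM. Qed.

Lemma ext_base_sum I (T : Type) (r : seq T) (P : pred T) (F : T -> ext R I) :
  ext_base (\sum_(t <- r | P t) F t) = \sum_(t <- r | P t) ext_base (F t).
Proof.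
by apply: (big_morph (@ext_base I)) => [u v|]; rewrite ?ext_baseD ?ext_base0.
Qed.

Lemma ext_base_sign I (s : nat) (x : ext R I) :
  ext_base ((-1) ^+ s *: x) = (-1) ^+ s *: ext_base x.
Proof. by rewrite ext_baseZ rmorphXn rmorphN1. Qed.

Lemma ext_base_basis I (A : {set I}) : ext_base (ext_basis R A) = ext_basis S A.
Proof. by apply/ffunP=> B; rewrite !ffunE rmorph_nat. Qed.

Lemma ext_baseM I (x y : ext R I) :
  ext_base (wedge x y) = wedge (ext_base x) (ext_base y).
Proof.
apply/ffunP=> D; rewrite !ffunE rmorph_sum; apply: eq_bigr => A _.
by rewrite !ffunE !rmorphM rmorphXn rmorphN1.
Qed.

Lemma ext_base_wprod I (l : seq (ext R I)) :
  ext_base (wprod l) = wprod [seq ext_base x | x <- l].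
Proof.
elim: l => [|x l IH]; first by rewrite !wprod_nil ext_base_basis.
by rewrite map_cons !wprod_cons ext_baseM IH.
Qed.

Lemma ext_base_hom I J (g : I -> ext R J) x :
  ext_base (ext_hom g x) = ext_hom (fun i => ext_base (g i)) (ext_base x).
Proof.
rewrite ext_base_sum; apply: eq_bigr => A _.
by rewrite ext_baseZ ext_base_wprod -map_comp ffunE.
Qed.
End BaseChange.

(** * Homogeneous elements *)

Section Degree.
Variable R : comNzRingType.
Implicit Types I J : finType.

Definition homog I (j : nat) (x : ext R I) := forall A : {set I}, x A != 0 -> #|A| = j.

Lemma homog0 I j : homog j (0 : ext R I).
Proof. by move=> A; rewrite ffunE eqxx. Qed.

Lemma homogD I j (x y : ext R I) : homog j x -> homog j y -> homog j (x + y).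
Proof.
move=> hx hy A; rewrite ffunE; have [x0|/hx//] := eqVneq (x A) 0.
by rewrite x0 add0r => /hy.
Qed.

Lemma homogZ I j a (x : ext R I) : homog j x -> homog j (a *: x).
Proof.
move=> hx A; rewrite ffunE scaleRo; have [x0|/hx//] := eqVneq (x A) 0.
by rewrite x0 mulr0 eqxx.
Qed.

Lemma homog_sum I j (T : Type) (r : seq T) (P : pred T) (F : T -> ext R I) :
  (forall t, P t -> homog j (F t)) -> homog j (\sum_(t <- r | P t) F t).
Proof. by apply: big_ind => //; [exact: homog0 | move=> *; exact: homogD]. Qed.

Lemma homog_basis I (A : {set I}) : homog #|A| (ext_basis R A).
Proof. by move=> B; rewrite ffunE; have [->|_] := eqVneq B A; rewrite ?eqxx. Qed.

Lemma homog_deg1 I (x : ext R I) : deg1 x -> homog 1 x.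
Proof.
by move=> [v ->]; apply: homog_sum => i _; apply: homogZ; rewrite -(cards1 i);
  apply: homog_basis.
Qed.

Lemma homog_wedge I j l (x y : ext R I) :
  homog j x -> homog l y -> homog (j + l) (wedge x y).
Proof.
move=> hx hy D; rewrite ffunE => nz.
have [A AD] : exists2 A : {set I}, A \subset D & x A * y (D :\: A) != 0.
  case: (pickP (fun A : {set I} => (A \subset D) && (x A * y (D :\: A) != 0))) =>
    [A /andP[]|none]; first by exists A.
  move: nz; rewrite big1 ?eqxx // => A AD; have := none A; rewrite AD /=.
  by move/negbT; rewrite negbK => /eqP->; rewrite mulr0.
have [->|/hx <-] := eqVneq (x A) 0; first by rewrite mul0r eqxx.
have [->|/hy <- _] := eqVneq (y (D :\: A)) 0; first by rewrite mulr0 eqxx.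
by rewrite -(cardsID A D) (setIidPr AD).
Qed.

Lemma homog_wprod I (l : seq (ext R I)) : all_deg1 l -> homog (size l) (wprod l).
Proof.
elim: l => [|x l IH] dl.
  by rewrite wprod_nil /= -(cards0 I); apply: homog_basis.
have [dx {}dl] := all_deg1_cons dl.
by rewrite wprod_cons -[size _]add1n; apply: homog_wedge; [apply: homog_deg1 | apply: IH].
Qed.

Lemma homog_hom I J (g : I -> ext R J) j x :
  (forall i, deg1 (g i)) -> homog j x -> homog j (ext_hom g x).
Proof.
move=> g1 hx; apply: homog_sum => A _.
have [->|/hx <-] := eqVneq (x A) 0; first by rewrite scale0r; apply: homog0.
apply: homogZ; rewrite cardE -(size_map g); apply: homog_wprod.
exact: all_deg1_map.
Qed.

Lemma homog_part I j (x : ext R I) : homog j (ext_part j x).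
Proof. by move=> A; rewrite ffunE; have [//|_] := eqVneq #|A| j; rewrite eqxx. Qed.

Lemma ext_part_id I j (x : ext R I) : homog j x -> ext_part j x = x.
Proof.
move=> hx; apply/ffunP=> A; rewrite ffunE; have [//|nA] := eqVneq #|A| j.
by apply/esym/eqP; apply: contraNT nA => /hx/eqP.
Qed.

Lemma ext_part_neq I j l (x : ext R I) : homog j x -> l != j -> ext_part l x = 0.
Proof.
move=> hx lj; apply/ffunP=> A; rewrite !ffunE; have [Al|//] := eqVneq #|A| l.
by apply/eqP; apply: contraNT lj => /hx <-; rewrite Al.
Qed.

Lemma ext_partD I j (x y : ext R I) : ext_part j (x + y) = ext_part j x + ext_part j y.
Proof. by apply/ffunP=> A; rewrite !ffunE; case: ifP; rewrite ?addr0. Qed.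

Lemma ext_partZ I j a (x : ext R I) : ext_part j (a *: x) = a *: ext_part j x.
Proof. by apply/ffunP=> A; rewrite !ffunE; case: ifP; rewrite ?scaler0. Qed.

Lemma ext_part_sum I j (T : Type) (r : seq T) (P : pred T) (F : T -> ext R I) :
  ext_part j (\sum_(t <- r | P t) F t) = \sum_(t <- r | P t) ext_part j (F t).
Proof.
apply: (big_morph (ext_part j)) => [u v|]; first exact: ext_partD.
by apply/ffunP=> A; rewrite !ffunE if_same.
Qed.

End Degree.

Local Close Scope ring_scope.

(** * Circles of a stack *)

Section Matching.
Variables (n : nat) (b : matching n).
Implicit Types i j r : 'I_(2 * n).

Lemma partnerK : involutive (partner b).
Proof.
move=> i; have /andP[/forallP/(_ i)/andP[/eqP bb _] _] := valP b; exact: bb.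
Qed.

Lemma partner_neq i : partner b i != i.
Proof. by have /andP[/forallP/(_ i)/andP[_ nb] _] := valP b. Qed.

Lemma partner_noncrossing i j : ~~ [&& i < j, j < partner b i & partner b i < partner b j].
Proof. by have /andP[_ /forallP/(_ i)/forallP/(_ j)] := valP b. Qed.

Lemma partner_inside i r :
  i < r < partner b i -> i < partner b r < partner b i.
Proof.
move=> /andP[ir rb].
have h1 := partner_noncrossing i r; have h2 := partner_noncrossing (partner b r) i.
have e1 : partner b r != partner b i.
  by rewrite (inj_eq (inv_inj partnerK)); apply: contraTneq ir => ->; rewrite ltnn.
have e2 : partner b r != i.
  by apply: contraTneq rb => <-; rewrite partnerK ltnn.
rewrite partnerK in h2; move: h1 h2 e1 e2; rewrite -!(inj_eq val_inj) /=; lia.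
Qed.

Lemma card_ord_between N (p q : nat) : q <= N ->
  #|[set r : 'I_N | p < r < q]| = q - p.+1.
Proof.
move=> qN; rewrite -sum1_card.
under eq_bigl do rewrite inE.
rewrite -(big_mkord (fun t : nat => p < t < q) (fun=> 1)).
transitivity (\sum_(p.+1 <= r < q) 1); last by rewrite sum_nat_const_nat muln1.
rewrite [RHS](big_nat_widen _ _ N) // [RHS](big_nat_widenl _ 0) //.
by apply: eq_bigl => r; rewrite andbC.
Qed.

Lemma card_involution_even (T : finType) (S : {set T}) (f : T -> T) :
  involutive f -> (forall x, f x != x) -> (forall x, x \in S -> f x \in S) ->
  ~~ odd #|S|.
Proof.
move=> fK f_neq fS; pose lt (x y : T) := enum_rank x < enum_rank y.
rewrite -(cardsID [set x | lt x (f x)] S).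
suff -> : S :\: [set x | lt x (f x)] = f @: (S :&: [set x | lt x (f x)]).
  by rewrite card_imset ?addnn ?odd_double //; apply: inv_inj.
apply/setP=> x; rewrite (can2_imset_pre _ fK fK) !inE /lt fK -leqNgt.
have -> : (f x \in S) = (x \in S) by apply/idP/idP => /fS; rewrite ?fK.
rewrite andbC leq_eqVlt [val _ == val _](inj_eq (inj_comp val_inj enum_rank_inj)).
by rewrite (negPf (f_neq x)).
Qed.

(** The points strictly under an arc are matched among themselves, so their number is even. *)
Lemma odd_partner i : odd (partner b i) = ~~ odd i.
Proof.
wlog lt_i : i / i < partner b i.
  move=> H; have [/H//|gt|eq] := ltngtP i (partner b i).
    by have := H (partner b i); rewrite partnerK => /(_ gt) ->; rewrite negbK.
  by have := partner_neq i; rewrite -(inj_eq val_inj) /= eq eqxx.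
have := @card_involution_even _ [set r : 'I_(2 * n) | i < r < partner b i] _
  partnerK partner_neq.
rewrite card_ord_between; last exact: ltnW.
have inS r : r \in [set r : 'I_(2 * n) | i < r < partner b i] ->
    partner b r \in [set r : 'I_(2 * n) | i < r < partner b i].
  by rewrite !inE => /partner_inside.
move=> /(_ inS); lia.
Qed.

Lemma contains_arc i : exists2 j, j \in arcs b & i = j \/ i = partner b j.
Proof.
have [lt|gt|eq] := ltngtP i (partner b i).
- by exists i; [rewrite mem_filter lt mem_enum | left].
- by exists (partner b i); [rewrite mem_filter partnerK gt mem_enum | right; rewrite partnerK].
- by have := partner_neq i; rewrite -(inj_eq val_inj) /= eq eqxx.
Qed.

Lemma arcs_uniq : uniq (arcs b).
Proof. by apply: filter_uniq; apply: enum_uniq. Qed.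

Lemma size_arcs : size (arcs b) = n.
Proof.
pose A := [set i : 'I_(2 * n) | i < partner b i].
have sA : size (arcs b) = #|A|.
  rewrite cardE; apply/perm_size/uniq_perm; [exact: arcs_uniq | exact: enum_uniq |].
  by move=> i; rewrite mem_filter !mem_enum andbT inE.
have := cardsC A; rewrite card_ord.
have -> : ~: A = partner b @: A; last first.
  by rewrite card_imset; [rewrite sA; lia | apply: inv_inj partnerK].
apply/setP=> i; rewrite (can2_imset_pre _ partnerK partnerK) !inE partnerK -leqNgt.
by rewrite leq_eqVlt [val _ == val _](inj_eq val_inj) (negPf (partner_neq i)).
Qed.
End Matching.

Local Open Scope group_scope.

(** * Circles as cycles of a permutation, and the effect of a saddle *)

Section StackPerm.
Variables (n k : nat) (m : nat -> matching n).
Implicit Types (s : seq (saddle n)) (u v w : point n k) (x : saddle n) (l : nat).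
Implicit Types (i j : 'I_(2 * n)).

Definition in_range s := all (fun x : saddle n => (0 < x.1 <= k)%N) s.

Lemma contracted_partner s l i :
  contracted m s l (partner (m l) i) = contracted m s l i.
Proof. by rewrite /contracted partnerK orbC. Qed.

Lemma contracted_range s l i : in_range s -> contracted m s l i -> (0 < l <= k)%N.
Proof. by move=> /allP ws /orP[/ws|/ws]. Qed.

(* Strands through points of even index point upwards, the others downwards:   *)
(* this orients every circle of the diagram, and forward follows the orientation. *)
Definition forward s u := if odd u.2 then below m s u else above m s u.
Definition backward s u := if odd u.2 then above m s u else below m s u.

Lemma above_below s u : in_range s -> contracted m s u.1 u.2 ->
  above m s (below m s u) = u.
Proof.
case: u => l i ws /= cl; rewrite /below /= cl /above /=.
have /andP[l0 lk] := contracted_range ws cl.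
have vl : (inord l.-1 : 'I_k.+1) = l.-1 :> nat.
  by rewrite inordK // prednK // ltnW.
by rewrite vl prednK // cl inord_val.
Qed.

Lemma below_above s u : in_range s -> contracted m s u.1.+1 u.2 ->
  below m s (above m s u) = u.
Proof.
case: u => l i ws /= cl; rewrite /above /= cl /below /=.
have /andP[l0 lk] := contracted_range ws cl.
have vl : (inord l.+1 : 'I_k.+1) = l.+1 :> nat by rewrite inordK.
by rewrite vl cl /= inord_val.
Qed.

Lemma belowK s u : ~~ contracted m s u.1 u.2 -> below m s (below m s u) = u.
Proof.
case: u => l i /= /negbTE cl; rewrite /below /= cl /=.
by rewrite contracted_partner cl partnerK.
Qed.

Lemma aboveK s u : ~~ contracted m s u.1.+1 u.2 -> above m s (above m s u) = u.
Proof.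
case: u => l i /= /negbTE cl; rewrite /above /= cl /=.
by rewrite contracted_partner cl partnerK.
Qed.

Lemma odd_below s u :
  odd (below m s u).2 = if contracted m s u.1 u.2 then odd u.2 else ~~ odd u.2.
Proof. by rewrite /below; case: ifP => //= _; rewrite odd_partner. Qed.

Lemma odd_above s u :
  odd (above m s u).2 = if contracted m s u.1.+1 u.2 then odd u.2 else ~~ odd u.2.
Proof. by rewrite /above; case: ifP => //= _; rewrite odd_partner. Qed.

Lemma forwardK s : in_range s -> cancel (forward s) (backward s).
Proof.
move=> ws u; rewrite /forward /backward; case ou: (odd u.2).
  rewrite odd_below ou; case cu: (contracted _ _ _ _); first exact: above_below.
  by rewrite belowK // cu.
rewrite odd_above ou; case cu: (contracted _ _ _ _); first exact: below_above.
by rewrite aboveK // cu.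
Qed.

Lemma backwardK s : in_range s -> cancel (backward s) (forward s).
Proof.
move=> ws u; rewrite /forward /backward; case ou: (odd u.2).
  rewrite odd_above ou; case cu: (contracted _ _ _ _); first exact: below_above.
  by rewrite aboveK // cu.
rewrite odd_below ou; case cu: (contracted _ _ _ _); first exact: above_below.
by rewrite belowK // cu.
Qed.

Definition forward_perm s (ws : in_range s) : {perm point n k} := perm (can_inj (forwardK ws)).

Definition same s u v := connect (adjacent m s) u v.

Lemma adjacentE s u v : adjacent m s u v = (v == forward s u) || (v == backward s u).
Proof. by rewrite /adjacent /forward /backward /=; case: odd => //; rewrite orbC. Qed.

Lemma sameE s (ws : in_range s) u v : same s u v = (v \in porbit (forward_perm ws) u).
Proof.
have porb w : porbit (forward_perm ws) (forward s w) = porbit (forward_perm ws) w.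
  by have := porbit_perm (forward_perm ws) 1 w; rewrite expg1 permE.
apply/idP/idP => [|/porbitP[t ->]].
  move=> /(@closed_connect _ _ (porbit (forward_perm ws) u)) <-; first exact: porbit_id.
  move=> w w'; rewrite adjacentE -!eq_porbit_mem.
  move=> /orP[]/eqP->; first by rewrite porb.
  by rewrite -[in LHS](backwardK ws w) porb.
elim: t => [|t IH]; first by rewrite expg0 perm1; apply: connect0.
apply: connect_trans IH _; apply: connect1.
by rewrite expgSr permM permE adjacentE eqxx.
Qed.

Lemma same_refl s u : same s u u. Proof. exact: connect0. Qed.

Lemma same_sym s u v : in_range s -> same s u v = same s v u.
Proof. by move=> ws; rewrite !(sameE ws) porbit_sym. Qed.

Lemma same_trans s v u w : same s u v -> same s v w -> same s u w.
Proof. exact: connect_trans. Qed.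

Lemma same_forward s u : same s u (forward s u).
Proof. by apply: connect1; rewrite adjacentE eqxx. Qed.

Lemma same_below s u : same s u (below m s u).
Proof. by apply: connect1; rewrite /adjacent /= eqxx. Qed.

Lemma same_above s u : same s u (above m s u).
Proof. by apply: connect1; rewrite /adjacent /= eqxx orbT. Qed.

Lemma circle_at_eq s u v : in_range s ->
  (circle_at m s u == circle_at m s v) = same s u v.
Proof.
move=> ws; rewrite -val_eqE /=; apply: root_connect.
by move=> u' v'; apply: same_sym.
Qed.

Lemma same_circle_at s u : same s u (val (circle_at m s u)).
Proof. exact: connect_root. Qed.

Lemma circle_at_val s (X : circles k m s) : in_range s -> circle_at m s (val X) = X.
Proof.
move=> ws; apply: val_inj; case: X => _ /= /codomP[u ->].
by apply: root_root => u' v'; apply: same_sym.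
Qed.

Lemma card_circles s (ws : in_range s) :
  #|circles k m s| = #|porbits (forward_perm ws)|.
Proof.
pose f (X : circles k m s) := porbit (forward_perm ws) (val X).
have f_inj : injective f.
  move=> X Y /eqP; rewrite /f eq_porbit_mem porbit_sym -sameE -circle_at_eq //.
  by rewrite !circle_at_val // => /eqP.
rewrite -(card_imset _ f_inj); apply: eq_card => S.
apply/imsetP/imsetP => [[X _ ->]|[u _ ->]]; first by exists (val X).
exists (circle_at m s u) => //; apply/eqP.
by rewrite /f eq_porbit_mem porbit_sym -sameE same_circle_at.
Qed.

Section Step.
Variables (s : seq (saddle n)) (l : nat) (i : 'I_(2 * n)).
Hypotheses (ws : in_range s) (lk : (0 < l <= k)%N) (ncl : ~~ contracted m s l i).
Notation b := (partner (m l)).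
Notation s' := ((l, i) :: s).

Lemma in_range_cons : in_range s'. Proof. by rewrite /in_range /= lk. Qed.

Let vl : (inord l : 'I_k.+1) = l :> nat.
Proof. by rewrite inordK // ltnS; case/andP: lk. Qed.

Let vl1 : (inord l.-1 : 'I_k.+1) = l.-1 :> nat.
Proof. by case/andP: lk => l0 lk'; rewrite inordK // prednK // ltnW. Qed.

Let l1K : l.-1.+1 = l. Proof. by rewrite prednK //; case/andP: lk. Qed.

Lemma contracted_cons l' j :
  contracted m s' l' j = contracted m s l' j || (l' == l) && ((j == i) || (j == b i)).
Proof.
rewrite /contracted !inE !xpair_eqE; have [->|_] := eqVneq l' l; last by rewrite /= orbF.
rewrite /= (can2_eq (@partnerK _ (m l)) (@partnerK _ (m l))).
by case: (j == i); case: (j == b i); case: (_ \in s); case: (_ \in s).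
Qed.

(** [swap1] and [swap2] are the points where the orientation enters the arc of [m l] and its mirror
    image; the parity of [i] decides which belongs to which. *)
Definition swap1 : point n k := if odd i then (inord l, i) else (inord l.-1, i).
Definition swap2 : point n k := if odd i then (inord l.-1, b i) else (inord l, b i).

(** Contracting an arc with its mirror image exchanges the successors of the two entry points, so a
    saddle multiplies the permutation by a transposition. *)
Lemma forward_cons u : forward s' u = forward s (tperm swap1 swap2 u).
Proof.
have ncb : contracted m s l (b i) = false by rewrite contracted_partner; apply/negbTE.
have nci := negbTE ncl; have ob := odd_partner (m l) i.
have E1 : forward s swap1 = (swap1.1, b i).
  by rewrite /forward /swap1; case oi: (odd i) => /=; rewrite oi /= /below /above /= ?vl ?vl1 ?l1K nci.
have E2 : forward s swap2 = (swap2.1, i).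
  rewrite /forward /swap2; case oi: (odd i) => /=; rewrite ob oi /= /below /above /= ?vl ?vl1 ?l1K ncb;
  by rewrite partnerK.
have E1' : forward s' swap1 = (swap2.1, i).
  rewrite /forward /swap1 /swap2; case oi: (odd i) => /=; rewrite oi /= /below /above /= ?vl ?vl1 ?l1K;
  by rewrite contracted_cons eqxx eqxx orbT.
have E2' : forward s' swap2 = (swap1.1, b i).
  rewrite /forward /swap2 /swap1; case oi: (odd i) => /=; rewrite ob oi /= /below /above /= ?vl ?vl1 ?l1K;
  by rewrite contracted_cons !eqxx !orbT.
case: tpermP => [->|->|/eqP n1 /eqP n2]; first by rewrite E1' E2.
  by rewrite E2' E1.
case: u n1 n2 => r j n1 n2; rewrite /forward /=.
have rE : (r == inord l) = (nat_of_ord r == l) by rewrite -val_eqE /= vl.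
have rE1 : (r == inord l.-1) = (r.+1 == l) by rewrite -val_eqE /= vl1 -{2}l1K eqSS.
case oj: (odd j); rewrite /below /above /= contracted_cons.
  suff -> : (nat_of_ord r == l) && ((j == i) || (j == b i)) = false by rewrite orbF.
  apply/negP=> /andP[rl] /orP[]/eqP jE; move: n1 n2 oj; rewrite /swap1 /swap2 jE ?ob;
  by case: (odd i); rewrite !xpair_eqE ?eqxx rE rl.
suff -> : (r.+1 == l) && ((j == i) || (j == b i)) = false by rewrite orbF.
apply/negP=> /andP[rl] /orP[]/eqP jE; move: n1 n2 oj; rewrite /swap1 /swap2 jE ?ob;
by case: (odd i); rewrite !xpair_eqE ?eqxx rE1 rl.
Qed.

Lemma forward_perm_cons : forward_perm in_range_cons = tperm swap1 swap2 * forward_perm ws.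
Proof. by apply/permP=> u; rewrite permM [LHS]permE [RHS]permE forward_cons. Qed.

Lemma swap_neq : swap1 != swap2.
Proof.
rewrite /swap1 /swap2; case: (odd i); rewrite xpair_eqE [i == _]eq_sym;
by rewrite (negPf (partner_neq _ _)) andbF.
Qed.

Lemma same_swap : same s swap1 swap2 = is_split k m s (l, i).
Proof.
have below_l j : contracted m s l j = false -> same s (inord l, j) (inord l, b j).
  by move=> cl; have := same_below s (inord l, j); rewrite /below /= vl cl.
have above_l1 j : contracted m s l j = false -> same s (inord l.-1, j) (inord l.-1, b j).
  by move=> cl; have := same_above s (inord l.-1, j); rewrite /above /= vl1 l1K cl.
have nci := negbTE ncl; rewrite /swap1 /swap2 /is_split /= -/(same _ _ _).
case: (odd i); apply/idP/idP => h.
- rewrite same_sym //; apply: same_trans h _.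
  by rewrite same_sym //; apply: above_l1.
- rewrite same_sym // in h; apply: same_trans h _; exact: above_l1.
- by apply: same_trans h _; rewrite same_sym //; apply: below_l.
- by apply: same_trans h _; apply: below_l.
Qed.

Lemma same_swap1 : same s' swap1 (inord l, i).
Proof.
rewrite /swap1; case: (odd i); first exact: same_refl.
have := same_above s' (inord l.-1, i); rewrite /above /= vl1 l1K contracted_cons.
by rewrite !eqxx orbT.
Qed.

Lemma same_swap2 : same s' swap2 (inord l, b i).
Proof.
rewrite /swap2; case: (odd i); last exact: same_refl.
have := same_above s' (inord l.-1, b i); rewrite /above /= vl1 l1K contracted_cons.
by rewrite !eqxx !orbT.
Qed.

(** Multiplication by a transposition adds a cycle if its two points share one, and removes a cycle
    otherwise. *)
Lemma card_circles_cons :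
  (#|circles k m s'| + (~~ is_split k m s (l, i)).*2 = #|circles k m s| + 1)%N.
Proof.
rewrite (card_circles in_range_cons) (card_circles ws) forward_perm_cons.
have := porbits_mul_tperm (forward_perm ws) swap1 swap2.
by rewrite porbit_sym -sameE same_swap swap_neq.
Qed.

(** Undoing a merge adds a circle, so read backwards the transposition acts inside a single
    cycle. *)
Lemma same_merge : ~~ is_split k m s (l, i) -> same s' (inord l, i) (inord l, b i).
Proof.
move=> nsp; have ws' := in_range_cons.
suff h : same s' swap1 swap2.
  apply: same_trans same_swap2; apply: same_trans h.
  by rewrite same_sym //; apply: same_swap1.
have /= := porbits_mul_tperm (forward_perm in_range_cons) swap1 swap2.
have -> : tperm swap1 swap2 * forward_perm in_range_cons = forward_perm ws.
  by rewrite forward_perm_cons mulgA tperm2 mul1g.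
rewrite swap_neq -(card_circles ws) -(card_circles in_range_cons).
have := card_circles_cons; rewrite nsp porbit_sym -sameE.
move: #|circles k m s| #|circles k m s'| => c c'.
by case: (same s' swap1 swap2) => //=; lia.
Qed.
End Step.

End StackPerm.

Local Close Scope group_scope.

Local Open Scope ring_scope.

(** * Closed form of the saddle maps *)

Section ArcProduct.
Variables (R : comNzRingType) (N J : finType) (z : N -> J).

Definition diffs (l : seq (N * N)) : seq (ext R J) :=
  [seq ext_gen R (z p.1) - ext_gen R (z p.2) | p <- l].

Definition arc_prod (l : seq (N * N)) : ext R J := wprod (diffs l).

Lemma diffs_deg1 l : all_deg1 (diffs l).
Proof. by move=> _ /mapP[p _ ->]; apply: deg1B; apply: deg1_gen. Qed.

Lemma arc_prod_cat l1 l2 : arc_prod (l1 ++ l2) = wedge (arc_prod l1) (arc_prod l2).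
Proof. by rewrite /arc_prod /diffs map_cat wprod_cat. Qed.

Lemma homog_arc_prod l : homog (size l) (arc_prod l).
Proof. by rewrite -(size_map (fun p => ext_gen R (z p.1) - ext_gen R (z p.2)) l);
  apply/homog_wprod/diffs_deg1. Qed.
End ArcProduct.

Lemma diffs_base (R S : comNzRingType) (f : {rmorphism R -> S}) (N J : finType)
  (z : N -> J) l : [seq ext_base f x | x <- diffs R z l] = diffs S z l.
Proof.
rewrite /diffs -map_comp; apply: eq_map => p /=.
by rewrite ext_baseB !ext_base_basis.
Qed.

Lemma arc_prod_base (R S : comNzRingType) (f : {rmorphism R -> S}) (N J : finType)
  (z : N -> J) l : ext_base f (arc_prod R z l) = arc_prod S z l.
Proof. by rewrite ext_base_wprod diffs_base. Qed.

Section Relabel.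
Variables (R : comNzRingType) (I1 I2 J : finType).
Variables (lab1 : I1 -> J) (lab2 : I2 -> J) (f : I1 -> I2).
Implicit Types (E : seq (ext R J)) (v : ext R I1).

(** [lab1] and [lab2] label the circles before and after a saddle. They are compatible with the map
    [f] of circles only modulo the span of [E], whose product kills the defect. *)
Lemma relabel E v : all_deg1 E ->
  (forall X, lspan E (ext_gen R (lab2 (f X)) - ext_gen R (lab1 X))) ->
  wedge (wprod E) (ext_map lab2 (ext_map f v)) = wedge (wprod E) (ext_map lab1 v).
Proof.
move=> dE spE; rewrite !ext_mapE ext_hom_comp; try by move=> *; apply: deg1_gen.
apply: wedge_ext_hom_eq => X.
- by rewrite ext_hom_gen; apply: deg1_gen.
- exact: deg1_gen.
by rewrite ext_hom_gen; apply: wprod_span.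
Qed.

Lemma relabel_split E E2 b1 b2 v : all_deg1 E2 ->
  wprod E2 = wedge (wprod E) (ext_gen R (lab2 b1) - ext_gen R (lab2 b2)) ->
  (forall X, lspan E2 (ext_gen R (lab2 (f X)) - ext_gen R (lab1 X))) ->
  wedge (wprod E) (ext_map lab2 (wedge (ext_gen R b1 - ext_gen R b2) (ext_map f v))) =
  wedge (wprod E2) (ext_map lab1 v).
Proof.
move=> dE EE2 spE; rewrite -(relabel v dE spE) EE2 -wedgeA; congr wedge.
by rewrite !ext_mapE ext_homM ?ext_homB ?ext_hom_gen // => X; apply: deg1_gen.
Qed.
End Relabel.

Section ClosedForm.
Variables (n k : nat) (m : nat -> matching n) (R : comNzRingType).
Variables (J : finType) (z : 'I_(2 * n) -> J).
Implicit Types (s : seq (saddle n)) (xs : seq (oriented_saddle n)).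
Implicit Types (u v w : point n k).

Definition saddle_ends (x : oriented_saddle n) : 'I_(2 * n) * 'I_(2 * n) :=
  let i := x.1.2 in let j := partner (m x.1.1) i in if x.2 then (i, j) else (j, i).

(* The arcs contracted by the splits of xs, from the last one to the first.    *)
Fixpoint split_arcs s xs : seq ('I_(2 * n) * 'I_(2 * n)) :=
  if xs is x :: xs' then
    let r := split_arcs (x.1 :: s) xs' in
    if is_split k m s x.1 then rcons r (saddle_ends x) else r
  else [::].

Lemma size_split_arcs s xs : size (split_arcs s xs) = split_count k m s xs.
Proof.
elim: xs s => //= x xs IH s; rewrite -IH.
by case: (is_split _ _ _ _); rewrite ?size_rcons.
Qed.

Fixpoint valid_saddles s xs : bool :=
  if xs is x :: xs' then
    [&& (0 < x.1.1 <= k)%N, ~~ contracted m s x.1.1 x.1.2 & valid_saddles (x.1 :: s) xs']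
  else true.

Lemma same_ind s (ws : in_range k s) (P : point n k -> point n k -> Prop) :
  (forall u, P u u) -> (forall u v w, P u v -> P v w -> P u w) ->
  (forall u, P u (forward m s u)) -> forall u v, same m s u v -> P u v.
Proof.
move=> Pr Pt Pn u v; rewrite (sameE m ws) => /porbitP[t ->].
elim: t => [|t IH]; first by rewrite expg0 perm1.
by apply: Pt IH _; rewrite expgSr permM permE.
Qed.

(** Labels agree along the final circles. Going back through a saddle changes [forward] by a
    transposition: after a merge its two strands lie on one circle, and for a split the difference
    of their labels is, up to sign, one of the listed factors. *)
Lemma lspan_same xs s : in_range k s -> valid_saddles s xs ->
  (forall u v, same m (performed s xs) u v -> z u.2 = z v.2) ->
  forall u v, same m s u v ->
    lspan (diffs R z (split_arcs s xs)) (ext_gen R (z u.2) - ext_gen R (z v.2)).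
Proof.
elim: xs s => [|[[l i] o] xs IH] s ws; first by move=> _ zP u v /zP->; rewrite subrr.
move=> /= /and3P[lk ncl vxs] zP.
have ws' := in_range_cons i ws lk.
have {}IH := IH _ ws' vxs zP.
set E' := diffs _ _ (split_arcs _ xs) in IH.
set E := diffs _ _ _.
have E'E x : lspan E' x -> lspan E x.
  rewrite /E; case: ifP => // _; apply: lspan_sub => y yE.
  by rewrite /diffs map_rcons mem_rcons inE yE orbT.
pose d u v := ext_gen R (z u.2) - ext_gen R (z v.2).
have dT u v w : lspan E (d u v) -> lspan E (d v w) -> lspan E (d u w).
  by move=> uv vw; have := lspanD uv vw; rewrite /d addrA subrK.
have dS u v : lspan E (d u v) -> lspan E (d v u).
  by move=> uv; have := lspanN uv; rewrite /d opprB.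
pose p := (inord l, i) : point n k; pose p' := (inord l, partner (m l) i) : point n k.
have mid : lspan E (d p p').
  have [sp|nsp] := boolP (is_split k m s (l, i)); last first.
    by apply/E'E/IH; apply: same_merge.
  rewrite /E sp; case: o {E E'E dT dS E' IH} => /=.
    by apply: lspan_mem; rewrite /diffs map_rcons mem_rcons mem_head.
  rewrite /d -opprB; apply/lspanN/lspan_mem.
  by rewrite /diffs map_rcons mem_rcons mem_head.
have sw1 : lspan E (d (swap1 k l i) p) by apply/E'E/IH/same_swap1.
have sw2 : lspan E (d (swap2 k m l i) p') by apply/E'E/IH/same_swap2.
apply: (same_ind ws) => [u|u v w|u]; first by rewrite subrr; apply: lspan0.
  exact: dT.
have nx v : lspan E (d v (forward m ((l, i) :: s) v)) by apply/E'E/IH/same_forward.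
have := forward_cons lk ncl (tperm (swap1 k l i) (swap2 k m l i) u).
rewrite tpermK; case: tpermP => [->|->|_ _] <-.
- exact: (dT _ _ _ sw1 (dT _ _ _ mid (dT _ _ _ (dS _ _ sw2) (nx _)))).
- exact: (dT _ _ _ sw2 (dT _ _ _ (dS _ _ mid) (dT _ _ _ (dS _ _ sw1) (nx _)))).
- exact: nx.
Qed.

(** A circle is labelled through an arbitrary point, its root. By [lspan_same] another point changes
    the label by an element that the product over the remaining splits kills. *)
Lemma saddle_maps_label xs s (v : ext R (circles k m s)) :
  in_range k s -> valid_saddles s xs ->
  (forall u v, same m (performed s xs) u v -> z u.2 = z v.2) ->
  ext_map (fun X => z (val X).2) (saddle_maps xs v) =
  wedge (arc_prod R z (split_arcs s xs)) (ext_map (fun X => z (val X).2) v).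
Proof.
elim: xs s v => [|[[l i] o] xs IH] s v ws; first by rewrite /arc_prod wprod_nil wedge1l.
move=> vx zP; have spE := lspan_same ws vx zP.
move: (vx) => /= /and3P[lk ncl vxs].
have ws' := in_range_cons i ws lk.
have spE' := lspan_same ws' vxs zP.
rewrite (IH _ _ ws' vxs zP); set E' := split_arcs _ xs in spE' *; move: spE => /=; rewrite -/E'.
rewrite /saddle_map [(_, o).1]/=.
have [sp|nsp] := boolP (is_split k m s (l, i)) => spE; last first.
  apply: relabel; first exact: diffs_deg1.
  by move=> X; apply: spE'; rewrite same_sym //; apply: same_circle_at.
rewrite [strands _ _ _ _]surjective_pairing.
set b1 := (strands _ _ _ _).1; set b2 := (strands _ _ _ _).2.
have [b1E b2E] :
    lspan (diffs R z E')
      (ext_gen R (z (val b1).2) - ext_gen R (z (saddle_ends ((l, i), o)).1)) /\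
    lspan (diffs R z E')
      (ext_gen R (z (val b2).2) - ext_gen R (z (saddle_ends ((l, i), o)).2)).
  have h j : lspan (diffs R z E')
      (ext_gen R (z (val (circle_at (k := k) m ((l, i) :: s) (inord l, j))).2) - ext_gen R (z j)).
    by apply: (spE' (val (circle_at (k := k) m ((l, i) :: s) (inord l, j))) (inord l, j)); rewrite same_sym //; apply: same_circle_at.
  by rewrite /b1 /b2 /strands; case: (o); split; apply: h.
set e := saddle_ends _ in b1E b2E spE *.
(* [b1] and [b2] are labelled through their roots, the listed factor through the ends of the arc;
   both differences agree modulo the span of the factors of [E']. *)
have prodE : arc_prod R z (rcons E' e) =
    wedge (arc_prod R z E') (ext_gen R (z (val b1).2) - ext_gen R (z (val b2).2)).
  rewrite /arc_prod {1}/diffs map_rcons wprod_rcons; apply/eqP.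
  rewrite -subr_eq0 -wedgeBr; apply/eqP; apply: wprod_span; first exact: diffs_deg1.
  have := lspanB b2E b1E; congr (lspan _ _).
  by rewrite !opprB [LHS]addrACA [RHS]addrACA; congr (_ + _); apply: addrC.
apply: relabel_split; [exact: diffs_deg1 | exact: prodE | move=> X].
have E'E x : lspan (diffs R z E') x -> lspan (diffs R z (rcons E' e)) x.
  by apply: lspan_sub => y yE; rewrite /diffs map_rcons mem_rcons inE yE orbT.
case: eqP => [->|_]; last first.
  by apply/E'E/spE'; rewrite same_sym //; apply: same_circle_at.
have a_i := spE (inord l, i) (val (circle_at (k := k) m s (inord l, i)))
  (same_circle_at _ _ _).
have b1_e := E'E _ b1E.
suff e_i : lspan (diffs R z (rcons E' e)) (ext_gen R (z e.1) - ext_gen R (z i)).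
  by have := lspanD (lspanD b1_e e_i) a_i; rewrite /= !subrKA.
rewrite /e; case: (o); rewrite /= ?subrr; first exact: lspan0.
by apply: lspan_mem; rewrite /diffs map_rcons mem_rcons mem_head.
Qed.

Lemma card_circles_performed xs s : in_range k s -> valid_saddles s xs ->
  (#|circles k m (performed s xs)| + size xs =
   #|circles k m s| + (split_count k m s xs).*2)%N.
Proof.
move=> ws vx; suff main (c : seq (saddle n) -> nat) :
    (forall t l i, in_range k t -> (0 < l <= k)%N -> ~~ contracted m t l i ->
       c ((l, i) :: t) + (~~ is_split k m t (l, i)).*2 = c t + 1)%N ->
    (c (performed s xs) + size xs = c s + (split_count k m s xs).*2)%N.
  by apply: (main (fun t => #|circles k m t|)) => t l i; apply: card_circles_cons.
move=> cE; elim: xs s ws vx => [|[[l i] o] xs IH] s ws /=; first by rewrite !addn0.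
move=> /and3P[lk ncl vxs]; have ws' := in_range_cons i ws lk.
have := IH _ ws' vxs; have := cE s l i ws lk ncl.
move: (c (performed _ _)) (c (_ :: _)) (c s) (split_count _ _ _ _) => a1 a2 a3 sc.
by case: (is_split _ _ _ _) => /=; lia.
Qed.

End ClosedForm.

(** * Products in the odd arc algebra *)

Section Universal.
Variables (n k : nat) (m : nat -> matching n) (s : seq (saddle n)).
Hypothesis ws : in_range k s.
Implicit Types (l : nat) (i : 'I_(2 * n)).

(** The universal property of circles: a labelling of points that respects vertical strands and
    uncontracted arcs is constant on circles. Circles of different stacks are compared through
    it. *)
Lemma same_label (T : Type) (F : nat -> 'I_(2 * n) -> T) (u v : point n k) :
  (forall l i, (l <= k)%N -> contracted m s l i -> F l.-1 i = F l i) ->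
  (forall l i, (l <= k)%N -> ~~ contracted m s l i -> F l (partner (m l) i) = F l i) ->
  (forall l i, (l <= k)%N -> ~~ contracted m s l.+1 i ->
     F l (partner (m l.+1) i) = F l i) ->
  same m s u v -> F u.1 u.2 = F v.1 v.2.
Proof.
move=> Fvert Fbelow Fabove.
pose P (u v : point n k) := F u.1 u.2 = F v.1 v.2.
apply: (@same_ind _ _ _ _ ws P) => [//|x y z Pxy|[l i]]; first exact: etrans.
have lk : (l <= k)%N by rewrite -ltnS.
rewrite /P /forward /below /above /=; case: (odd i) => /=; case: ifPn => c /=.
- have /andP[l0 _] := contracted_range ws c.
  by rewrite inordK ?Fvert // prednK // ltnW.
- by rewrite Fbelow.
- have /andP[_ l1] := contracted_range ws c.
  by rewrite inordK // -(Fvert l.+1).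
- by rewrite Fabove.
Qed.

Notation cA l i := (circle_at (k := k) m s (inord l, i)).

Lemma circle_at_vert l i : contracted m s l i -> cA l.-1 i = cA l i.
Proof.
move=> c; have /andP[l0 lk] := contracted_range ws c.
apply/eqP; rewrite circle_at_eq // same_sym //.
have := same_below m s ((inord l, i) : point n k); rewrite /below /=.
by rewrite inordK ?c // ltnS.
Qed.

Lemma circle_at_below l i : (l <= k)%N -> ~~ contracted m s l i ->
  cA l (partner (m l) i) = cA l i.
Proof.
move=> lk c; apply/eqP; rewrite circle_at_eq // same_sym //.
have := same_below m s ((inord l, i) : point n k); rewrite /below /=.
by rewrite inordK ?(negPf c).
Qed.

Lemma circle_at_above l i : (l <= k)%N -> ~~ contracted m s l.+1 i ->
  cA l (partner (m l.+1) i) = cA l i.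
Proof.
move=> lk c; apply/eqP; rewrite circle_at_eq // same_sym //.
have := same_above m s ((inord l, i) : point n k); rewrite /above /=.
by rewrite inordK ?(negPf c).
Qed.

Lemma same_inord l l' i j : cA l i = cA l' j -> same m s ((inord l, i) : point n k) (inord l', j).
Proof. by move/eqP; rewrite circle_at_eq. Qed.
End Universal.

(** * The saddles of a choice in one layer of a stack *)

Section Saddles.
Variables (n : nat).
Implicit Types (m : nat -> matching n) (s : seq (saddle n)) (l : nat) (i j : 'I_(2 * n)).

Lemma contracted_map m s l0 (t : seq 'I_(2 * n)) l i :
  contracted m ([seq (l0, j) | j <- t] ++ s) l i =
  (l == l0) && ((i \in t) || (partner (m l) i \in t)) || contracted m s l i.
Proof.
have mem_pair j : ((l, j) \in [seq (l0, j') | j' <- t]) = (l == l0) && (j \in t).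
  apply/mapP/andP => [[j' j't [-> ->]]|[/eqP-> jt]]; first by rewrite eqxx.
  by exists j.
rewrite /contracted !mem_cat !mem_pair; case: (l == l0) => //=.
by rewrite orbACA.
Qed.

Lemma in_range_map k s l0 (t : seq 'I_(2 * n)) : (0 < l0 <= k)%N ->
  in_range k s -> in_range k ([seq (l0, j) | j <- t] ++ s).
Proof.
move=> lk ws; rewrite /in_range all_cat; apply/andP; split=> //.
by rewrite all_map; apply/allP.
Qed.

Lemma valid_map k m s l (o : 'I_(2 * n) -> bool) (r : seq 'I_(2 * n)) :
  (0 < l <= k)%N -> (forall i, ~~ contracted m s l i) ->
  uniq r -> {subset r <= arcs (m l)} ->
  valid_saddles k m s [seq ((l, i), o i) | i <- r].
Proof.
move=> lk nc; have {nc}: forall i, i \in r -> ~~ contracted m s l i by move=> *; apply: nc.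
elim: r s => //= i r IH s nc /andP[ir ur] ra; rewrite lk nc ?mem_head //=.
apply: IH => // [j jr|j jr]; last by apply: ra; rewrite inE jr orbT.
rewrite contracted_cons eqxx negb_or nc ?inE ?jr ?orbT //=.
rewrite negb_or; apply/andP; split; first by apply: contraNneq ir => <-.
apply/eqP=> ji.
have := ra i (mem_head _ _); have := ra j; rewrite inE jr orbT => /(_ isT).
rewrite !mem_filter ji partnerK => /andP[lt1 _] /andP[lt2 _].
by have := ltn_trans lt1 lt2; rewrite ltnn.
Qed.

Variables (b : matching n) (C : choice b).

Lemma valid_choice k m s l : m l = b -> (0 < l <= k)%N ->
  (forall i, ~~ contracted m s l i) -> valid_saddles k m s (saddles C l).
Proof.
move=> ml lk nc; apply: valid_map => //.
  by rewrite (perm_uniq (order_arcs C)) arcs_uniq.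
by move=> i; rewrite (perm_mem (order_arcs C)) ml.
Qed.

Lemma performed_saddles s l (o : 'I_(2 * n) -> bool) r :
  performed s [seq ((l, i), o i) | i <- r] = [seq (l, i) | i <- rev r] ++ s.
Proof.
elim: r s => //= i r IH s; rewrite IH rev_cons map_rcons -cats1 -catA //.
Qed.

Lemma contracted_performed m s l : m l = b ->
  forall l' i, contracted m (performed s (saddles C l)) l' i = (l' == l) || contracted m s l' i.
Proof.
move=> ml l' i; rewrite performed_saddles contracted_map; case: eqP => //= ->.
rewrite !mem_rev !(perm_mem (order_arcs C)) ml.
by have [j jb [->|->]] := contains_arc b i; rewrite ?partnerK jb ?orbT.
Qed.

Lemma in_range_performed k s l : (0 < l <= k)%N -> in_range k s ->
  in_range k (performed s (saddles C l)).
Proof. by move=> lk ws; rewrite performed_saddles; apply: in_range_map. Qed.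

Lemma size_saddles l : size (saddles C l) = n.
Proof. by rewrite size_map (perm_size (order_arcs C)) size_arcs. Qed.

Lemma performed_cat s xs ys : performed s (xs ++ ys) = performed (performed s xs) ys.
Proof. by elim: xs s => //= x xs IH s. Qed.

Lemma split_arcs_cat k m s xs ys :
  split_arcs k m s (xs ++ ys) = split_arcs k m (performed s xs) ys ++ split_arcs k m s xs.
Proof.
elim: xs s => [|x xs IH] s /=; first by rewrite cats0.
by rewrite IH; case: is_split; rewrite ?rcons_cat.
Qed.

Lemma valid_cat k m s xs ys :
  valid_saddles k m s (xs ++ ys) =
  valid_saddles k m s xs && valid_saddles k m (performed s xs) ys.
Proof. by elim: xs s => //= x xs IH s; rewrite IH !andbA. Qed.

(** Serves to reduce one layer of a three-line stack to the two-line stack for which its choice was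
    made. *)
Lemma split_arcs_local k m s l k' m' s' l' (o : 'I_(2 * n) -> bool) r :
  m l = m' l' ->
  (forall t i, is_split k m ([seq (l, j) | j <- t] ++ s) (l, i) =
               is_split k' m' ([seq (l', j) | j <- t] ++ s') (l', i)) ->
  split_arcs k m s [seq ((l, i), o i) | i <- r] =
  split_arcs k' m' s' [seq ((l', i), o i) | i <- r].
Proof.
move=> mm sp; suff h t : split_arcs k m ([seq (l, j) | j <- t] ++ s) [seq ((l, i), o i) | i <- r] =
  split_arcs k' m' ([seq (l', j) | j <- t] ++ s') [seq ((l', i), o i) | i <- r].
  exact: (h [::]).
elim: r t => //= i r IH t; rewrite sp (IH (i :: t)).
by case: is_split => //; rewrite /saddle_ends /= mm.
Qed.
End Saddles.

Section OddArc.
Variable n : nat.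
Implicit Types (a b c d : matching n) (i j : 'I_(2 * n)) (C : choices n).

Lemma in_range_nil k : in_range (n := n) k [::]. Proof. by []. Qed.

Lemma circ_at_upper b a i : circ_at b a (partner b i) = circ_at b a i.
Proof.
have := @circle_at_above n 0 (chain a [:: b]) [::] (in_range_nil 0) 0 i (leqnn 0) isT.
by rewrite /circ_at (_ : inord 0 = ord0) //; apply: val_inj; rewrite /= inordK.
Qed.

Lemma circ_at_lower b a i : circ_at b a (partner a i) = circ_at b a i.
Proof.
have := @circle_at_below n 0 (chain a [:: b]) [::] (in_range_nil 0) 0 i (leqnn 0) isT.
by rewrite /circ_at (_ : inord 0 = ord0) //; apply: val_inj; rewrite /= inordK.
Qed.

Lemma circ_atP (T : Type) (F : 'I_(2 * n) -> T) b a i j :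
  (forall r, F (partner b r) = F r) -> (forall r, F (partner a r) = F r) ->
  circ_at b a i = circ_at b a j -> F i = F j.
Proof.
move=> Fb Fa /eqP; rewrite circle_at_eq // => sij.
apply: (same_label (in_range_nil 0) (F := fun=> F) _ _ _ sij) => l r //.
  by rewrite leqn0 => /eqP-> _; apply: Fa.
by rewrite leqn0 => /eqP-> _; apply: Fb.
Qed.

Lemma circ_at_surj b a (X : circ b a) : X = circ_at b a (val X).2.
Proof.
rewrite /circ_at -[LHS](circle_at_val X (in_range_nil 0)); congr circle_at.
by case: (val X) => r i /=; rewrite (ord1 r).
Qed.

(* The signed list of the arcs of b along which C_cba splits a circle.         *)
Definition splits_of C c b a : seq ('I_(2 * n) * 'I_(2 * n)) :=
  split_arcs 1 (chain a [:: b; c]) [::] (saddles (C c b a) 1).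

Lemma size_splits_of C c b a : size (splits_of C c b a) = splits C c b a.
Proof. exact: size_split_arcs. Qed.

Lemma mem_splits_of C c b a p : p \in splits_of C c b a -> p.2 = partner b p.1.
Proof.
rewrite /splits_of /saddles; move: (C c b a) => ch; move: ([::] : seq (saddle n)).
elim: (Defs.order ch) => //= i r IH s.
case: is_split; last exact: (IH _).
rewrite mem_rcons inE => /orP[/eqP->|]; last exact: IH.
by rewrite /saddle_ends /=; case: (orientation _ _) => //=; rewrite partnerK.
Qed.

Section Stack2.
Variables (C : choices n) (c b a : matching n).
Notation m := (chain a [:: b; c]).
Notation xs := (saddles (C c b a) 1).

Lemma valid2 : valid_saddles 1 m [::] xs.
Proof. exact: valid_choice. Qed.

Lemma range2 : in_range 1 (performed [::] xs).
Proof. exact: in_range_performed. Qed.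

Lemma contracted2 l i : contracted m (performed [::] xs) l i = (l == 1)%N.
Proof. by rewrite (contracted_performed (b := b)) // orbF. Qed.

Lemma label2 (T : Type) (z : 'I_(2 * n) -> T) :
  (forall i, z (partner c i) = z i) -> (forall i, z (partner a i) = z i) ->
  forall u v : point n 1, same m (performed [::] xs) u v -> z u.2 = z v.2.
Proof.
move=> zc za u v; apply: (same_label range2 (F := fun=> z)) => // -[|[|l]] i //=;
by rewrite contracted2.
Qed.

(** Once all arcs of [b] are contracted, the two lines are parallel copies joined by vertical
    strands. *)
Lemma card_performed2 : #|circles 1 m (performed [::] xs)| = #|circ c a|.
Proof.
pose f (X : circles 1 m (performed [::] xs)) := circ_at c a (val X).2.
have vert i : circle_at (k := 1) m (performed [::] xs) (inord 0, i) =
    circle_at (k := 1) m (performed [::] xs) (inord 1, i).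
  by apply: (@circle_at_vert n 1 m (performed [::] xs) range2 1 i); rewrite contracted2.
have all0 X : X = circle_at (k := 1) m (performed [::] xs) (inord 0, (val X).2).
  rewrite -[LHS](circle_at_val X range2).
  case: (val X) => r i /=; have [->|->] : r = inord 0 \/ r = inord 1; last by rewrite vert.
    case: r => -[|[|//]] p; [left|right]; apply: val_inj; rewrite /= inordK //.
  by [].
rewrite -(card_imset _ (_ : injective f)).
  apply: eq_card => Y; rewrite (circ_at_surj Y) !inE.
  apply/imsetP; exists (circle_at (k := 1) m (performed [::] xs) (inord 0, (val Y).2)) => //.
  symmetry; apply: (@label2 _ (circ_at c a) _ _ _ (inord 0, (val Y).2)) => [i|i|].
  - exact: circ_at_upper.
  - exact: circ_at_lower.
  - by rewrite same_sym ?range2 //; apply: same_circle_at.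
move=> X Y fXY; rewrite (all0 X) (all0 Y); move: fXY.
apply: (@circ_atP _ (fun i => circle_at (k := 1) m (performed [::] xs) (inord 0, i))) => i.
  rewrite !vert; apply: (@circle_at_above n 1 m _ range2 1) => //.
  by rewrite contracted2.
by apply: (@circle_at_below n 1 m _ range2 0) => //; rewrite contracted2.
Qed.

Lemma card_disjoint2 : #|circles 1 m [::]| = (#|circ c b| + #|circ b a|)%N.
Proof.
pose F (l : nat) i : circ c b + circ b a :=
  if l is 0 then inr (circ_at b a i) else inl (circ_at c b i).
have FP (u v : point n 1) : same m [::] u v -> F u.1 u.2 = F v.1 v.2.
  apply: same_label => // -[|[|l]] i //= _ _;
  by rewrite ?circ_at_upper ?circ_at_lower.
pose f (X : circles 1 m [::]) := F (val X).1 (val X).2.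
rewrite -card_sum -(card_imset _ (_ : injective f)).
  have fE (r : 'I_2) i : f (circle_at m [::] (r, i)) = F r i.
    by apply: (FP _ (r, i)); rewrite same_sym //; apply: same_circle_at.
  apply: eq_card => -[] Y; rewrite (circ_at_surj Y) !inE; apply/imsetP.
    by exists (circle_at m [::] (inord 1 : 'I_2, (val Y).2)); rewrite ?fE ?inordK.
  by exists (circle_at m [::] (inord 0 : 'I_2, (val Y).2)); rewrite ?fE ?inordK.
move=> X Y.
rewrite -{2}(circle_at_val X (in_range_nil 1)) -{2}(circle_at_val Y (in_range_nil 1)) /f.
case: (val X) => r i; case: (val Y) => r' j /=.
have rE (t : 'I_2) : t = inord t by apply: val_inj; rewrite /= inordK.
have [r0|r1] := posnP r; have [r'0|r'1] := posnP r'.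
- rewrite (rE r) (rE r') r0 r'0 /F !inordK // => -[e].
  have {e} : circ_at b a i = circ_at b a j by apply: val_inj.
  apply: (@circ_atP _ (fun i => circle_at (k := 1) m [::] (inord 0, i))) => t.
    exact: (@circle_at_above n 1 m [::] _ 0).
  exact: (@circle_at_below n 1 m [::] _ 0).
- by rewrite r0 -(prednK r'1).
- by rewrite r'0 -(prednK r1).
have r1' : nat_of_ord r = 1%N by case: (r) r1 => -[|[|]].
have r'1' : nat_of_ord r' = 1%N by case: (r') r'1 => -[|[|]].
rewrite (rE r) (rE r') r1' r'1' /F !inordK // => -[e].
have {e} : circ_at c b i = circ_at c b j by apply: val_inj.
apply: (@circ_atP _ (fun i => circle_at (k := 1) m [::] (inord 1, i))) => t.
  exact: (@circle_at_above n 1 m [::] _ 1).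
exact: (@circle_at_below n 1 m [::] _ 1).
Qed.

(** Of the [n] saddles, each split adds a circle and each merge removes one. *)
Lemma count_splits :
  ((splits C c b a).*2 + #|circ c b| + #|circ b a| = #|circ c a| + n)%N.
Proof.
have := card_circles_performed (in_range_nil 1) valid2.
rewrite card_performed2 card_disjoint2 size_saddles -/(splits C c b a).
lia.
Qed.

End Stack2.
End OddArc.

(* Locked, since unifying #|circ b a| with #|circ b' a'| unfolds both types.    *)
HB.lock Definition ncirc n (b a : matching n) : nat := #|circ b a|.

Section CircleCount.
Variable n : nat.
Implicit Types (a b c : matching n) (i j : 'I_(2 * n)) (C : choices n).

Lemma ncirc_splits C c b a :
  ((splits C c b a).*2 + ncirc c b + ncirc b a = ncirc c a + n)%N.
Proof. by rewrite ncirc.unlock; apply: count_splits. Qed.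

Lemma ncirc_porbits b a (w0 : in_range 0 [::]) :
  ncirc b a = #|porbits (forward_perm (chain a [:: b]) w0)|.
Proof. by rewrite ncirc.unlock; apply: card_circles. Qed.

Lemma ncirc_le b a b' a' :
  (forall i j, circ_at b a i = circ_at b a j -> circ_at b' a' i = circ_at b' a' j) ->
  (ncirc b' a' <= ncirc b a)%N.
Proof.
rewrite ncirc.unlock => H; pose f (X : circ b a) : circ b' a' := circ_at b' a' (val X).2.
apply: leq_trans (leq_imset_card f predT); apply: subset_leq_card.
apply/subsetP=> Y _; apply/imsetP; exists (circ_at b a (val Y).2) => //.
by rewrite {1}(circ_at_surj Y); apply: H; rewrite -circ_at_surj.
Qed.
End CircleCount.

(** Labels are compared modulo these linear forms, which [split_prod] kills. *)
Definition arc_span n (R : comNzRingType) (C : choices n) (c b a : matching n)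
    (x : ext R (circ c a)) : Prop :=
  lspan (diffs R (circ_at c a) (splits_of C c b a)) x.
Arguments arc_span {n R} C c b a x.

Definition split_prod n (R : comNzRingType) (C : choices n) (c b a : matching n) :
    ext R (circ c a) :=
  arc_prod R (circ_at c a) (splits_of C c b a).
Arguments split_prod {n} R C c b a.

(** A circle of $W(c)b$ may meet several circles of $W(d)e$. Taking the one through its root is an
    arbitrary choice, harmless behind a suitable [split_prod]. *)
Definition relabel_circ n (c b d e : matching n) (X : circ c b) : circ d e :=
  circ_at d e (val X).2.
Arguments relabel_circ {n c b} d e X.

Section Product.
Variables (n : nat) (R : comNzRingType) (C : choices n).
Implicit Types (a b c d : matching n) (i j : 'I_(2 * n)).

Lemma arc_span_same c b a (u v : point n 1) : same (chain a [:: b; c]) [::] u v ->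
  arc_span C c b a (ext_gen R (circ_at c a u.2) - ext_gen R (circ_at c a v.2)).
Proof.
apply: lspan_same => //; first exact: valid2.
by apply: label2 => r; rewrite ?circ_at_upper ?circ_at_lower.
Qed.

Lemma arc_span_upper c b a i j : circ_at c b i = circ_at c b j ->
  arc_span C c b a (ext_gen R (circ_at c a i) - ext_gen R (circ_at c a j)).
Proof.
move=> eij; apply: (arc_span_same (u := (inord 1, i)) (v := (inord 1, j))).
apply: same_inord => //; move: eij.
apply: (@circ_atP _ _ (fun i => circle_at (k := 1) _ [::] (inord 1, i))) => t.
  exact: (@circle_at_above n 1 _ [::] _ 1).
exact: (@circle_at_below n 1 _ [::] _ 1).
Qed.

Lemma arc_span_lower c b a i j : circ_at b a i = circ_at b a j ->
  arc_span C c b a (ext_gen R (circ_at c a i) - ext_gen R (circ_at c a j)).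
Proof.
move=> eij; apply: (arc_span_same (u := (inord 0, i)) (v := (inord 0, j))).
apply: same_inord => //; move: eij.
apply: (@circ_atP _ _ (fun i => circle_at (k := 1) _ [::] (inord 0, i))) => t.
  exact: (@circle_at_above n 1 _ [::] _ 0).
exact: (@circle_at_below n 1 _ [::] _ 0).
Qed.

Lemma arc_span_arc c b a i :
  arc_span C c b a (ext_gen R (circ_at c a i) - ext_gen R (circ_at c a (partner b i))).
Proof. by apply: arc_span_lower; rewrite circ_at_upper. Qed.

Lemma split_prod_kill c b a x : arc_span C c b a x -> wedge (split_prod R C c b a) x = 0.
Proof. by apply: wprod_span; apply: diffs_deg1. Qed.

Lemma split_prod_line c b a (r : nat) d e (x : ext R (circ d e)) :
  ext_hom (fun X : circles 1 (chain a [:: b; c]) [::] => ext_gen R (circ_at c a (val X).2))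
    (ext_map (fun X : circ d e => circle_at (k := 1) (chain a [:: b; c]) [::]
                                    (inord r, (val X).2)) x) =
  ext_hom (fun X : circ d e => ext_gen R (circ_at c a
     (val (circle_at (k := 1) (chain a [:: b; c]) [::] (inord r, (val X).2))).2)) x.
Proof.
rewrite ext_mapE ext_hom_comp; try by move=> *; apply: deg1_gen.
by apply: eq_ext_hom => X; rewrite ext_hom_gen.
Qed.

(** The definition passes through the roots of the two-line stack; [split_prod] kills the difference
    to the direct relabelling. *)
Lemma OF2_closed c b a (x : ext R (circ c b)) (y : ext R (circ b a)) :
  OF2 C x y = wedge (split_prod R C c b a)
    (wedge (ext_map (relabel_circ c a) x) (ext_map (relabel_circ c a) y)).
Proof.
rewrite /OF2 (saddle_maps_label _ (z := circ_at c a)) //; last 2 first.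
- exact: valid2.
- by apply: label2 => r; rewrite ?circ_at_upper ?circ_at_lower.
rewrite -/(split_prod R C c b a) [ext_map _ (wedge _ _)]ext_mapE ext_homM; last first.
  by move=> X; apply: deg1_gen.
pose W u v := wedge (split_prod R C c b a) (wedge u v).
apply: etrans (f_equal2 W (split_prod_line c b a 1 x) (split_prod_line c b a 0 y)) _.
apply: etrans _ (esym (f_equal2 W (ext_mapE _ x) (ext_mapE _ y))).
apply: wedge_ext_hom_eq2 => X; try exact: deg1_gen; apply: split_prod_kill.
  apply: (arc_span_same (u := val (circle_at _ [::] (inord 1, (val X).2)))
    (v := (inord 1, (val X).2))).
  by rewrite same_sym //; apply: same_circle_at.
apply: (arc_span_same (u := val (circle_at _ [::] (inord 0, (val X).2)))
  (v := (inord 0, (val X).2))).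
by rewrite same_sym //; apply: same_circle_at.
Qed.

End Product.

(** * The two composites on a three-line stack *)

Section Stack3.
Variables (n : nat) (C : choices n) (d c b a : matching n).
Implicit Types (i j : 'I_(2 * n)) (t : seq 'I_(2 * n)).
Notation m3 := (chain a [:: b; c; d]).
Notation cA3 s l i := (circle_at (k := 2) m3 s (inord l, i)).

Lemma in_range_pair k l t : (0 < l <= k)%N -> in_range k [seq (l, j) | j <- t].
Proof. by move=> lk; have := in_range_map t lk (in_range_nil n k); rewrite cats0. Qed.

Lemma contracted_pair (m : nat -> matching n) l0 t l i :
  contracted m [seq (l0, j) | j <- t] l i =
  (l == l0) && ((i \in t) || (partner (m l) i \in t)).
Proof. by have := contracted_map m [::] l0 t l i; rewrite cats0 orbF. Qed.

Lemma is_splitE k m (s : seq (saddle n)) l i : in_range k s ->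
  is_split k m s (l, i) =
  (circle_at (k := k) m s (inord l.-1, i) == circle_at (k := k) m s (inord l, i)).
Proof. by move=> ws; rewrite circle_at_eq. Qed.

Lemma is_split_upper t i :
  is_split 2 m3 [seq (2, j) | j <- t] (2, i) =
  is_split 1 (chain b [:: c; d]) [seq (1%N, j) | j <- t] (1%N, i).
Proof.
have w3 := in_range_pair t (isT : (0 < 2 <= 2)%N).
have w2 := in_range_pair t (isT : (0 < 1 <= 1)%N).
set s3 := [seq (2, j) | j <- t] in w3 *; set s2 := [seq (1%N, j) | j <- t] in w2 *.
have c3 := contracted_pair m3 2 t; have c2 := contracted_pair (chain b [:: c; d]) 1 t.
rewrite -/s3 in c3; rewrite -/s2 in c2.
rewrite !is_splitE //=; apply/eqP/eqP => /same_inord e.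
  pose F (l : nat) i := if l is l'.+1
    then Some (circle_at (k := 1) (chain b [:: c; d]) s2 (inord l', i)) else None.
  have := same_label w3 (F := F) _ _ _ (e w3).
  rewrite !inordK // /F => H; apply: Some_inj; apply: H => -[|[|[|l]]] r //= _;
  rewrite c3 //= => c'; congr Some.
  - by apply: (@circle_at_vert _ _ _ _ w2 1 r); rewrite c2.
  - by apply: (circle_at_below w2) => //; rewrite c2.
  - by apply: (circle_at_below w2) => //; rewrite c2.
  - by apply: (circle_at_above w2) => //; rewrite c2.
  - by apply: (circle_at_above w2) => //; rewrite c2.
pose F (l : nat) i := cA3 s3 l.+1 i.
have := same_label w2 (F := F) _ _ _ (e w2).
rewrite !inordK // /F => H; apply: H => -[|[|l]] r //= _; rewrite c2 //= => c'.
- by apply: (@circle_at_vert _ _ _ _ w3 2 r); rewrite c3.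
- by apply: (circle_at_below w3) => //; rewrite c3.
- by apply: (circle_at_below w3) => //; rewrite c3.
- by apply: (circle_at_above w3) => //; rewrite c3.
- by apply: (circle_at_above w3) => //; rewrite c3.
Qed.

Lemma is_split_lower t i :
  is_split 2 m3 [seq (1%N, j) | j <- t] (1%N, i) =
  is_split 1 (chain a [:: b; c]) [seq (1%N, j) | j <- t] (1%N, i).
Proof.
have w3 := in_range_pair t (isT : (0 < 1 <= 2)%N).
have w2 := in_range_pair t (isT : (0 < 1 <= 1)%N).
set s := [seq (1%N, j) | j <- t] in w3 w2 *.
have c3 := contracted_pair m3 1 t; have c2 := contracted_pair (chain a [:: b; c]) 1 t.
rewrite -/s in c3 c2.
rewrite !is_splitE //=; apply/eqP/eqP => /same_inord e.
  pose F (l : nat) i := if (l < 2)%N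
    then Some (circle_at (k := 1) (chain a [:: b; c]) s (inord l, i)) else None.
  have := same_label w3 (F := F) _ _ _ (e w3).
  rewrite !inordK // /F => H; apply: Some_inj; apply: H => -[|[|[|l]]] r //= _;
  rewrite c3 //= => c'; congr Some.
  - by apply: (@circle_at_vert _ _ _ _ w2 1 r); rewrite c2.
  - by apply: (circle_at_below w2) => //; rewrite c2.
  - by apply: (circle_at_below w2) => //; rewrite c2.
  - by apply: (circle_at_above w2) => //; rewrite c2.
  - by apply: (circle_at_above w2) => //; rewrite c2.
pose F (l : nat) i := cA3 s l i.
have := same_label w2 (F := F) _ _ _ (e w2).
rewrite !inordK // /F => H; apply: H => -[|[|l]] r //= _; rewrite c2 //= => c'.
- by apply: (@circle_at_vert _ _ _ _ w3 1 r); rewrite c3.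
- by apply: (circle_at_below w3) => //; rewrite c3.
- by apply: (circle_at_below w3) => //; rewrite c3.
- by apply: (circle_at_above w3) => //; rewrite c3.
- by apply: (circle_at_above w3) => //; rewrite c3.
Qed.

Lemma is_split_after_upper t i (s0 := performed [::] (saddles (C d c b) 2)) :
  is_split 2 m3 ([seq (1%N, j) | j <- t] ++ s0) (1%N, i) =
  is_split 1 (chain a [:: b; d]) [seq (1%N, j) | j <- t] (1%N, i).
Proof.
have w0 : in_range 2 s0 by apply: in_range_performed.
have w3 := in_range_map t (isT : (0 < 1 <= 2)%N) w0.
have w2 := in_range_pair t (isT : (0 < 1 <= 1)%N).
have c3 l r : contracted m3 ([seq (1%N, j) | j <- t] ++ s0) l r =
    (l == 1)%N && ((r \in t) || (partner (m3 l) r \in t)) || (l == 2).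
  by rewrite contracted_map (contracted_performed (b := c)) // orbF.
have c2 := contracted_pair (chain a [:: b; d]) 1 t.
set s2 := [seq (1%N, j) | j <- t] in w2 c2 w3 c3 *; set s3 := s2 ++ s0 in w3 c3 *.
rewrite !is_splitE //=; apply/eqP/eqP => /same_inord e.
  pose F (l : nat) i := circle_at (k := 1) (chain a [:: b; d]) s2 (inord (minn l 1), i).
  have := same_label w3 (F := F) _ _ _ (e w3).
  rewrite !inordK // /F => H; apply: H => -[|[|[|l]]] r //= _;
  rewrite c3 //= ?orbF => c'.
  - by apply: (@circle_at_vert _ _ _ _ w2 1 r); rewrite c2.
  - by apply: (circle_at_below w2) => //; rewrite c2.
  - by apply: (circle_at_below w2) => //; rewrite c2.
  - by apply: (circle_at_above w2) => //; rewrite c2.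
  - by apply: (circle_at_above w2) => //; rewrite c2.
have vert r : cA3 s3 1 r = cA3 s3 2 r by apply: (@circle_at_vert _ _ _ _ w3 2 r); rewrite c3.
pose F (l : nat) i := cA3 s3 l i.
have := same_label w2 (F := F) _ _ _ (e w2).
rewrite !inordK // /F => H; apply: H => -[|[|l]] r //= _; rewrite c2 //= => c'.
- by apply: (@circle_at_vert _ _ _ _ w3 1 r); rewrite c3 /= c'.
- by apply: (circle_at_below w3) => //; rewrite c3.
- by apply: (circle_at_below w3) => //; rewrite c3 /= orbF.
- by apply: (circle_at_above w3) => //; rewrite c3 /= orbF.
- by rewrite !vert; apply: (circle_at_above w3) => //; rewrite c3.
Qed.

Lemma is_split_after_lower t i (s0 := performed [::] (saddles (C c b a) 1)) :
  is_split 2 m3 ([seq (2, j) | j <- t] ++ s0) (2, i) =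
  is_split 1 (chain a [:: c; d]) [seq (1%N, j) | j <- t] (1%N, i).
Proof.
have w0 : in_range 2 s0 by apply: in_range_performed.
have w3 := in_range_map t (isT : (0 < 2 <= 2)%N) w0.
have w2 := in_range_pair t (isT : (0 < 1 <= 1)%N).
have c3 l r : contracted m3 ([seq (2, j) | j <- t] ++ s0) l r =
    (l == 2)%N && ((r \in t) || (partner (m3 l) r \in t)) || (l == 1)%N.
  by rewrite contracted_map (contracted_performed (b := b)) // orbF.
have c2 := contracted_pair (chain a [:: c; d]) 1 t.
set s2 := [seq (1%N, j) | j <- t] in w2 c2 *; set s3 := _ ++ s0 in w3 c3 *.
rewrite !is_splitE //=; apply/eqP/eqP => /same_inord e.
  pose F (l : nat) i := circle_at (k := 1) (chain a [:: c; d]) s2 (inord l.-1, i).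
  have := same_label w3 (F := F) _ _ _ (e w3).
  rewrite !inordK // /F => H; apply: H => -[|[|[|l]]] r //= _;
  rewrite c3 //= ?orbF => c'.
  - by apply: (@circle_at_vert _ _ _ _ w2 1 r); rewrite c2.
  - by apply: (circle_at_below w2) => //; rewrite c2.
  - by apply: (circle_at_below w2) => //; rewrite c2.
  - by apply: (circle_at_above w2) => //; rewrite c2.
  - by apply: (circle_at_above w2) => //; rewrite c2.
have vert r : cA3 s3 0 r = cA3 s3 1 r by apply: (@circle_at_vert _ _ _ _ w3 1 r); rewrite c3.
pose F (l : nat) i := cA3 s3 l.+1 i.
have := same_label w2 (F := F) _ _ _ (e w2).
rewrite !inordK // /F => H; apply: H => -[|[|l]] r //= _; rewrite c2 //= => c'.
- by apply: (@circle_at_vert _ _ _ _ w3 2 r); rewrite c3 /= c'.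
- by rewrite -!vert; apply: (circle_at_below w3) => //; rewrite c3.
- by apply: (circle_at_below w3) => //; rewrite c3 /= orbF.
- by apply: (circle_at_above w3) => //; rewrite c3 /= orbF.
- by apply: (circle_at_above w3) => //; rewrite c3.
Qed.

Lemma split_arcs_upper_first :
  split_arcs 2 m3 [::] (contract_upper_first C d c b a) =
  splits_of C d b a ++ splits_of C d c b.
Proof.
rewrite split_arcs_cat; congr (_ ++ _); apply: split_arcs_local => // t i.
  by rewrite is_split_after_upper cats0.
by rewrite !cats0 is_split_upper.
Qed.

Lemma split_arcs_lower_first :
  split_arcs 2 m3 [::] (contract_lower_first C d c b a) =
  splits_of C d c a ++ splits_of C c b a.
Proof.
rewrite split_arcs_cat; congr (_ ++ _); apply: split_arcs_local => // t i.
  by rewrite is_split_after_lower cats0.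
by rewrite !cats0 is_split_lower.
Qed.

(** Associators are read off at the unit, where a composite is the product of its split factors. *)
Lemma OF3_one (R : comNzRingType) xs : valid_saddles 2 m3 [::] xs ->
  (forall l i, contracted m3 (performed [::] xs) l i = (l == 1)%N || (l == 2)) ->
  OF3 (d := d) (c := c) (b := b) (a := a) xs (ext_basis R set0) = arc_prod R (circ_at d a) (split_arcs 2 m3 [::] xs).
Proof.
move=> vx cx; rewrite /OF3 (saddle_maps_label _ (z := circ_at d a)) //.
  by rewrite ext_mapE ext_hom1 wedge1r.
have wp : in_range 2 (performed [::] xs).
  have wnil := in_range_nil n 2; move: ([::] : seq (saddle n)) wnil vx.
  elim: xs {cx} => //= x xs IH s ws /and3P[lk _ vx]; apply: IH vx.
  by rewrite /in_range /= lk.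
move=> u v; apply: (same_label wp (F := fun=> circ_at d a)) => // -[|[|[|l]]] i //=;
by rewrite cx //= ?circ_at_upper ?circ_at_lower.
Qed.

Lemma OF3_upper_first (R : comNzRingType) :
  OF3 (d := d) (c := c) (b := b) (a := a) (contract_upper_first C d c b a) (ext_basis R set0) =
  arc_prod R (circ_at d a) (splits_of C d b a ++ splits_of C d c b).
Proof.
rewrite OF3_one ?split_arcs_upper_first //.
  rewrite valid_cat !valid_choice // => i.
  by rewrite (contracted_performed (b := c)).
move=> l i; rewrite performed_cat (contracted_performed (b := b)) //.
by rewrite (contracted_performed (b := c)) // orbF.
Qed.

Lemma OF3_lower_first (R : comNzRingType) :
  OF3 (d := d) (c := c) (b := b) (a := a) (contract_lower_first C d c b a) (ext_basis R set0) =
  arc_prod R (circ_at d a) (splits_of C d c a ++ splits_of C c b a).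
Proof.
rewrite OF3_one ?split_arcs_lower_first //.
  rewrite valid_cat !valid_choice // => i.
  by rewrite (contracted_performed (b := b)).
move=> l i; rewrite performed_cat (contracted_performed (b := c)) //.
by rewrite (contracted_performed (b := b)) // orbF orbC.
Qed.

End Stack3.

(** * Signs of the products *)

Lemma arc_prod_hom (R : comNzRingType) (N J : finType) (z : N -> J) l :
  arc_prod R z l = ext_hom (fun i => ext_gen R (z i)) (arc_prod R id l).
Proof.
have g1 i : deg1 (ext_gen R (z i)) by apply: deg1_gen.
rewrite [in RHS]/arc_prod ext_hom_wprod // /diffs -map_comp; congr wprod.
by apply: eq_map => p /=; rewrite ext_homB !ext_hom_gen.
Qed.

Lemma ext_map_arc_prod (R : comNzRingType) (N I J : finType) (z : N -> I) (f : I -> J) l :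
  ext_map f (arc_prod R z l) = arc_prod R (fun i => f (z i)) l.
Proof.
rewrite ext_mapE arc_prod_hom ext_hom_comp; try by move=> *; apply: deg1_gen.
rewrite [RHS]arc_prod_hom; apply: eq_ext_hom => i.
by rewrite ext_hom_gen.
Qed.

Section Signs.
Variables (n : nat).
Implicit Types (a b c d : matching n) (C : choices n).

Lemma splits_indep C C' c b a : splits C' c b a = splits C c b a.
Proof. by have := ncirc_splits C c b a; have := ncirc_splits C' c b a; lia. Qed.

Lemma diffs_arc_span R C C' c b a x :
  x \in diffs R (circ_at c a) (splits_of C' c b a) -> arc_span C c b a x.
Proof.
by move=> /mapP[p /mem_splits_of p2 ->]; rewrite p2; apply: arc_span_arc.
Qed.

Definition eps C C' c b a := split_prod int C' c b a != split_prod int C c b a.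

(** Either choice splits along arcs of [b], and the difference across any arc of [b] lies in the
    span of the factors of the other choice. *)
Lemma epsP C C' c b a :
  split_prod int C' c b a = (-1) ^+ eps C C' c b a *: split_prod int C c b a.
Proof.
have [s] : exists s : bool, split_prod int C' c b a = (-1) ^+ s *: split_prod int C c b a.
  apply: wprod_same_span; try exact: diffs_deg1.
  - by rewrite !size_map !size_splits_of (splits_indep C).
  - exact: diffs_arc_span.
  - exact: diffs_arc_span.
rewrite /eps => E; case: eqVneq => [->|] /=; first by rewrite scale1r.
by rewrite E; case: s {E} => //=; rewrite scale1r eqxx.
Qed.

Lemma split_prod_base (R : comNzRingType) C c b a :
  split_prod R C c b a = ext_base (intr : {rmorphism int -> R}) (split_prod int C c b a).
Proof. by rewrite arc_prod_base. Qed.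

Lemma split_prod_eps (R : comNzRingType) C C' c b a :
  split_prod R C' c b a = (-1) ^+ eps C C' c b a *: split_prod R C c b a.
Proof. by rewrite (split_prod_base R C') (epsP C) ext_base_sign -split_prod_base. Qed.

(** Behind [split_prod], a product of labels may first be formed on the circles of $W(e)f$. A sign
    known there, such as [eps], thereby passes to $W(d)a$. *)
Lemma split_prod_transport R C d b a (e f : matching n) l :
  (forall i j, circ_at e f i = circ_at e f j ->
    arc_span C d b a (ext_gen R (circ_at d a i) - ext_gen R (circ_at d a j))) ->
  wedge (split_prod R C d b a) (arc_prod R (circ_at d a) l) =
  wedge (split_prod R C d b a) (ext_map (relabel_circ d a) (arc_prod R (circ_at e f) l)).
Proof.
move=> ef; rewrite ext_map_arc_prod [in LHS]arc_prod_hom [in RHS]arc_prod_hom.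
apply: wedge_ext_hom_eq => i; try exact: deg1_gen.
by apply/split_prod_kill/ef; rewrite -circ_at_surj.
Qed.

Definition upper_prod C d c b a : ext int (circ d a) :=
  arc_prod int (circ_at d a) (splits_of C d b a ++ splits_of C d c b).
Definition lower_prod C d c b a : ext int (circ d a) :=
  arc_prod int (circ_at d a) (splits_of C d c a ++ splits_of C c b a).

Lemma upper_prod_eps C C' d c b a :
  upper_prod C' d c b a =
  (-1) ^+ (eps C C' d b a (+) eps C C' d c b) *: upper_prod C d c b a.
Proof.
rewrite /upper_prod !arc_prod_cat -/(split_prod int C' d b a) -/(split_prod int C d b a).
rewrite !(split_prod_transport _ (@arc_span_upper _ _ _ _ _ _)).
rewrite -/(split_prod int C' d c b) -/(split_prod int C d c b) !(epsP C C').
by rewrite !ext_mapE ext_homZ wedgeZl wedgeZr scalerA signr_addb.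
Qed.

Lemma lower_prod_eps C C' d c b a :
  lower_prod C' d c b a =
  (-1) ^+ (eps C C' d c a (+) eps C C' c b a) *: lower_prod C d c b a.
Proof.
rewrite /lower_prod !arc_prod_cat -/(split_prod int C' d c a) -/(split_prod int C d c a).
rewrite !(split_prod_transport _ (@arc_span_lower _ _ _ _ _ _)).
rewrite -/(split_prod int C' c b a) -/(split_prod int C c b a) !(epsP C C').
by rewrite !ext_mapE ext_homZ wedgeZl wedgeZr scalerA signr_addb.
Qed.

Section Phi.
Variables (C : choices n) (phi : matching n -> matching n -> matching n -> matching n -> 'Z_2).
Hypothesis phiC : is_phi_ch C phi.

Lemma upper_lower d c b a :
  upper_prod C d c b a = (-1) ^+ odd (phi d c b a) *: lower_prod C d c b a.
Proof.
by have := @phiC a b c d (ext_basis int set0); rewrite OF3_upper_first OF3_lower_first signr_odd.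
Qed.

(* OF(C_cba), respectively the map of the two composites to W(d)a, is nonzero. *)
Definition nz3 c b a := split_prod int C c b a != 0.
Definition nz4 d c b a := upper_prod C d c b a != 0.

Lemma signz_neq0 (I : finType) (s : nat) (x : ext int I) : ((-1) ^+ s *: x != 0) = (x != 0).
Proof.
congr (~~ _); apply/eqP/eqP => [|->]; last by rewrite scaler0.
by move/(congr1 (fun y => (-1) ^+ s *: y)); rewrite signrZK scaler0.
Qed.

Lemma nz4_lower d c b a : nz4 d c b a = (lower_prod C d c b a != 0).
Proof. by rewrite /nz4 upper_lower signz_neq0. Qed.

Lemma nz4_unit_lower d c b a : splits C c b a = 0%N -> nz4 d c b a = nz3 d c a.
Proof.
by rewrite -size_splits_of => /size0nil s0; rewrite nz4_lower /lower_prod s0 cats0.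
Qed.

Lemma nz4_unit_upper d c b a : splits C d c b = 0%N -> nz4 d c b a = nz3 d b a.
Proof.
by rewrite -size_splits_of => /size0nil s0; rewrite /nz4 /upper_prod s0 cats0.
Qed.

Lemma nz4_nz3 d c b a : nz4 d c b a -> nz3 d b a /\ nz3 d c a.
Proof.
move=> h; split.
  by apply: contra h; rewrite /upper_prod arc_prod_cat => /eqP E;
     rewrite [arc_prod _ _ (splits_of C d b a)]E wedge0l.
move: h; rewrite nz4_lower; apply: contra; rewrite /lower_prod arc_prod_cat => /eqP E.
by rewrite [arc_prod _ _ (splits_of C d c a)]E wedge0l.
Qed.

Lemma nz4_nz3_factor d c b a : nz4 d c b a -> nz3 d c b /\ nz3 c b a.
Proof.
move=> h; split.
  apply: contra h; rewrite /upper_prod arc_prod_cat => /eqP E.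
  rewrite (split_prod_transport _ (@arc_span_upper _ _ C d b a)).
  by rewrite [arc_prod _ _ _]E ext_mapE ext_hom0 wedge0r.
move: h; rewrite nz4_lower; apply: contra; rewrite /lower_prod arc_prod_cat => /eqP E.
rewrite (split_prod_transport _ (@arc_span_lower _ _ C d c a)).
by rewrite [arc_prod _ _ _]E ext_mapE ext_hom0 wedge0r.
Qed.

(* If the ends of every arc of b lie on a common circle of W(c)a, then every   *)
(* circle of W(c)b meets a single circle of W(c)a, so |W(c)a| <= |W(c)b|.      *)
Lemma nz3_one c b a : splits C c b a = 1%N -> (ncirc c b < ncirc c a)%N -> nz3 c b a.
Proof.
rewrite -size_splits_of /nz3 /split_prod => s1; apply: contraTneq => p0.
have arc_eq i : circ_at c a (partner b i) = circ_at c a i.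
  have [p sp] : exists p, splits_of C c b a = [:: p].
    by case: (splits_of C c b a) s1 => [|p [|]] // _; exists p.
  move: p0; rewrite sp /arc_prod wprod_cons wprod_nil wedge1r => p0.
  have := arc_span_arc int C c b a i; rewrite /arc_span sp /=.
  move=> [k [_ [->]]]; rewrite p0 scaler0 addr0 => /eqP e.
  by apply/esym/eqP; apply: contraLR e => h; apply: ext_gen_diff_neq0 h.
rewrite -leqNgt; apply: ncirc_le => i j.
by apply: circ_atP => // r; apply: circ_at_upper.
Qed.
End Phi.

(** Changing the choices multiplies the upper and the lower product by signs made of [eps], and a
    nonzero integral element determines the sign that relates them. *)
Lemma phi_eps C C' phi phi' d c b a : is_phi_ch C phi -> is_phi_ch C' phi' ->
  nz4 C d c b a ->
  odd (phi d c b a) (+) odd (phi' d c b a) =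
  eps C C' d c b (+) eps C C' d c a (+) eps C C' d b a (+) eps C C' c b a.
Proof.
move=> hC hC' nz; have := upper_lower hC' d c b a.
rewrite (upper_prod_eps C) (lower_prod_eps C) (upper_lower hC) !scalerA -!signr_addb.
move/signz_eq => /(_ _); rewrite -(nz4_lower hC) => /(_ nz).
set x := odd _; set y := odd _.
by case: x; case: y; case: (eps _ _ d c b); case: (eps _ _ d c a); case: (eps _ _ d b a);
  case: (eps _ _ c b a).
Qed.

End Signs.

Local Close Scope ring_scope.

(** * Counting circles *)

Section Counting.
Variable n : nat.
Implicit Types (a b c : matching n) (i j r x y : 'I_(2 * n)).

Lemma ncirc_sym b a : ncirc b a = ncirc a b.
Proof.
have le b' a' : ncirc b' a' <= ncirc a' b'.
  apply: ncirc_le => i j; apply: circ_atP => r; first exact: circ_at_lower.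
  exact: circ_at_upper.
by apply/eqP; rewrite eqn_leq; apply/andP; split; apply: le.
Qed.

Lemma circ_at_diag b i j : circ_at b b i = circ_at b b j -> j = i \/ j = partner b i.
Proof.
pose F r := if r < partner b r then r else partner b r.
have FE r : F (partner b r) = F r.
  rewrite /F partnerK; case: ltngtP => // e.
  by have := partner_neq b r; rewrite -(inj_eq val_inj) /= e eqxx.
move/(circ_atP (F := F) FE FE); rewrite /F.
case: ifP => _; case: ifP => _ e; rewrite ?e ?partnerK; auto.
by left; apply: (can_inj (@partnerK _ b)).
Qed.

Lemma ncirc_diag_ge b : n <= ncirc b b.
Proof.
pose f i := (circ_at b b i, i < partner b i).
have f_inj : injective f.
  move=> i j fij; have := congr1 snd fij; rewrite /=.
  have [->//|->] := circ_at_diag (congr1 fst fij); rewrite partnerK; case: ltngtP => // e.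
  by have := partner_neq b i; rewrite -(inj_eq val_inj) /= e eqxx.
rewrite ncirc.unlock; have := max_card (mem (f @: setT)).
by rewrite card_imset // cardsT card_ord card_prod card_bool mulnC leq_mul2r.
Qed.

(** Only the successors of the even points [i] and [partner b j] change, namely by an exchange, so
    the permutation is multiplied by a transposition. *)
Lemma ncirc_flip a b b1 i j : ~~ odd i -> odd j -> partner b i != j ->
  partner b1 i = j -> partner b1 (partner b j) = partner b i ->
  (forall r, ~~ odd r -> r != i -> r != partner b j -> partner b1 r = partner b r) ->
  (ncirc b1 a + (circ_at b a i != circ_at b a j).*2 = ncirc b a + 1)%N.
Proof.
move=> ei oj nbij b1i b1bj b1r.
have w0 := in_range_nil n 0.
pose u : point n 0 := (ord0, i); pose v : point n 0 := (ord0, partner b j).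
have fE w : forward (chain a [:: b1]) [::] w = forward (chain a [:: b]) [::] (tperm u v w).
  case: w => r x; rewrite (ord1 r) {r}.
  case: tpermP => [[->]|[->]|/eqP nu /eqP nv].
  - by rewrite /forward /= (negPf ei) odd_partner oj /= /above /= b1i partnerK.
  - by rewrite /forward /= (negPf ei) odd_partner oj /= /above /= b1bj.
  rewrite /forward /=; case ox: (odd x) => //; rewrite /above /= b1r ?ox //.
have pE : forward_perm (chain a [:: b1]) w0 = (tperm u v * forward_perm (chain a [:: b]) w0)%g.
  by apply/permP=> w; rewrite permM [LHS]permE [RHS]permE fE.
have /= E := porbits_mul_tperm (forward_perm (chain a [:: b]) w0) u v.
move: E; rewrite -pE -!ncirc_porbits.
rewrite porbit_sym -sameE -circle_at_eq //.
rewrite -[circle_at (chain a [:: b]) _ v]/(circ_at b a (partner b j)) circ_at_upper.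
rewrite -[circle_at (chain a [:: b]) _ u]/(circ_at b a i).
have -> : u != v by rewrite xpair_eqE /= (can2_eq (@partnerK _ b) (@partnerK _ b)) in nbij *.
done.
Qed.
End Counting.

(** * Reconnecting two arcs of a matching *)

Definition betw (u v y : nat) := (u < y < v) || (v < y < u).

Lemma betwC u v y : betw u v y = betw v u y.
Proof. by rewrite /betw orbC. Qed.

Lemma betw_xor u v w y : y != u -> y != v -> y != w ->
  betw u w y = betw u v y (+) betw v w y.
Proof.
rewrite /betw; case: (ltngtP u y) => // _ _; case: (ltngtP v y) => // _ _;
by case: (ltngtP w y).
Qed.

Section Surgery.
Variable n : nat.
Implicit Types (a b c : matching n) (i j r x y : 'I_(2 * n)).

Lemma partner_betw b x y : y != x -> y != partner b x ->
  betw x (partner b x) y = betw x (partner b x) (partner b y).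
Proof.
move=> yx ybx; have h1 := @partner_inside _ b x y.
have h2 := @partner_inside _ b x (partner b y).
have h3 := @partner_inside _ b (partner b x) y.
have h4 := @partner_inside _ b (partner b x) (partner b y).
rewrite !partnerK in h1 h2 h3 h4.
by rewrite /betw; apply/idP/idP; lia.
Qed.

Lemma matching_betw (f : {ffun 'I_(2 * n) -> 'I_(2 * n)}) :
  (forall i, f (f i) = i) -> (forall i, f i != i) ->
  (forall x y, y != x -> y != f x -> betw x (f x) y -> betw x (f x) (f y)) ->
  is_matching f.
Proof.
move=> fK fn fb; apply/andP; split; first by apply/forallP=> i; rewrite fK eqxx fn.
apply/forallP=> x; apply/forallP=> y; apply/negP=> /and3P[xy yfx fxy].
have : betw x (f x) (f y).
  apply: fb; [| |by rewrite /betw xy yfx].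
    by rewrite -(inj_eq val_inj) gtn_eqF.
  by rewrite -(inj_eq val_inj) ltn_eqF.
rewrite /betw; lia.
Qed.

(** Since the points between [i] and [j] are matched among themselves, an arc from [i] to [j]
    crosses nothing, and the two arcs it replaces leave room for one between their far ends. *)
Lemma surgery b i j : i < j -> partner b i != j ->
  (forall r, i < r < j -> i < partner b r < j) ->
  exists b1 : matching n,
  [/\ partner b1 i = j, partner b1 j = i, partner b1 (partner b i) = partner b j,
      partner b1 (partner b j) = partner b i
    & forall r, r != i -> r != j -> r != partner b i -> r != partner b j ->
        partner b1 r = partner b r].
Proof.
move=> ij nij inside; set P := partner b i; set Q := partner b j.
have bK := @partnerK _ b.
have ne x y : (x != y) = (nat_of_ord x != y) by [].
have Pi : P != i := partner_neq b i.
have Qj : Q != j := partner_neq b j.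
have Pj : P != j := nij.
have Qi : Q != i by rewrite -(inj_eq (can_inj bK)) bK eq_sym.
have ji : j != i by rewrite ne gtn_eqF.
have PQ : P != Q by rewrite (inj_eq (can_inj bK)) eq_sym.
have bP : partner b P = i := bK i.
have bQ : partner b Q = j := bK j.
pose g r := if r == i then j else if r == j then i else if r == P then Q
  else if r == Q then P else partner b r.
have gi : g i = j by rewrite /g eqxx.
have gj : g j = i by rewrite /g eqxx (negPf ji).
have gP : g P = Q by rewrite /g eqxx (negPf Pi) (negPf Pj).
have gQ : g Q = P by rewrite /g eqxx (negPf Qi) (negPf Qj) eq_sym (negPf PQ).
have go r : r != i -> r != j -> r != P -> r != Q -> g r = partner b r.
  by rewrite /g => /negPf-> /negPf-> /negPf-> /negPf->.
have bt x r := @partner_betw b x r.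
have in_r r : (i < r < j) = (i < partner b r < j).
  by apply/idP/idP => /inside; rewrite ?bK.
have Pout : ~~ (i <= P <= j).
  by have := in_r P; rewrite bP; move: Pi Pj; rewrite !ne; lia.
have Qout : ~~ (i <= Q <= j).
  by have := in_r Q; rewrite bQ; move: Qi Qj; rewrite !ne; lia.
have gK r : g (g r) = r.
  have [->|ri] := eqVneq r i; first by rewrite gi gj.
  have [->|rj] := eqVneq r j; first by rewrite gj gi.
  have [->|rP] := eqVneq r P; first by rewrite gP gQ.
  have [->|rQ] := eqVneq r Q; first by rewrite gQ gP.
  rewrite (go r) // go ?bK //.
  - by apply: contraNneq rP => e; rewrite /P -e bK.
  - by apply: contraNneq rQ => e; rewrite /Q -e bK.
  - by rewrite (inj_eq (can_inj bK)).
  - by rewrite (inj_eq (can_inj bK)).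
have gN r : g r != r.
  have [->|ri] := eqVneq r i; first by rewrite gi.
  have [->|rj] := eqVneq r j; first by rewrite gj eq_sym.
  have [->|rP] := eqVneq r P; first by rewrite gP eq_sym.
  have [->|rQ] := eqVneq r Q; first by rewrite gQ.
  by rewrite go // partner_neq.
have bij y : betw i j y = (i < y < j) by rewrite /betw; lia.
(* Modulo 2 the interval between [P] and [Q] is the sum of those between [i] and [P], [i] and [j],
   [j] and [Q], and [partner b] respects each of the three away from these points. *)
have PQy y : y != i -> y != j -> y != P -> y != Q ->
    betw P Q y = betw i P y (+) (i < y < j) (+) betw j Q y.
  by move=> yi yj yP yQ; rewrite (@betw_xor P i Q) // (@betw_xor i j Q) // betwC bij addbA.
have xX_ij x X : x != i -> x != j -> X != i -> X != j -> (i < x < j) = (i < X < j) ->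
    betw x X i = betw x X j.
  by rewrite !ne /betw; lia.
have gB x y : y != x -> y != g x -> betw x (g x) y -> betw x (g x) (g y).
{ have E y' : y' != i -> y' != j -> y' != P -> y' != Q ->
    [/\ betw i P y' = betw i P (partner b y'), betw j Q y' = betw j Q (partner b y'),
        partner b y' != i /\ partner b y' != j
      & partner b y' != P /\ partner b y' != Q].
    move=> yi yj yP yQ; split=> //; try by apply: bt.
      by split; [apply: contraNneq yP | apply: contraNneq yQ] => e; rewrite /P /Q -e bK.
    by rewrite !(inj_eq (can_inj bK)).
  have PQ_other y' : y' != i -> y' != j -> y' != P -> y' != Q ->
      betw P Q y' = betw P Q (partner b y').
    move=> yi yj yP yQ; have [e1 e2 [? ?] [? ?]] := E y' yi yj yP yQ.
    by rewrite !PQy // e1 e2 in_r.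
  have E2 x' : x' != i -> x' != j -> x' != P -> x' != Q ->
    [/\ betw x' (partner b x') i = betw x' (partner b x') j,
        betw x' (partner b x') i = betw x' (partner b x') P &
        betw x' (partner b x') j = betw x' (partner b x') Q].
    move=> xi xj xP xQ; have [_ _ [bxi bxj] [bxP bxQ]] := E x' xi xj xP xQ.
    by split; [apply: xX_ij | |]; rewrite -?in_r //; apply: bt; rewrite eq_sym.
  have [->|xi] := eqVneq x i; last have [->|xj] := eqVneq x j;
    last have [->|xP] := eqVneq x P; last have [->|xQ] := eqVneq x Q;
    rewrite ?gi ?gj ?gP ?gQ;
  (have [->|yi] := eqVneq y i; last have [->|yj] := eqVneq y j;
    last have [->|yP] := eqVneq y P; last have [->|yQ] := eqVneq y Q;
    rewrite ?gi ?gj ?gP ?gQ) => //.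
  all: try by move=> _ _; rewrite go // !bij -in_r.
  all: try by move=> _ _; rewrite go // !(betwC j i) !bij -in_r.
  all: try by move=> _ _; rewrite go // -PQ_other.
  all: try by move=> _ _; rewrite go // !(betwC Q P) -PQ_other.
  all: try by move=> _ _; have [e1 e2 e3] := E2 x xi xj xP xQ; rewrite go // -?e2 -?e3 -?e1.
  all: try by move=> yx; rewrite !go // => ybx; rewrite -bt.
  all: move=> _ _; move: ij Pout Qout; rewrite /betw; clear; lia. }
have gm : is_matching (finfun g).
  by apply: matching_betw => [r|r|x y]; rewrite !ffunE; [apply: gK | apply: gN | apply: gB].
exists (exist _ (finfun g) gm); rewrite /partner /=.
by split=> [||||r ri rj rP rQ]; rewrite ffunE ?gi ?gj ?gP ?gQ // go.
Qed.
End Surgery.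

(** * Geodesics between matchings *)

Section Geodesics.
Variable n : nat.
Implicit Types (a b c t : matching n) (i j r x y : 'I_(2 * n)).

Lemma surgery_ncirc b i j : i < j -> odd i != odd j -> partner b i != j ->
  (forall r, i < r < j -> i < partner b r < j) ->
  exists b1 : matching n,
  [/\ [/\ partner b1 i = j, partner b1 j = i, partner b1 (partner b i) = partner b j
        & partner b1 (partner b j) = partner b i],
      forall r, r != i -> r != j -> r != partner b i -> r != partner b j ->
        partner b1 r = partner b r
    & forall a, ncirc b1 a + (circ_at b a i != circ_at b a j).*2 = ncirc b a + 1].
Proof.
move=> ij oij nij inside; have [b1 [b1i b1j b1P b1Q b1r]] := surgery ij nij inside.
exists b1; split=> // a; have bK := @partnerK _ b.
have oP := odd_partner b i; have oQ := odd_partner b j.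
case oi: (odd i) oij oP => /=; case oj: (odd j) oQ => //= oQ _ oP.
  rewrite eq_sym; apply: (@ncirc_flip _ a b b1 j i) => //.
  - by rewrite oj.
  - by apply: contraNneq nij => <-; rewrite bK.
  move=> r odr nrj nrP; apply: b1r => //.
  - by apply: contraNneq odr => ->; rewrite oi.
  - by apply: contraNneq odr => ->; rewrite oQ.
apply: (@ncirc_flip _ a b b1 i j) => //; first by rewrite oi.
move=> r odr nri nrQ; apply: b1r => //.
- by apply: contraNneq odr => ->; rewrite oj.
- by apply: contraNneq odr => ->; rewrite oP.
Qed.

Hypothesis ncirc_diag : forall b, ncirc b b = n.

(** Take a shortest arc of [a] missing from [b]. Under it the two matchings agree, so surgery on [b]
    can create it. Its ends lie on one circle of $W(b)a$, which the surgery splits. *)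
Lemma geodesic_step b a : b != a ->
  exists b1, (ncirc b b1).+1 = n /\ ncirc b1 a = (ncirc b a).+1.
Proof.
move=> nab; pose P i := (i < partner a i) && (partner b i != partner a i).
have [i0 Pi0] : exists i, P i.
  have [x nx] : exists x, partner b x != partner a x.
    apply/existsP; apply: contraNT nab; rewrite negb_exists => /forallP h.
    by apply/eqP/val_inj/ffunP => x; apply/eqP; have := h x; rewrite negbK.
  have [lt|gt|e] := ltngtP x (partner a x); first by exists x; rewrite /P lt.
    exists (partner a x); rewrite /P partnerK gt /=.
    by apply: contraNneq nx => e; rewrite -{1}e partnerK.
  by have := partner_neq a x; rewrite -(inj_eq val_inj) /= -e eqxx.
case: (arg_minnP (fun i => partner a i - i) Pi0) => i /andP[ilt bai] imin.
have ab r : i < r < partner a i -> partner b r = partner a r.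
  move=> ir; have ir' := partner_inside ir; apply/eqP; apply: contraT => nr.
  have [lt|gt|e] := ltngtP r (partner a r).
  - by have := imin r; rewrite /P lt nr => /(_ isT); lia.
  - have := imin (partner a r); rewrite /P partnerK gt /=.
    have -> : partner b (partner a r) != r.
      by apply: contraNneq nr => e; rewrite -{1}e partnerK.
    by move=> /(_ isT); lia.
  - by have := partner_neq a r; rewrite -(inj_eq val_inj) /= -e eqxx.
have [|||b1 [_ _ b1E]] := @surgery_ncirc b i (partner a i) ilt.
- by rewrite odd_partner; case: (odd i).
- by [].
- by move=> r ir; rewrite ab //; apply: partner_inside.
exists b1; split.
  have := b1E b; rewrite ncirc_diag ncirc_sym.
  have -> /= : circ_at b b i != circ_at b b (partner a i).
    apply/eqP=> /circ_at_diag[e|e]; first by have := partner_neq a i; rewrite e eqxx.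
    by move: bai; rewrite e eqxx.
  by lia.
by have := b1E a; rewrite circ_at_lower eqxx /= addn0 addn1.
Qed.

Variables A B : matching n.
Hypothesis A_def : forall i, partner A i = (if odd i then i.-1 else i.+1) :> nat.
Hypothesis B_def : forall i, partner B i =
  (if i == 0 :> nat then (2 * n).-1 else if i == (2 * n).-1 :> nat then 0
   else if odd i then i.+1 else i.-1) :> nat.

(** [A] joins $2i$ to $2i+1$ and [B] joins $2i+1$ to $2i+2$, so walking along the line stays on one
    circle. *)
Lemma circ_at_AB i j : circ_at A B i = circ_at A B j.
Proof.
suff h (k : nat) x : nat_of_ord x = k -> forall y, nat_of_ord y = 0 ->
    circ_at A B x = circ_at A B y.
  have lt0 : 0 < 2 * n by case: i => r; apply: leq_trans.
  by rewrite (h _ i erefl (Ordinal lt0)) // (h _ j erefl (Ordinal lt0)).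
elim: k x => [|k IH] x xk y y0; first by congr circ_at; apply: val_inj; rewrite /= xk y0.
have ltk : k < 2 * n by have := ltn_ord x; rewrite xk; apply: ltnW.
pose z := Ordinal ltk; rewrite -(IH z erefl y y0).
case ox: (odd x).
  rewrite -circ_at_upper; congr circ_at; apply: val_inj => /=.
  by rewrite A_def ox xk.
rewrite -circ_at_lower; congr circ_at; apply: val_inj => /=.
rewrite B_def xk /=; case: eqP => [e|_]; last first.
  by move: ox; rewrite xk /= => /negbFE->.
by have := ltn_ord x; move: ox; rewrite xk; lia.
Qed.

Lemma ncirc_AB : 0 < n -> ncirc A B = 1.
Proof.
move=> n0; have lt0 : 0 < 2 * n by rewrite muln_gt0.
rewrite ncirc.unlock -(cards1 (circ_at A B (Ordinal lt0))); apply: eq_card => X.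
by rewrite !inE (circ_at_surj X) (circ_at_AB _ (Ordinal lt0)) eqxx.
Qed.

Hypothesis ncirc_le_n : forall b a, ncirc b a <= n.

(** Creating an arc of [A] in [a] adds a circle to $W(A)a$ and merges two circles of $W(a)B$, so the
    sum stays constant on the way to [A]. These are the numbers of blocks of a noncrossing partition
    and of its Kreweras complement. *)
Lemma ncirc_A_B a : 0 < n -> ncirc A a + ncirc a B = n.+1.
Proof.
move=> n0; move: {2}(n - ncirc a A) (leqnn (n - ncirc a A)) => k.
elim: k a => [|k IH] a.
  rewrite leqn0 subn_eq0 => le; have eA : ncirc a A = n.
    by apply/eqP; rewrite eqn_leq ncirc_le_n.
  have [->|na] := eqVneq a A; first by rewrite ncirc_diag ncirc_AB // addn1.
  have [b1 [_ h]] := geodesic_step na; have := ncirc_le_n b1 A; lia.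
move=> le; have [->|na] := eqVneq a A; first by rewrite ncirc_diag ncirc_AB // addn1.
have [x ox nx] : exists2 x : 'I_(2 * n), ~~ odd x & partner a x != partner A x.
  have [x nx] : exists x, partner a x != partner A x.
    apply/existsP; apply: contraNT na; rewrite negb_exists => /forallP h.
    by apply/eqP/val_inj/ffunP => x; apply/eqP; have := h x; rewrite negbK.
  case ox: (odd x); last by exists x; rewrite ?ox.
  exists (partner A x); first by rewrite odd_partner ox.
  by apply: contraNneq nx; rewrite partnerK => e; rewrite -{1}e partnerK.
have Ax : partner A x = x.+1 :> nat by rewrite A_def (negPf ox).
have [|||| a1 [_ _ a1E]] := @surgery_ncirc a x (partner A x).
- by rewrite Ax.
- by rewrite odd_partner; case: (odd x).
- by [].
- by move=> r; rewrite Ax; lia.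
have a1A : ncirc a1 A = (ncirc a A).+1.
  by have := a1E A; rewrite circ_at_lower eqxx addn0 addn1.
have := IH a1; rewrite (ncirc_sym A a1) a1A (ncirc_sym A a).
have := a1E B; have -> : circ_at a B x != circ_at a B (partner A x); last first.
  by move=> /=; have := ncirc_le_n a1 A; lia.
have axx := partner_neq a x; have oax := odd_partner a x.
have Bd := B_def; have nxN : partner a x != x.+1 :> nat by rewrite -Ax.
have [lt|gt|e] := ltngtP x (partner a x).
(* Since [x] is even, [B] matches the points strictly under the arc of [a] at [x] among themselves,
   and the point after [x] is one of them. *)
- pose F r := x < r < partner a x.
  have Fa r : F (partner a r) = F r.
    apply/idP/idP; rewrite /F => /partner_inside; rewrite ?partnerK //.
  have FB r : F (partner B r) = F r.
    rewrite /F B_def; have := ltn_ord (partner a x); move: ox oax lt.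
    by do !case: ifP; lia.
  apply/eqP => /(circ_atP (F := F) Fa FB); rewrite /F Ax; lia.
(* Now the right end [x] is even and the left end odd, so it is the closed interval that [B]
   preserves. *)
- pose F r := partner a x <= r <= x.
  have Fa r : F (partner a r) = F r.
    have [->|rx] := eqVneq r x; first by rewrite /F; lia.
    have [->|rax] := eqVneq r (partner a x); first by rewrite /F partnerK; lia.
    have := partner_betw rx rax.
    have : partner a r != x by apply: contraNneq rax => <-; rewrite partnerK.
    have : partner a r != partner a x by rewrite (can_eq (@partnerK _ a)).
    move: rx rax gt; rewrite -!(inj_eq val_inj) /F /betw /=; lia.
  have FB r : F (partner B r) = F r.
    rewrite /F B_def; have := ltn_ord x; move: ox oax gt.
    by do !case: ifP; lia.
  apply/eqP => /(circ_atP (F := F) Fa FB); rewrite /F Ax; lia.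
by move: axx; rewrite -(inj_eq val_inj) /= -e eqxx.
Qed.

End Geodesics.

(** * The extremal matchings, transpositions and cuts *)

Section Extremal.
Variable n : nat.
Implicit Types (a b c t : matching n) (i j r x y u v : 'I_(2 * n)).

Lemma exists_matching (h : nat -> nat) :
  (forall i, i < 2 * n -> h i < 2 * n) -> (forall i, i < 2 * n -> h (h i) = i) ->
  (forall i, i < 2 * n -> h i <> i) ->
  (forall i j, i < 2 * n -> j < 2 * n -> ~~ [&& i < j, j < h i & h i < h j]) ->
  exists b : matching n, forall i, partner b i = h i :> nat.
Proof.
move=> hlt hK hN hnc.
pose f := [ffun i : 'I_(2 * n) => insubd i (h i)].
have fE i : f i = h i :> nat by rewrite ffunE val_insubd hlt.
have fm : is_matching f.
  apply/andP; split; apply/forallP=> i; last first.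
    by apply/forallP=> j; rewrite !fE; apply: hnc.
  apply/andP; split; first by apply/eqP/val_inj; rewrite /= !fE hK.
  by apply/eqP=> /(congr1 val); rewrite /= fE; apply: hN.
by exists (exist _ f fm) => i; rewrite /partner /= fE.
Qed.

Definition outer_arcs (i : nat) : nat := if odd i then i.-1 else i.+1.
Definition inner_arcs (i : nat) : nat :=
  if i == 0 then (2 * n).-1 else if i == (2 * n).-1 then 0
  else if odd i then i.+1 else i.-1.

Lemma exists_outer : exists A : matching n, forall i, partner A i = outer_arcs i :> nat.
Proof.
by apply: exists_matching => [i|i|i|i j]; rewrite /outer_arcs; do !case: ifP; lia.
Qed.

Lemma exists_inner : exists B : matching n, forall i, partner B i = inner_arcs i :> nat.
Proof.
by apply: exists_matching => [i|i|i|i j]; rewrite /inner_arcs; do !case: ifP; lia.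
Qed.

Variables A B : matching n.
Hypothesis A_def : forall i, partner A i = outer_arcs i :> nat.
Hypothesis B_def : forall i, partner B i = inner_arcs i :> nat.

(** With [x] odd and [y] even, the points strictly between them form whole arcs of [A], so surgery
    applies. *)
Lemma exists_transposition x y : odd x -> ~~ odd y -> x < y ->
  exists t, circ_at A A x <> circ_at A A y /\
    forall a, ncirc t a + (circ_at A a x != circ_at A a y).*2 = ncirc A a + 1.
Proof.
move=> ox ey xy; have Ax := A_def x; rewrite /outer_arcs ox in Ax.
have nAx : partner A x != y by rewrite -(inj_eq val_inj) /= Ax; lia.
have [|||t [_ _ tE]] := @surgery_ncirc n A x y xy.
- by rewrite ox (negPf ey).
- exact: nAx.
- by move=> r; rewrite A_def /outer_arcs; do !case: ifP; lia.
exists t; split=> // /circ_at_diag[e|e]; first by rewrite e ltnn in xy.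
by rewrite e eqxx in nAx.
Qed.

(* B with its black region cut into the parts below and above the index 2k.    *)
Lemma exists_cut k : 0 < k < n ->
  exists b x y, (forall a, ncirc b a + (circ_at B a x != circ_at B a y).*2 = ncirc B a + 1)
   /\ (circ_at B B x <> circ_at B B y) /\
   forall u v, u < k.*2 -> k.*2 <= v -> circ_at A b u <> circ_at A b v.
Proof.
move=> kn; have lt0 : 0 < 2 * n by lia.
have lt1 : k.*2.-1 < 2 * n by lia.
pose x := Ordinal lt0; pose y := Ordinal lt1.
have Bx : partner B x = (2 * n).-1 :> nat by rewrite B_def.
have By : partner B y = k.*2 :> nat by rewrite B_def /inner_arcs /=; do !case: ifP; lia.
have nBx : partner B x != y by rewrite -(inj_eq val_inj) /= Bx; lia.
have [||||b [[bx by_ bBx bBy] br bE]] := @surgery_ncirc n B x y.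
- by rewrite /=; lia.
- by rewrite /=; lia.
- exact: nBx.
- by move=> r; rewrite B_def /inner_arcs /=; do !case: ifP; lia.
exists b, x, y; split=> //; split.
  move=> /circ_at_diag[e|e]; last by rewrite e eqxx in nBx.
  by have := congr1 val e; rewrite /=; lia.
move=> u v uk kv; pose F (r : 'I_(2 * n)) := r < k.*2.
have FA r : F (partner A r) = F r by rewrite /F A_def /outer_arcs; do !case: ifP; lia.
have Fb r : F (partner b r) = F r.
  have [->|rx] := eqVneq r x; first by rewrite bx /F /=; lia.
  have [->|ry] := eqVneq r y; first by rewrite by_ /F /=; lia.
  have [->|rBx] := eqVneq r (partner B x); first by rewrite bBx /F By Bx; lia.
  have [->|rBy] := eqVneq r (partner B y); first by rewrite bBy /F By Bx; lia.
  rewrite br // /F B_def /inner_arcs.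
  move: rx ry rBx rBy; rewrite -!(inj_eq val_inj) /= Bx By; have := ltn_ord r.
  by do !case: ifP; lia.
by move/(circ_atP (F := F) FA Fb); rewrite /F; lia.
Qed.

(** Having fewer circles, $W(A)a$ joins two points that $W(A)b$ separates. Each point may be moved
    along its arc of [A] to fix the parities; if the order is wrong, moving both and exchanging them
    corrects it. *)
Lemma exists_separated b a : ncirc A a < ncirc A b ->
  exists x y, [/\ odd x, ~~ odd y, x < y, circ_at A b x <> circ_at A b y
                & circ_at A a x = circ_at A a y].
Proof.
move=> lt.
have [x [y [xy nxy]]] : exists x y, circ_at A a x = circ_at A a y /\
    circ_at A b x <> circ_at A b y.
  case: (boolP [exists x, exists y, (circ_at A a x == circ_at A a y) &&
      (circ_at A b x != circ_at A b y)]) => [/existsP[x /existsP[y /andP[/eqP ? /eqP ?]]]|].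
    by exists x, y.
  rewrite negb_exists => /forallP h; move: lt; rewrite ltnNge ncirc_le // => x y /eqP xy.
  have := h x; rewrite negb_exists => /forallP/(_ y)/nandP[/negP[]|].
    exact: xy.
  by move/negPn/eqP.
have cA c r : circ_at A c (partner A r) = circ_at A c r := circ_at_upper A c r.
wlog ox : x xy nxy / odd x.
  move=> H; case ox: (odd x); first exact: (H x).
  by apply: (H (partner A x)); rewrite ?cA ?odd_partner ?ox.
wlog ey : y xy nxy / ~~ odd y.
  move=> H; case oy: (odd y); last by apply: (H y) => //; rewrite oy.
  by apply: (H (partner A y)); rewrite ?cA ?odd_partner ?oy.
have [lt'|ge] := ltnP x y; first by exists x, y.
exists (partner A y), (partner A x); rewrite !cA !odd_partner ox ey.
split=> //; last by move/esym.
have Ay := A_def y; have Ax := A_def x.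
have nAyx : partner A y <> x by move=> e; apply: nxy; rewrite -e cA.
have : partner A y != x by apply/eqP.
rewrite -(inj_eq val_inj) /= Ax Ay /outer_arcs; move: ox ey ge; do !case: ifP; lia.
Qed.

End Extremal.

(** * Cochains on nonzero products *)

Section Classification.
Variable n : nat.
Variables (C : choices n) (phi : matching n -> matching n -> matching n -> matching n -> 'Z_2).
Hypothesis phiC : is_phi_ch C phi.
Implicit Types (a b c d t : matching n) (i j r x y u v : 'I_(2 * n)).

(** For the triple [b, b, b], [ncirc_splits] bounds the count by [n]. *)
Lemma ncirc_diag b : ncirc b b = n.
Proof.
by have := ncirc_splits C b b b; have := ncirc_diag_ge b; lia.
Qed.

Lemma ncirc_le_n b a : ncirc b a <= n.
Proof.
have := ncirc_splits C a b a; rewrite (ncirc_diag a) (ncirc_sym a b).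
by have := ncirc_diag b; lia.
Qed.

Variables A B : matching n.
Hypothesis A_def : forall i, partner A i = outer_arcs i :> nat.
Hypothesis B_def : forall i, partner B i = inner_arcs n i :> nat.
Hypothesis n0 : 0 < n.

Let AB1 : ncirc A B = 1. Proof. exact: (ncirc_AB A_def B_def n0). Qed.
Let A_B a : ncirc A a + ncirc a B = n.+1.
Proof. exact: (ncirc_A_B ncirc_diag A_def B_def ncirc_le_n a n0). Qed.

Notation s c b a := (splits C c b a).
Let sE c b a : (s c b a).*2 + ncirc c b + ncirc b a = ncirc c a + n := ncirc_splits C c b a.

(** The splits form a spanning tree on the circles of $W(c)a$: they connect all circles and are one
    fewer. *)
Lemma nz3_tree c b a i0 : s c b a = (ncirc c a).-1 ->
  (forall i, arc_span C c b a (ext_gen int (circ_at c a i) - ext_gen int (circ_at c a i0))%R) ->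
  nz3 C c b a.
Proof.
move=> sz sp; apply: (@wprod_tree_neq0 _ _ _ (circ_at c a i0)); first exact: diffs_deg1.
  by rewrite size_map size_splits_of sz ncirc.unlock.
by move=> X; rewrite (circ_at_surj X); apply: sp.
Qed.

Lemma span_connected c b a i0 : (forall i, circ_at b a i = circ_at b a i0) ->
  forall i, arc_span C c b a (ext_gen int (circ_at c a i) - ext_gen int (circ_at c a i0))%R.
Proof. by move=> h i; apply: arc_span_lower; apply: h. Qed.

Let i0 : 'I_(2 * n). Proof. by exists 0; rewrite muln_gt0. Defined.

Lemma nz3_cAB c : nz3 C c A B.
Proof.
apply: (@nz3_tree c A B i0); last first.
  by apply: span_connected => i; apply: (circ_at_AB A_def B_def).
by have := sE c A B; have := A_B c; rewrite AB1 (ncirc_sym c A); lia.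
Qed.

Lemma nz3_cBA c : nz3 C c B A.
Proof.
apply: (@nz3_tree c B A i0); last first.
  apply: span_connected => i; have := circ_at_AB A_def B_def i i0.
  apply: circ_atP => r; first exact: circ_at_lower.
  exact: circ_at_upper.
by have := sE c B A; have := A_B c; rewrite (ncirc_sym B A) AB1 (ncirc_sym c A); lia.
Qed.

(** As [a] lies on a geodesic from [A] to [B], the composite for [c, A, a, B] is nonzero like the
    product for [c, A, B], and so are its factors. *)
Lemma nz3_cAa c a : nz3 C c A a.
Proof.
have sAaB : s A a B = 0 by have := sE A a B; have := A_B a; rewrite AB1; lia.
have := nz3_cAB c; rewrite -(nz4_unit_lower phiC c sAaB).
by case/(nz4_nz3_factor phiC).
Qed.

Lemma nz3_caA c a : nz3 C c a A.
Proof.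
have sBaA : s B a A = 0.
  have := sE B a A; have := A_B a.
  by rewrite (ncirc_sym B A) AB1 (ncirc_sym a A) (ncirc_sym B a); lia.
have := nz3_cBA c; rewrite -(nz4_unit_lower phiC c sBaA).
by case/(nz4_nz3 phiC).
Qed.

Variable eta : matching n -> matching n -> matching n -> bool.
Hypothesis eta_cocycle : forall d c b a, nz4 C d c b a ->
  eta d c b (+) eta d c a (+) eta d b a (+) eta c b a = false.

(* eta modified by the coboundary that makes it vanish on all (c, b, A).       *)
Definition gauged c b a := eta c b a (+) eta c b A (+) eta b a A (+) eta c a A.
Notation e := gauged.

Lemma gauged_cocycle d c b a : nz4 C d c b a ->
  e d c b (+) e d c a (+) e d b a (+) e c b a = false.
Proof.
move/eta_cocycle; rewrite /gauged.
move: (eta d c b) (eta d c a) (eta d b a) (eta c b a) (eta d c A) (eta c b A)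
  (eta d b A) (eta c a A) (eta d a A) (eta b a A).
by do 10 case.
Qed.

Lemma splits_same c a : s c a a = 0.
Proof. by have := sE c a a; rewrite ncirc_diag; lia. Qed.

Lemma splits_same_l c a : s c c a = 0.
Proof. by have := sE c c a; rewrite ncirc_diag; lia. Qed.

(** The terms at $(c,b,A)$ cancel. Those at $(b,A,A)$ and $(c,A,A)$ agree, by the cocycle condition
    at quadruples $(g,A,A,A)$. *)
Lemma gauged_A c b : e c b A = false.
Proof.
have xAA g : eta g A A = eta A A A.
  have nz : nz4 C g A A A.
    by rewrite (nz4_unit_lower phiC) ?splits_same // nz3_cAa.
  have := eta_cocycle nz; by case: (eta g A A); case: (eta A A A).
by rewrite /gauged (xAA b) (xAA c); case: (eta c b A); case: (eta A A A).
Qed.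

Lemma gauged_nz4_A c b a : nz4 C c b a A -> e c b a = false.
Proof. by move/gauged_cocycle; rewrite !gauged_A !addbF. Qed.

(** Without splits, the composite for [c, b, a, A] is nonzero like the product for [c, a, A]. *)
Lemma gauged_unit c b a : s c b a = 0 -> e c b a = false.
Proof.
by move=> s0; apply: gauged_nz4_A; rewrite (nz4_unit_upper _ s0) nz3_caA.
Qed.

(** The cocycle condition at [c, a, b, a], where $(c,a,b)$ and $(c,a,a)$ have no splits. *)
Lemma gauged_white_split c b a : (ncirc b a).+1 = n -> s c b a = 1 -> e c b a = e a b a.
Proof.
move=> ba s1; have e1 := sE c b a; have e2 := sE c a b; have ab := ncirc_sym a b.
have s0 : s c a b = 0 by lia.
have nz : nz4 C c a b a.
  by rewrite (nz4_unit_upper _ s0) (nz3_one s1) //; lia.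
have := gauged_cocycle nz.
rewrite (gauged_unit s0) (gauged_unit (splits_same c a)).
by case: (e c b a); case: (e a b a).
Qed.

(* t is A with its arcs at x and y reconnected, as far as circle counts see it. *)
Definition transposition x y t :=
  [/\ odd x, ~~ odd y & x < y] /\ circ_at A A x <> circ_at A A y /\
  forall a, ncirc t a + (circ_at A a x != circ_at A a y).*2 = ncirc A a + 1.

(** The cocycle conditions at [t, A, b, a] and [t, A, t, a] share the value at $(t,A,a)$. The first
    identifies it with the value at $(t,b,a)$, the second with that at $(t,A,t)$; the other triples
    have no splits. *)
Lemma gauged_cover x y t b a : transposition x y t ->
  (ncirc b a).+1 = n -> ncirc A b = (ncirc A a).+1 ->
  circ_at A b x <> circ_at A b y -> circ_at A a x = circ_at A a y ->
  e a b a = e t A t.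
Proof.
move=> [_ [xyA tE]] ba AbAa bxy axy.
have tA : (ncirc t A).+1 = n.
  by have := tE A; rewrite (introF eqP xyA) ncirc_diag /=; lia.
have ta : ncirc t a = (ncirc A a).+1 by have := tE a; rewrite (introT eqP axy) /=; lia.
have tb : (ncirc t b).+1 = ncirc A b.
  by have := tE b; rewrite (introF eqP bxy) /=; lia.
have At := ncirc_sym A t.
have stba : s t b a = 1 by have := sE t b a; lia.
have sAba : s A b a = 0 by have := sE A b a; lia.
have stAb : s t A b = 0 by have := sE t A b; lia.
have sAta : s A t a = 0 by have := sE A t a; lia.
have nz1 : nz4 C t A b a by rewrite (nz4_unit_lower phiC _ sAba) nz3_cAa.
have nz2 : nz4 C t A t a by rewrite (nz4_unit_lower phiC _ sAta) nz3_cAa.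
have := gauged_cocycle nz1; have := gauged_cocycle nz2.
rewrite (gauged_unit stAb) (gauged_unit sAba) (gauged_unit sAta).
rewrite (gauged_unit (splits_same_l t a)) (gauged_white_split ba stba).
by case: (e t A t); case: (e t A a); case: (e a b a).
Qed.

(* Cutting the single circle of W(A)B along a suitable chord gives a matching b *)
(* through which any two transpositions can be compared.                       *)
Lemma gauged_transposition x y t x' y' t' :
  transposition x y t -> transposition x' y' t' -> e t A t = e t' A t'.
Proof.
have main z w g : transposition z w g -> forall (z1 w1 : 'I_(2 * n)) g1,
    z1 = 1 :> nat -> w1 = (2 * n).-2 :> nat -> transposition z1 w1 g1 ->
    e g A g = e g1 A g1.
  move=> Tu z1 w1 g1 z1E w1E Tu1; have [[oz ew zw] _] := Tu.
  (* As [w] is even, the cut at twice [w./2] separates [z] from [w]. Any cut separates the reference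
     points $1$ and $2n-2$. *)
  have kn : 0 < w./2 < n by have := ltn_ord w; lia.
  have [b [p [q [bE [pq sep]]]]] := exists_cut A_def B_def kn.
  have bB : (ncirc b B).+1 = n.
    by have := bE B; rewrite (introF eqP pq) ncirc_diag /=; lia.
  have BA : circ_at B A p = circ_at B A q.
    have := circ_at_AB A_def B_def p q.
    apply: circ_atP => r; first exact: circ_at_lower.
    exact: circ_at_upper.
  have Ab : ncirc A b = (ncirc A B).+1.
    have := bE A; rewrite (introT eqP BA) /= (ncirc_sym b A) (ncirc_sym B A); lia.
  have AB_ i j := circ_at_AB A_def B_def i j.
  have sep1 : circ_at A b z <> circ_at A b w by apply: sep; lia.
  rewrite -(gauged_cover Tu bB Ab sep1 (AB_ z w)).
  have sep2 : circ_at A b z1 <> circ_at A b w1 by apply: sep; rewrite ?z1E ?w1E; lia.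
  by rewrite -(gauged_cover Tu1 bB Ab sep2 (AB_ z1 w1)).
move=> T1 T2; have [[ox ey xy] _] := T1.
have lt1 : 1 < 2 * n by lia.
have lt2 : (2 * n).-2 < 2 * n by lia.
have [||t0 [h1 h2]] := @exists_transposition n A A_def (Ordinal lt1) (Ordinal lt2) isT.
- by rewrite /=; lia.
- by have := ltn_ord y; rewrite /=; lia.
have T0 : transposition (Ordinal lt1) (Ordinal lt2) t0.
  by split=> //; split=> //=; have := ltn_ord y; lia.
rewrite (main _ _ _ T1 _ _ _ _ _ T0) //.
by rewrite (main _ _ _ T2 _ _ _ _ _ T0).
Qed.

Hypothesis gauged_T : forall x y t, transposition x y t -> e t A t = false.

(** A step either loses a circle against [A], and then $(b,a,A)$ has no splits, or gains one, and
    then its value is 0 or that of a transposition. *)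
Lemma gauged_step c b a : (ncirc b a).+1 = n -> e c b a = false.
Proof.
move=> ba; have ab := ncirc_sym a b.
have e1 := sE c b a; have e2 := sE c a b; have e3 := sE A b a; have e4 := sE A a b.
have e5 := sE b a A; have bA := ncirc_sym b A; have aA := ncirc_sym a A.
have [black|white] : ncirc A a = (ncirc A b).+1 \/ ncirc A b = (ncirc A a).+1 by lia.
  have s0 : s b a A = 0 by lia.
  by apply: gauged_nz4_A; rewrite (nz4_unit_lower phiC _ s0) nz3_caA.
have [s0|s1] : s c b a = 0 \/ s c b a = 1 by lia.
  exact: gauged_unit.
have lt : ncirc A a < ncirc A b by lia.
have [x [y [ox ey xy bxy axy]]] := exists_separated A_def lt.
have [t [h1 h2]] := exists_transposition A_def ox ey xy.
have T : transposition x y t by [].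
by rewrite (gauged_white_split ba s1) (gauged_cover T ba white bxy axy) (gauged_T T).
Qed.

(* Induction along a geodesic from b to a: the first step b1 satisfies          *)
(* s(W(b)b1, W(b1)a) = 0, so that the cocycle condition applies to c, b, b1, a. *)
Lemma gauged_nz3 c b a : nz3 C c b a -> e c b a = false.
Proof.
move: {2}(n - ncirc b a) (leqnn (n - ncirc b a)) => k.
elim: k b => [|k IH] b le nz.
  apply: gauged_unit; have := sE c b a; have := ncirc_le_n b a.
  have [->|nab] := eqVneq b a; first by rewrite splits_same.
  have [b1 [_ h]] := geodesic_step ncirc_diag nab; have := ncirc_le_n b1 a; lia.
have [ba|nba] := eqVneq b a; first by apply: gauged_unit; rewrite ba splits_same.
have [b1 [bb1 b1a]] := geodesic_step ncirc_diag nba.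
have s0 : s b b1 a = 0 by have := sE b b1 a; lia.
have nz' : nz4 C c b b1 a by rewrite (nz4_unit_lower phiC _ s0).
have [nz1 _] := nz4_nz3 phiC nz'.
have := gauged_cocycle nz'.
rewrite (gauged_step _ bb1) (gauged_unit s0) (IH b1) //; last by lia.
by case: (e c b a).
Qed.

End Classification.

Local Open Scope ring_scope.

(** * The twisting involution *)

Section Fold.
Variables (R : comNzRingType) (V : lmodType R) (N : nat).
Implicit Types (z : 'I_N -> V) (i j p q : 'I_N).

(** If [z] labels points by their circles, the alternating sum over the points left of [j] collects
    circles around [j], signed by orientation. A circle thus goes to plus or minus itself plus twice
    the signed sum of the circles enclosing it. *)
Definition altfold z j : V :=
  (\sum_(i < N | (i < j)%N) (-1) ^+ i *: z i) *+ 2 + (-1) ^+ j *: z j.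

Lemma altfoldB z z' j : altfold (fun i => z i - z' i) j = altfold z j - altfold z' j.
Proof.
rewrite /altfold; under eq_bigr do rewrite scalerBr.
by rewrite sumrB scalerBr mulrnBl [in RHS]opprD addrACA.
Qed.

(* With S j the alternating sum of the first j vectors, altfold z j is         *)
(* S j + S j.+1 and z j is the signed difference S j.+1 - S j.                 *)
Lemma altfoldK z j : altfold (altfold z) j = z j.
Proof.
pose S (t : nat) := \sum_(i < N | (i < t)%N) (-1) ^+ i *: z i.
have SS i : S i.+1 = S i + (-1) ^+ i *: z i.
  rewrite /S (bigD1 i) //= addrC; congr (_ + _); apply: eq_bigl => r.
  by rewrite ltnS -val_eqE /= andbC ltn_neqAle.
have FS i : altfold z i = S i + S i.+1 by rewrite SS addrA -mulr2n.
have sumF (t : nat) : (t <= N)%N ->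
    \sum_(i < N | (i < t)%N) (-1) ^+ i *: altfold z i = - ((-1) ^+ t *: S t).
  elim: t => [|t IH] tN.
    by rewrite big_pred0 // /S big_pred0 // scaler0 oppr0.
  pose i := Ordinal tN.
  rewrite (bigD1 i) //= addrC (eq_bigl (fun r : 'I_N => (r < t)%N)); last first.
    by move=> r; rewrite ltnS -val_eqE /= andbC ltn_neqAle.
  rewrite IH 1?ltnW // (FS i) scalerDr addrA addNr add0r exprS mulN1r scaleNr opprK.
  by [].
have -> : altfold (altfold z) j =
  (\sum_(i < N | (i < j)%N) (-1) ^+ i *: altfold z i) *+ 2 + (-1) ^+ j *: altfold z j by [].
rewrite sumF 1?ltnW // mulNrn FS SS.
by rewrite [S j + _]addrA -mulr2n scalerDr signrZK scalerMnr addKr.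
Qed.

End Fold.

Arguments altfold {R V N} z j.

Lemma altfold_linear (R : comNzRingType) (V W : lmodType R) N (h : {linear V -> W})
    (z : 'I_N -> V) j :
  h (altfold z j) = altfold (fun i => h (z i)) j.
Proof.
rewrite /altfold linearD linearMn linearZ linear_sum /=; congr (_ *+ _ + _).
by apply: eq_bigr => i _; rewrite linearZ.
Qed.

Section FoldMatching.
Variables (R : comNzRingType) (V : lmodType R) (n : nat).
Implicit Types (z : 'I_(2 * n) -> V) (b : matching n) (i j p q : 'I_(2 * n)).

(* The points below an arc are paired by b with opposite parities, so doubling *)
(* their alternating sum gives the alternating sum of the z i - z (b i).       *)
Lemma altfold_arc z b p : (p < partner b p)%N ->
  altfold z (partner b p) - altfold z p =
  (-1) ^+ p *: (z p - z (partner b p)) +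
  \sum_(i < 2 * n | (p < i < partner b p)%N) (-1) ^+ i *: (z i - z (partner b i)).
Proof.
move=> lt; set q := partner b p.
have sq : (-1) ^+ q = - (-1) ^+ p :> R.
  by rewrite -[LHS]signr_odd odd_partner signrN signr_odd.
have inner : (\sum_(i < 2 * n | (p < i < q)%N) (-1) ^+ i *: z i) *+ 2 =
    \sum_(i < 2 * n | (p < i < q)%N) (-1) ^+ i *: (z i - z (partner b i)).
  rewrite mulr2n {2}(reindex_inj (can_inj (@partnerK _ b))) /=.
  rewrite [X in _ + X](eq_bigl (fun i : 'I_(2 * n) => (p < i < q)%N)); last first.
    move=> i; apply/idP/idP => [h|]; last exact: partner_inside.
    by have := partner_inside h; rewrite partnerK.
  rewrite -big_split; apply: eq_bigr => i _ /=; rewrite scalerBr; congr (_ + _).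
  by rewrite -signr_odd odd_partner signrN scaleNr signr_odd.
have split_sum : \sum_(i < 2 * n | (i < q)%N) (-1) ^+ i *: z i =
    \sum_(i < 2 * n | (i < p)%N) (-1) ^+ i *: z i + (-1) ^+ p *: z p +
    \sum_(i < 2 * n | (p < i < q)%N) (-1) ^+ i *: z i.
  rewrite (bigID (fun i : 'I_(2 * n) => (i < p)%N)) /= -addrA; congr (_ + _).
    by apply: eq_bigl => i; apply: andb_idl => ip; apply: ltn_trans ip lt.
  rewrite (bigD1 p) /=; last by rewrite lt ltnn.
  by congr (_ + _); apply: eq_bigl => i; rewrite -val_eqE /=; lia.
rewrite -inner /altfold split_sum sq scaleNr !mulrnDl scalerBr.
set X := _ *+ 2; set Y := (\sum_(_ < _ | (p < _ < q)%N) _) *+ 2.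
rewrite [X + _ + Y]addrAC.
apply/eqP; rewrite subr_eq mulr2n; apply/eqP; move: (_ *: z p) (_ *: z q) => u v.
by rewrite [RHS]+%R.[AC (2*1*2) (4*3*(1*5)*2)].
Qed.

Variant partner_spec b i : Prop :=
  | PartnerRight p of (p < partner b p)%N & i = p
  | PartnerLeft p of (p < partner b p)%N & i = partner b p.

Lemma partnerP b i : partner_spec b i.
Proof.
have [lt|gt|e] := ltngtP i (partner b i); first exact: PartnerRight lt erefl.
  by apply: (@PartnerLeft _ _ (partner b i)); rewrite partnerK.
by have := partner_neq b i; rewrite -(inj_eq val_inj) /= -e eqxx.
Qed.

(** This makes [twist_gen] independent of the point chosen on a circle. *)
Lemma altfold_partner z b : (forall i, z (partner b i) = z i) ->
  forall i, altfold z (partner b i) = altfold z i.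
Proof.
move=> zb i; have eqp p : (p < partner b p)%N -> altfold z (partner b p) = altfold z p.
  move=> /(altfold_arc z) e; apply/eqP; rewrite -subr_eq0 e zb subrr scaler0 add0r.
  by rewrite big1 // => r _; rewrite zb subrr scaler0.
by case: (partnerP b i) => p lt ->; rewrite ?partnerK eqp.
Qed.
End FoldMatching.

Section FoldSpan.
Variables (R : comNzRingType) (J : finType) (n : nat) (l : seq (ext R J)).
Implicit Types (z : 'I_(2 * n) -> ext R J) (b : matching n).

Lemma lspan_altfold z j : (forall i, lspan l (z i)) -> lspan l (altfold z j).
Proof.
move=> sz; apply: lspanD; last exact: lspanZ.
have ss : lspan l (\sum_(i < 2 * n | (i < j)%N) (-1) ^+ i *: z i).
  by apply: lspan_sum => i _; apply: lspanZ.
by rewrite mulr2n; apply: lspanD.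
Qed.

Lemma lspan_altfold_arc z b : (forall i, lspan l (z i - z (partner b i))) ->
  forall i, lspan l (altfold z i - altfold z (partner b i)).
Proof.
move=> sz i; have sp (p : 'I_(2 * n)) : (p < partner b p)%N ->
    lspan l (altfold z (partner b p) - altfold z p).
  move=> /(altfold_arc z)->; apply: lspanD; first exact: lspanZ.
  by apply: lspan_sum => r _; apply: lspanZ.
case: (partnerP b i) => p lt ->; last by rewrite partnerK; apply: sp.
by rewrite -opprB; apply/lspanN/sp.
Qed.
End FoldSpan.

Section Automorphism.
Variables (n : nat) (R : comNzRingType).
Implicit Types (a b c d : matching n) (i j : 'I_(2 * n)).

Definition zgen c a i : ext R (circ c a) := ext_gen R (circ_at c a i).

Definition twist_gen c a (X : circ c a) : ext R (circ c a) :=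
  altfold (zgen c a) (val X).2.

(* The cocycles that this automorphism contributes are not coboundaries on the  *)
(* nonzero products; up to coboundaries they are the only ones.                *)
Definition circle_twist c a (x : ext R (circ c a)) : ext R (circ c a) :=
  ext_hom (@twist_gen c a) x.

Lemma altfold_deg1 (J : finType) (z : 'I_(2 * n) -> ext R J) j :
  (forall i, deg1 (z i)) -> deg1 (altfold z j).
Proof.
move=> dz; apply: deg1D; last exact: deg1Z.
have ss : deg1 (\sum_(i < 2 * n | (i < j)%N) (-1) ^+ i *: z i).
  by apply: deg1_sum => i _; apply: deg1Z.
by rewrite mulr2n; apply: deg1D.
Qed.

Lemma twist_gen_deg1 c a X : deg1 (@twist_gen c a X).
Proof. by apply: altfold_deg1 => i; apply: deg1_gen. Qed.

Lemma twist_gen_at c a i : twist_gen (circ_at c a i) = altfold (zgen c a) i.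
Proof.
apply: (@circ_atP _ _ (altfold (zgen c a)) c a).
- by apply: altfold_partner => r; rewrite /zgen circ_at_upper.
- by apply: altfold_partner => r; rewrite /zgen circ_at_lower.
- by rewrite -circ_at_surj.
Qed.

Lemma circle_twist_zgen c a i : circle_twist (zgen c a i) = altfold (zgen c a) i.
Proof. by rewrite /circle_twist ext_hom_gen twist_gen_at. Qed.

Lemma circle_twist_altfold c a i :
  circle_twist (altfold (zgen c a) i) = zgen c a i.
Proof.
rewrite /circle_twist altfold_linear -[RHS](altfoldK (zgen c a)).
by congr (_ *+ 2 + _ *: _); [apply: eq_bigr => r _; congr (_ *: _)|];
  apply: circle_twist_zgen.
Qed.

Lemma circle_twistK c a : involutive (@circle_twist c a).
Proof.
move=> x; rewrite /circle_twist ext_hom_comp; try exact: twist_gen_deg1.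
rewrite -[RHS]ext_hom_id; apply: eq_ext_hom => X.
by rewrite (circ_at_surj X) twist_gen_at; apply: circle_twist_altfold.
Qed.

End Automorphism.

Lemma lspan_hom (R : comNzRingType) (I J : finType) (g : I -> ext R J) l x :
  lspan l x -> lspan [seq ext_hom g y | y <- l] (ext_hom g x).
Proof.
elim: l x => [|y l IH] x /= => [->|[k [u [Su ->]]]]; first exact: ext_hom0.
by exists k, (ext_hom g u); rewrite ext_homD ext_homZ; split=> //; apply: IH.
Qed.

Lemma ext_base_altfold (R S : comNzRingType) (f : {rmorphism R -> S}) N (J : finType)
    (z : 'I_N -> ext R J) j :
  ext_base f (altfold z j) = altfold (fun i => ext_base f (z i)) j.
Proof.
rewrite /altfold mulr2n !ext_baseD ext_base_sign ext_base_sum -mulr2n.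
by congr (_ *+ _ + _); apply: eq_bigr => i _; rewrite ext_base_sign.
Qed.

Section TwistSign.
Variables (n : nat).
Implicit Types (a b c d : matching n) (i j : 'I_(2 * n)) (C : choices n).

Lemma ext_base_twist (R S : comNzRingType) (f : {rmorphism R -> S}) c a
    (x : ext R (circ c a)) :
  ext_base f (circle_twist x) = circle_twist (ext_base f x).
Proof.
rewrite ext_base_hom; apply: eq_ext_hom => X.
rewrite ext_base_altfold; congr (_ *+ 2 + _ *: _); last exact: ext_base_basis.
by apply: eq_bigr => i _; rewrite ext_base_basis.
Qed.

Lemma circle_twist_span (R : comNzRingType) C c b a x :
  x \in diffs R (circ_at c a) (splits_of C c b a) -> arc_span C c b a (circle_twist x).
Proof.
move=> /mapP[p /mem_splits_of p2 ->]; rewrite p2 /circle_twist ext_homB.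
rewrite -!/(circle_twist _) !circle_twist_zgen.
by apply: lspan_altfold_arc => i; apply: arc_span_arc.
Qed.

Definition twist_sign C c b a :=
  circle_twist (split_prod int C c b a) != split_prod int C c b a.

Lemma twist_signP C c b a :
  circle_twist (split_prod int C c b a) =
  (-1) ^+ twist_sign C c b a *: split_prod int C c b a.
Proof.
have g1 := @twist_gen_deg1 n int c a.
have [s] : exists s : bool,
    circle_twist (split_prod int C c b a) = (-1) ^+ s *: split_prod int C c b a.
  rewrite /circle_twist ext_hom_wprod //; apply: wprod_same_span.
  - exact: diffs_deg1.
  - by move=> _ /mapP[x xE ->]; apply: ext_hom_deg1; [exact: g1 | exact: diffs_deg1 xE].
  - by rewrite !size_map.
  - by move=> _ /mapP[x xE ->]; apply: circle_twist_span xE.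
  - by move=> x xE; rewrite -[x]circle_twistK; apply/lspan_hom/circle_twist_span.
rewrite /twist_sign => E; case: eqVneq => [->|] /=; first by rewrite scale1r.
by rewrite E; case: s {E} => //=; rewrite scale1r eqxx.
Qed.

Lemma split_prod_twist (R : comNzRingType) C c b a :
  circle_twist (split_prod R C c b a) =
  (-1) ^+ twist_sign C c b a *: split_prod R C c b a.
Proof.
by rewrite (split_prod_base R C) -ext_base_twist twist_signP ext_base_sign.
Qed.

Lemma circle_twistM (R : comNzRingType) c a (x y : ext R (circ c a)) :
  circle_twist (wedge x y) = wedge (circle_twist x) (circle_twist y).
Proof. exact: ext_homM (@twist_gen_deg1 n R c a) x y. Qed.

Section Relabel.
Variables (R : comNzRingType) (C : choices n) (c b a d e : matching n).
Hypothesis sp : forall i j, circ_at d e i = circ_at d e j ->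
  arc_span C c b a (ext_gen R (circ_at c a i) - ext_gen R (circ_at c a j)).

Definition twist_relabel (X : circ d e) : ext R (circ c a) :=
  altfold (zgen R c a) (val X).2.
Definition relabel_twist (X : circ d e) : ext R (circ c a) :=
  ext_hom (fun X => ext_gen R (relabel_circ c a X)) (twist_gen R X).

Lemma twist_relabelE (x : ext R (circ d e)) :
  circle_twist (ext_map (relabel_circ c a) x) = ext_hom twist_relabel x.
Proof.
rewrite ext_mapE; apply: etrans (ext_hom_comp _ _ _) _.
- by move=> X; apply: deg1_gen.
- exact: twist_gen_deg1.
by apply: eq_ext_hom => X; rewrite ext_hom_gen twist_gen_at.
Qed.

Lemma relabel_twistE (x : ext R (circ d e)) :
  ext_map (relabel_circ c a) (circle_twist x) = ext_hom relabel_twist x.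
Proof.
rewrite ext_mapE; apply: ext_hom_comp; first exact: twist_gen_deg1.
by move=> X; apply: deg1_gen.
Qed.

Lemma twist_relabel_deg1 X : deg1 (twist_relabel X).
Proof. by apply: altfold_deg1 => i; apply: deg1_gen. Qed.

Lemma relabel_twist_deg1 X : deg1 (relabel_twist X).
Proof. by apply: ext_hom_deg1; [move=> Y; apply: deg1_gen | apply: twist_gen_deg1]. Qed.

(** Relabelling and twisting commute modulo [arc_span]: [altfold] is linear in the labels, and the
    two labels of each point are congruent. *)
Lemma twist_relabel_span X : wedge (split_prod R C c b a) (twist_relabel X - relabel_twist X) = 0.
Proof.
apply: split_prod_kill; rewrite /relabel_twist /twist_gen altfold_linear -altfoldB.
apply: lspan_altfold => i; rewrite /= ext_hom_gen.
by apply: sp; rewrite -circ_at_surj.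
Qed.
End Relabel.

Lemma twist_OF2 (R : comNzRingType) C c b a (x : ext R (circ c b)) (y : ext R (circ b a)) :
  circle_twist (OF2 C x y) =
  (-1) ^+ twist_sign C c b a *: OF2 C (circle_twist x) (circle_twist y).
Proof.
rewrite (OF2_closed C x y) (OF2_closed C (circle_twist x) (circle_twist y)).
rewrite (circle_twistM (split_prod R C c b a) _) split_prod_twist wedgeZl; congr (_ *: _).
rewrite (circle_twistM (ext_map (relabel_circ c a) x) _).
pose W u v := wedge (split_prod R C c b a) (wedge u v).
apply: etrans (f_equal2 W (@twist_relabelE R c a c b x) (@twist_relabelE R c a b a y)) _.
apply: etrans _
  (esym (f_equal2 W (@relabel_twistE R c a c b x) (@relabel_twistE R c a b a y))).
apply: wedge_ext_hom_eq2 => X; try exact: twist_relabel_deg1;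
  try exact: relabel_twist_deg1; apply: twist_relabel_span.
  exact: arc_span_upper.
exact: arc_span_lower.
Qed.

Lemma twist_upper C d c b a :
  circle_twist (upper_prod C d c b a) =
  (-1) ^+ (twist_sign C d b a (+) twist_sign C d c b) *: upper_prod C d c b a.
Proof.
rewrite /upper_prod arc_prod_cat -/(split_prod int C d b a).
rewrite (split_prod_transport _ (@arc_span_upper _ _ C d b a)) circle_twistM.
rewrite split_prod_twist wedgeZl signr_addb -scalerA; congr (_ *: _).
rewrite -/(split_prod int C d c b) twist_relabelE.
rewrite (wedge_ext_hom_eq (h := @relabel_twist int d a _ _)); first last.
- by move=> X; apply/twist_relabel_span/arc_span_upper.
- exact: relabel_twist_deg1.
- exact: twist_relabel_deg1.
by rewrite -relabel_twistE split_prod_twist ext_mapE ext_homZ wedgeZr -ext_mapE.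
Qed.

Lemma twist_lower C d c b a :
  circle_twist (lower_prod C d c b a) =
  (-1) ^+ (twist_sign C d c a (+) twist_sign C c b a) *: lower_prod C d c b a.
Proof.
rewrite /lower_prod arc_prod_cat -/(split_prod int C d c a).
rewrite (split_prod_transport _ (@arc_span_lower _ _ C d c a)) circle_twistM.
rewrite split_prod_twist wedgeZl signr_addb -scalerA; congr (_ *: _).
rewrite -/(split_prod int C c b a) twist_relabelE.
rewrite (wedge_ext_hom_eq (h := @relabel_twist int d a _ _)); first last.
- by move=> X; apply/twist_relabel_span/arc_span_lower.
- exact: relabel_twist_deg1.
- exact: twist_relabel_deg1.
by rewrite -relabel_twistE split_prod_twist ext_mapE ext_homZ wedgeZr -ext_mapE.
Qed.

(** Apply the twist to the equality of the two composites up to sign, and compare signs on a nonzero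
    element. *)
Lemma twist_sign_cocycle C phi d c b a : is_phi_ch C phi -> nz4 C d c b a ->
  twist_sign C d c b (+) twist_sign C d c a (+) twist_sign C d b a
    (+) twist_sign C c b a = false.
Proof.
move=> phiC nz; have := twist_upper C d c b a.
rewrite [in LHS](upper_lower phiC) /circle_twist ext_homZ -/(circle_twist _) twist_lower.
rewrite (upper_lower phiC) !scalerA -!signr_addb => /signz_eq.
rewrite -(nz4_lower phiC) => /(_ nz).
by case: (odd _); case: (twist_sign C d c b); case: (twist_sign C d c a);
  case: (twist_sign C d b a); case: (twist_sign C c b a).
Qed.

Lemma twist_sign_unit C c b a : splits C c b a = 0%N -> twist_sign C c b a = false.
Proof.
rewrite -size_splits_of => /size0nil s0; apply/negbTE; rewrite negbK.
by rewrite /split_prod s0 /arc_prod wprod_nil /circle_twist ext_hom1.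
Qed.

Variable A : matching n.
Hypothesis A_def : forall i, partner A i = outer_arcs i :> nat.

(** The points left of an even position come in pairs $2i,2i+1$ on one circle, which cancel. *)
Lemma circle_twist_AA (x : ext int (circ A A)) : circle_twist x = x.
Proof.
rewrite -[RHS]ext_hom_id; apply: eq_ext_hom => X; rewrite [in RHS](circ_at_surj X).
rewrite /twist_gen; move: (val X).2 => j.
have zA i : zgen int A A (partner A i) = zgen int A A i by rewrite /zgen circ_at_upper.
suff even_j (r : 'I_(2 * n)) : ~~ odd r -> altfold (zgen int A A) r = zgen int A A r.
  case oj: (odd j); last by rewrite even_j ?oj.
  by rewrite -(altfold_partner zA) even_j ?odd_partner ?oj // zA.
move=> er; rewrite /altfold -signr_odd (negPf er) scale1r.
suff -> : (\sum_(i < 2 * n | (i < r)%N) (-1) ^+ i *: zgen int A A i) *+ 2 = 0.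
  by rewrite add0r.
rewrite mulr2n {2}(reindex_inj (can_inj (@partnerK _ A))) /=.
rewrite [X in _ + X](eq_bigl (fun i : 'I_(2 * n) => (i < r)%N)); last first.
  by move=> i; rewrite A_def /outer_arcs; move: er; do !case: ifP; lia.
rewrite -big_split big1 //= => i _.
by rewrite zA -[in X in _ + X]signr_odd odd_partner signrN scaleNr signr_odd subrr.
Qed.

(** No point lies under an arc of [A], so by [altfold_arc] the twist negates the difference across
    it, here the only factor of the product. *)
Lemma twist_sign_tAt C t : splits C t A t = 1%N -> nz3 C t A t ->
  twist_sign C t A t.
Proof.
rewrite -size_splits_of /nz3 /twist_sign /split_prod => s1 nz.
have [p sp] : exists p, splits_of C t A t = [:: p].
  by case: (splits_of C t A t) s1 => [|p [|]] // _; exists p.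
have p2 : p.2 = partner A p.1 by apply: (@mem_splits_of _ C t A t); rewrite sp mem_head.
have prodE : arc_prod int (circ_at t t) (splits_of C t A t) =
    zgen int t t p.1 - zgen int t t (partner A p.1).
  by rewrite sp /arc_prod wprod_cons wprod_nil wedge1r p2.
rewrite prodE in nz *; rewrite /circle_twist ext_homB -!/(circle_twist _) !circle_twist_zgen.
have flip i : (i < partner A i)%N -> altfold (zgen int t t) (partner A i) - altfold (zgen int t t) i
   = zgen int t t i - zgen int t t (partner A i).
  move=> lt; have := A_def i; rewrite /outer_arcs; case: ifP => oi Ai; first by move: lt; lia.
  rewrite (altfold_arc _ lt) -signr_odd oi scale1r big1 ?addr0 // => r.
  by rewrite Ai; lia.
have fl : altfold (zgen int t t) p.1 - altfold (zgen int t t) (partner A p.1) =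
   - (zgen int t t p.1 - zgen int t t (partner A p.1)).
  case: (partnerP A p.1) => i lt ->; rewrite ?partnerK ?flip //.
    by rewrite -flip // opprB.
  by rewrite opprB.
rewrite fl; apply: contra nz => /eqP e; apply/eqP/ext_eq_oppr.
by rewrite [RHS]e.
Qed.

End TwistSign.

Local Close Scope ring_scope.

(** * Removing the obstruction *)

Section Trivialization.
Variable n : nat.
Variables (C C' : choices n).
Variables (phi phi' : matching n -> matching n -> matching n -> matching n -> 'Z_2).
Hypotheses (phiC : is_phi_ch C phi) (phiC' : is_phi_ch C' phi').
Variable e0 : matching n -> matching n -> matching n -> bool.
Hypothesis de0 : forall d c b a,
  e0 d c b (+) e0 d c a (+) e0 d b a (+) e0 c b a = odd (phi d c b a) (+) odd (phi' d c b a).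

Let eta (k : bool) c b a := e0 c b a (+) eps C C' c b a (+) (k && twist_sign C c b a).

Let eta_cocycle k d c b a : nz4 C d c b a ->
  eta k d c b (+) eta k d c a (+) eta k d b a (+) eta k c b a = false.
Proof.
move=> nz; have := phi_eps phiC phiC' nz; have := de0 d c b a.
have := twist_sign_cocycle phiC nz; rewrite /eta.
move: (odd _ (+) odd _) (twist_sign C) => o ts t0 <-.
have -> : ts c b a = ts d c b (+) ts d c a (+) ts d b a.
  by move: t0; case: (ts d c b (+) _ (+) _); case: (ts c b a).
move: (ts d c b) (ts d c a) (ts d b a) {t0} => t2 t3 t4.
move: (eps C C' d c b) (eps C C' d c a) (eps C C' d b a) (eps C C' c b a) => p1 p2 p3 p4.
move: (e0 d c b) (e0 d c a) (e0 d b a) (e0 c b a) => q1 q2 q3 q4 h.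
have -> : q1 = q2 (+) q3 (+) q4 (+) (p1 (+) p2 (+) p3 (+) p4).
  by rewrite -h; case: q1 q2 q3 q4 {h} => [] [] [] [].
by case: k t2 t3 t4 p1 p2 p3 p4 q2 q3 q4 {h} => [] [] [] [] [] [] [] [] [] [] [].
Qed.

(** Adding [twist_sign] flips the common value at all $(t,A,t)$, so [k] is chosen as the value to be
    removed. *)
Lemma trivializing_cochain_pos : (0 < n)%N -> exists (k : bool) (mu : matching n -> matching n -> bool),
  forall c b a, nz3 C c b a -> eta k c b a = mu c b (+) mu b a (+) mu c a.
Proof.
move=> n0; have [A A_def] := exists_outer n; have [B B_def] := exists_inner n.
suff [k kP] : exists k, forall x y t, transposition A x y t -> gauged A (eta k) t A t = false.
  exists k, (fun c b => eta k c b A) => c b a nz.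
  have := gauged_nz3 phiC A_def B_def n0 (@eta_cocycle k) kP nz; rewrite /gauged.
  by case: (eta k c b a); case: (eta k c b A); case: (eta k b a A); case: (eta k c a A).
have flip x y t : transposition A x y t ->
    gauged A (eta true) t A t = ~~ gauged A (eta false) t A t.
  move=> [_ [xyA tE]].
  have At := ncirc_sym A t; have dA := ncirc_diag C A; have dt := ncirc_diag C t.
  have tA : ((ncirc t A).+1 = n)%N.
    by have := tE A; rewrite (introF eqP xyA) dA /=; lia.
  have s1 : splits C t A t = 1%N by have := ncirc_splits C t A t; lia.
  have nz : nz3 C t A t by apply: nz3_one => //; lia.
  have tAt := twist_sign_tAt A_def s1 nz.
  have tAA : twist_sign C t A A = false by apply/twist_sign_unit/splits_same.
  have ttA : twist_sign C t t A = false by apply/twist_sign_unit/splits_same_l.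
  have AtA : twist_sign C A t A = false.
    by rewrite /twist_sign (circle_twist_AA A_def) eqxx.
  rewrite /gauged /eta; move: (twist_sign C) (eps C C') tAt tAA ttA AtA.
  by move=> ts ep -> -> -> ->; rewrite /= !addbF !addbT !addNb.
(* A transposition needs an odd point to the left of an even one other than 0, hence at least four
   points. *)
have [one|n1] := leqP n 1.
  exists false => x y t [[ox ey xy] _].
  by have := ltn_ord y; have := ltn_ord x; lia.
have lt1 : (1 < 2 * n)%N by lia.
have lt2 : ((2 * n).-2 < 2 * n)%N by lia.
have [||t0 [h1 h2]] := @exists_transposition n A A_def (Ordinal lt1) (Ordinal lt2) isT.
- by rewrite /=; lia.
- by rewrite /=; lia.
have T0 : transposition A (Ordinal lt1) (Ordinal lt2) t0.
  by split=> //; split=> //=; lia.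
exists (gauged A (eta false) t0 A t0) => x y t T.
rewrite (gauged_transposition phiC A_def B_def n0 (@eta_cocycle _) T T0).
by move: (flip _ _ _ T0); case E: (gauged A (eta false) t0 A t0) => fl; [exact: fl | exact: E].
Qed.

Lemma trivializing_cochain : exists (k : bool) (mu : matching n -> matching n -> bool),
  forall c b a, nz3 C c b a ->
    e0 c b a (+) eps C C' c b a (+) (k && twist_sign C c b a) = mu c b (+) mu b a (+) mu c a.
Proof.
have [n0|n0] := posnP n; last exact: trivializing_cochain_pos.
have same (x y : matching n) : x = y.
  by apply/val_inj/ffunP => -[i lti]; exfalso; move: lti; rewrite n0.
exists false, (fun c b => eta false c b b) => c b a _.
by rewrite (same c a) (same b a) addbb addFb.
Qed.
End Trivialization.

Local Open Scope ring_scope.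

(** * Degree-dependent cochains *)

(** The vanishing of $H^2(\mathbb{Z})$: [nu] is defined by summation so that the identity holds for
    [l = 1], and the cocycle condition propagates it to all [l]. *)
Lemma int2_cocycle_trivial (V : comNzRingType) (Z : int -> int -> V) :
  (forall k, Z k 0 = 0) ->
  (forall k l m, Z k (l + m) - Z k l = Z (k + l) m - Z l m) ->
  exists nu : int -> V, forall k l, Z k l = nu k + nu l - nu (k + l).
Proof.
move=> Z0 dZ.
pose nu (k : int) := match k with
  | Posz p => - \sum_(i < p) Z i%:Z 1
  | Negz p => \sum_(i < p.+1) Z (- (i.+1)%:Z) 1 end.
have nu0 : nu 0 = 0 by rewrite /= big_ord0 oppr0.
have nuS k : nu (k + 1) = nu k - Z k 1.
  case: k => [p|[|p]].
  - by rewrite -PoszD addn1 /nu big_ord_recr /= opprD.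
  - by rewrite (_ : Negz 0 + 1 = 0) // nu0 /nu big_ord_recr big_ord0 /= add0r subrr.
  - rewrite (_ : Negz p.+1 + 1 = Negz p); last by rewrite !NegzE; ring.
    by rewrite /nu [in RHS]big_ord_recr /= NegzE addrK.
have Z01 : Z 0 1 = 0.
  by have := dZ 0 0 1; rewrite Z0 subr0 !add0r subrr.
have nu1 : nu 1 = 0 by rewrite -[1]add0r nuS nu0 Z01 subr0.
exists nu => k.
have step l : Z k (l + 1) - (nu k + nu (l + 1) - nu (k + (l + 1))) =
              Z k l - (nu k + nu l - nu (k + l)).
  have e : Z k (l + 1) = Z k l + Z (k + l) 1 - Z l 1.
    by rewrite -addrA -dZ addrC subrK.
  by rewrite e addrA !nuS; ring.
have F l : Z k l - (nu k + nu l - nu (k + l)) = 0.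
  elim: l => [|p IH|p IH]; first by rewrite Z0 addr0 nu0; ring.
    by rewrite -addn1 PoszD step.
  by rewrite -step (_ : - p.+1%:Z + 1 = - p%:Z) // -addn1 PoszD; ring.
by move=> l; apply/eqP; rewrite -subr_eq0 F.
Qed.

Section GroupoidCocycle.
Variables (V : comNzRingType) (M : Type).
Variable xi : M -> M -> M -> int -> int -> V.
Variable X : M -> M -> M -> M -> V.
Hypothesis dxi : forall d c b a k l m,
  xi d c b k l - xi d c a k (l + m) + xi d b a (k + l) m - xi c b a l m = X d c b a.

(** Setting [a = A] in [dxi] expresses [xi] through its values at [A]. Their dependence on the
    second degree, normalised to vanish in degree 0, reduces to a 2-cocycle of $\mathbb{Z}$ at the
    object [A]. *)
Lemma coboundary_degree_free (A : M) : exists la : M -> M -> int -> V,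
  forall d c b k l,
    xi d c b k l = X d c b A + la d c k + la c b l - la d b (k + l).
Proof.
have xiE d c b k l m : xi d c b k l =
    X d c b A + xi d c A k (l + m) - xi d b A (k + l) m + xi c b A l m.
  by rewrite -(dxi d c b A k l m); ring.
pose z d c k l := xi d c A k l - xi d c A k 0.
have z0 d c k : z d c k 0 = 0 by rewrite /z subrr.
have dz d c b k l m : z d c k (l + m) - z d c k l = z d b (k + l) m - z c b l m.
  have := xiE d c b k l 0; rewrite (xiE d c b k l m) addr0 => e.
  have {}e : xi d c A k (l + m) =
      xi d b A (k + l) m - xi c b A l m + xi d c A k l - xi d b A (k + l) 0 + xi c b A l 0.
    apply: (addrI (X d c b A)); apply: (addIr (- xi d b A (k + l) m)).
    by apply: (addIr (xi c b A l m)); rewrite e; ring.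
  by rewrite /z e; ring.
pose de d l := z d A 0 l.
have z_Ab b k m : z A b k m = z A A k m - de b m.
  by have := dz A b A k 0 m; rewrite add0r addr0 z0 subr0.
have z_db d b l m : z d b l m = z A A l m - de b m + de d (l + m) - de d l.
  rewrite -z_Ab /de; have := dz d A b 0 l m; rewrite add0r => /eqP.
  by rewrite eq_sym subr_eq => /eqP->; ring.
have [nu nuP] := int2_cocycle_trivial (fun k => z0 A A k) (dz A A A).
exists (fun d c k => xi d c A k 0 + nu k - de d k) => d c b k l.
have zE : z d c k l = nu k + nu l - nu (k + l) - de c l + de d (k + l) - de d k.
  by rewrite z_db nuP.
have -> : xi d c b k l =
    X d c b A + (z d c k l + xi d c A k 0) - xi d b A (k + l) 0 + xi c b A l 0.
  by rewrite (xiE d c b k l 0) addr0 /z subrK.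
by rewrite zE; ring.
Qed.

Lemma coboundary_cocycle A d c b a :
  X d c b a = X d c b A - X d c a A + X d b a A - X c b a A.
Proof.
have [la xiE] := coboundary_degree_free A.
by rewrite -(dxi d c b a 0 0 0) !xiE !addr0; ring.
Qed.

End GroupoidCocycle.

(** * The isomorphism *)

Section Grading.
Variables (R : comNzRingType) (I : finType).
Implicit Types (w : nat -> R) (x y : ext R I).

Lemma ext_part_hom (J : finType) (g : I -> ext R J) j x : (forall i, deg1 (g i)) ->
  ext_part j (ext_hom g x) = ext_hom g (ext_part j x).
Proof.
move=> g1; rewrite [in LHS](ext_basis_sum x) [in RHS](ext_basis_sum x).
rewrite ext_hom_sum !ext_part_sum ext_hom_sum; apply: eq_bigr => A _.
rewrite ext_homZ !ext_partZ ext_homZ; congr (_ *: _).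
have hb : homog #|A| (ext_basis R A) by apply: homog_basis.
have hA := homog_hom g1 hb.
have [->|nj] := eqVneq j #|A|.
  by rewrite (ext_part_id hA) (ext_part_id hb).
by rewrite (ext_part_neq hA nj) (ext_part_neq hb nj) ext_hom0.
Qed.

Definition ext_scale w x : ext R I := [ffun A : {set I} => w #|A| *: x A].

Lemma ext_scaleD w x y : ext_scale w (x + y) = ext_scale w x + ext_scale w y.
Proof. by apply/ffunP=> A; rewrite !ffunE scalerDr. Qed.

Lemma ext_scaleZ w a x : ext_scale w (a *: x) = a *: ext_scale w x.
Proof. by apply/ffunP=> A; rewrite !ffunE !scaleRo mulrCA. Qed.

Lemma ext_scale_homog w j x : homog j x -> ext_scale w x = w j *: x.
Proof.
move=> hx; apply/ffunP=> A; rewrite !ffunE; have [->|/hx->//] := eqVneq (x A) 0.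
by rewrite !scaler0.
Qed.

Lemma ext_scaleK w w' : (forall j, w' j * w j = 1) -> cancel (ext_scale w) (ext_scale w').
Proof. by move=> ww x; apply/ffunP=> A; rewrite !ffunE scalerA ww scale1r. Qed.

Lemma ext_part_scale w j x : ext_part j (ext_scale w x) = ext_scale w (ext_part j x).
Proof. by apply/ffunP=> A; rewrite !ffunE; case: ifP; rewrite ?scaler0. Qed.

End Grading.

Lemma wedge_ext_mapZ (R : comNzRingType) (I1 I2 J : finType) (f : I1 -> J) (g : I2 -> J)
    k l (w : ext R J) x y :
  wedge w (wedge (ext_map f (k *: x)) (ext_map g (l *: y))) =
  (k * l) *: wedge w (wedge (ext_map f x) (ext_map g y)).
Proof. by rewrite !ext_mapE !ext_homZ !(wedgeZl, wedgeZr) scalerA. Qed.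

Lemma homog_wedge_ext_map (R : comNzRingType) (I1 I2 J : finType)
    (f : I1 -> J) (g : I2 -> J) s j l (w : ext R J) x y :
  homog s w -> homog j x -> homog l y ->
  homog (s + (j + l)) (wedge w (wedge (ext_map f x) (ext_map g y))).
Proof.
move=> hw hx hy; rewrite !ext_mapE; apply: homog_wedge => //.
by apply: homog_wedge; apply: homog_hom => // i; apply: deg1_gen.
Qed.

(** * Powers of the imaginary unit *)

Section GaussPowers.
Implicit Types s t : 'Z_4.

Lemma gaussI_sqr : gaussI ^+ 2 = -1.
Proof. by rewrite expr2. Qed.

Lemma gaussI_add s t : gaussI ^+ (s + t)%R = gaussI ^+ s * gaussI ^+ t.
Proof.
rewrite -exprD /= expr_mod //.
Qed.

Lemma gaussI_double (b : bool) : gaussI ^+ (b.*2%:R : 'Z_4) = (-1) ^+ b.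
Proof. by case: b; rewrite ?expr0 // expr1 -gaussI_sqr. Qed.

End GaussPowers.

(** * Assembling the maps of the components *)

Section Assembly.
Variable n : nat.
Implicit Types (c b a : matching n).

Definition OH_map (h : forall c b, ext gaussInt (circ c b) -> ext gaussInt (circ c b))
    (x : OH n) : OH n :=
  [ffun u => h (tag u).1 (tag u).2 (OH_comp (tag u).1 (tag u).2 x) (tagged u)].

Lemma OH_comp_map h x c b : OH_comp c b (OH_map h x) = h c b (OH_comp c b x).
Proof. by apply/ffunP=> A; rewrite !ffunE. Qed.

Lemma OH_comp_ext (x y : OH n) : (forall c b, OH_comp c b x = OH_comp c b y) -> x = y.
Proof.
move=> xy; apply/ffunP=> -[[c b] A]; have /ffunP/(_ A) := xy c b.
by rewrite !ffunE.
Qed.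

Lemma OH_compD x y c b : OH_comp c b (x + y) = OH_comp c b x + OH_comp c b y.
Proof. by apply/ffunP=> A; rewrite !ffunE. Qed.

Lemma OH_compZ k x c b : OH_comp c b (k *: x) = k *: OH_comp c b x.
Proof. by apply/ffunP=> A; rewrite !ffunE. Qed.

Lemma OH_comp_mul C tau x y c a : OH_comp c a (twisted_mul C tau x y) =
  \sum_b twisted_comp C tau (OH_comp c b x) (OH_comp b a y).
Proof. by apply/ffunP=> A; rewrite !ffunE. Qed.

Lemma OF2Z (R : comNzRingType) (C : choices n) c b a k l
    (x : ext R (circ c b)) (y : ext R (circ b a)) :
  OF2 C (k *: x) (l *: y) = (k * l) *: OF2 C x y.
Proof.
by rewrite (OF2_closed C (k *: x) (l *: y)) (OF2_closed C x y) wedge_ext_mapZ.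
Qed.

Lemma homog_OF2 (R : comNzRingType) (C : choices n) c b a j l
    (x : ext R (circ c b)) (y : ext R (circ b a)) :
  homog j x -> homog l y -> homog (splits C c b a + (j + l)) (OF2 C x y).
Proof.
move=> hx hy; rewrite (OF2_closed C x y) -(size_splits_of C c b a).
have hw : homog (size (splits_of C c b a)) (split_prod R C c b a) by exact: homog_arc_prod.
exact (@homog_wedge_ext_map R _ _ _ (relabel_circ c a) (relabel_circ c a) _ _ _ _ _ _ hw hx hy).
Qed.

Lemma OH_degree_splits (C : choices n) c b a j l :
  OH_degree c a (splits C c b a + (j + l)) = OH_degree c b j + OH_degree b a l.
Proof. by rewrite /OH_degree; have := ncirc_splits C c b a; rewrite ncirc.unlock; lia. Qed.

Section Components.
Variables (C C' : choices n) (tau tau' : cochain2 n).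
Variables (la : matching n -> matching n -> int -> 'Z_4).
Variables (k : bool) (mu : matching n -> matching n -> bool).
Hypothesis sign_eq : forall c b a p q, nz3 C c b a ->
  gaussI ^+ tau c b a p q * gaussI ^+ la c a (p + q) * (-1) ^+ mu c a
    * (-1) ^+ (k && twist_sign C c b a) =
  gaussI ^+ tau' c b a p q * (gaussI ^+ la c b p * (-1) ^+ mu c b)
    * (gaussI ^+ la b a q * (-1) ^+ mu b a) * (-1) ^+ eps C C' c b a.

Let w c b j : gaussInt := gaussI ^+ la c b (OH_degree c b j) * (-1) ^+ mu c b.

Let twist c b (x : ext gaussInt (circ c b)) := if k then circle_twist x else x.

Definition comp_map c b (x : ext gaussInt (circ c b)) := ext_scale (w c b) (twist x).

Let twistK c b : involutive (@twist c b).
Proof. by rewrite /twist; case: k => x //; apply: circle_twistK. Qed.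

Let twistD c b (x y : ext gaussInt (circ c b)) : twist (x + y) = twist x + twist y.
Proof. by rewrite /twist; case: k => //; apply: ext_homD. Qed.

Let twistZ c b t (x : ext gaussInt (circ c b)) : twist (t *: x) = t *: twist x.
Proof. by rewrite /twist; case: k => //; apply: ext_homZ. Qed.

Let part_twist c b j (x : ext gaussInt (circ c b)) :
  ext_part j (twist x) = twist (ext_part j x).
Proof.
by rewrite /twist; case: k => //; apply: ext_part_hom => X; apply: twist_gen_deg1.
Qed.

Let homog_twist c b j (x : ext gaussInt (circ c b)) : homog j x -> homog j (twist x).
Proof. by move=> hx; rewrite -(ext_part_id hx) -part_twist; apply: homog_part. Qed.

Lemma comp_map_homog c b j (x : ext gaussInt (circ c b)) :
  homog j x -> comp_map x = w c b j *: twist x.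
Proof. by move=> hx; apply/ext_scale_homog/homog_twist. Qed.

Lemma comp_mapD c b (x y : ext gaussInt (circ c b)) :
  comp_map (x + y) = comp_map x + comp_map y.
Proof. by rewrite /comp_map twistD ext_scaleD. Qed.

Lemma comp_mapZ c b t (x : ext gaussInt (circ c b)) : comp_map (t *: x) = t *: comp_map x.
Proof. by rewrite /comp_map twistZ ext_scaleZ. Qed.

Lemma comp_map_sum c b (T : finType) (F : T -> ext gaussInt (circ c b)) :
  comp_map (\sum_t F t) = \sum_t comp_map (F t).
Proof.
apply: (big_morph (@comp_map c b)) => [x y|]; first exact: comp_mapD.
by have := comp_mapZ 0 (0 : ext gaussInt (circ c b)); rewrite !scale0r.
Qed.

Lemma comp_map_part c b j (x : ext gaussInt (circ c b)) :
  ext_part j (comp_map x) = comp_map (ext_part j x).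
Proof. by rewrite /comp_map ext_part_scale part_twist. Qed.

Definition comp_map_inv c b (x : ext gaussInt (circ c b)) :=
  twist (ext_scale (fun j => gaussI ^+ (- la c b (OH_degree c b j))%R * (-1) ^+ mu c b) x).

Let wK c b j : gaussI ^+ (- la c b (OH_degree c b j))%R * (-1) ^+ mu c b * w c b j = 1.
Proof.
by rewrite /w mulrACA -gaussI_add addNr expr0 mul1r -expr2 sqrr_sign.
Qed.

Lemma comp_mapK c b : cancel (@comp_map c b) (@comp_map_inv c b).
Proof.
move=> x; rewrite /comp_map /comp_map_inv (@ext_scaleK _ _ _ _ (wK c b)).
exact: twistK.
Qed.

Lemma comp_map_invK c b : cancel (@comp_map_inv c b) (@comp_map c b).
Proof.
move=> x; rewrite /comp_map /comp_map_inv twistK ext_scaleK // => j.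
by rewrite mulrC wK.
Qed.

Lemma comp_map_OF2 c b a j l (x : ext gaussInt (circ c b)) (y : ext gaussInt (circ b a)) :
  homog j x -> homog l y ->
  gaussI ^+ tau c b a (OH_degree c b j) (OH_degree b a l) *: comp_map (OF2 C x y) =
  gaussI ^+ tau' c b a (OH_degree c b j) (OH_degree b a l) *:
    OF2 C' (comp_map x) (comp_map y).
Proof.
move=> hx hy.
have OF2C' (u : ext gaussInt (circ c b)) (v : ext gaussInt (circ b a)) :
    OF2 C' u v = (-1) ^+ eps C C' c b a *: OF2 C u v.
  by rewrite !OF2_closed (split_prod_eps _ C C') wedgeZl.
have twist2 : twist (OF2 C x y) =
    (-1) ^+ (k && twist_sign C c b a) *: OF2 C (twist x) (twist y).
  by rewrite /twist; case: k => /=; rewrite ?twist_OF2 // expr0 scale1r.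
rewrite (comp_map_homog hx) (comp_map_homog hy) (comp_map_homog (@homog_OF2 gaussInt C c b a j l x y hx hy)).
rewrite OF2Z OF2C' twist2 !scalerA /w (OH_degree_splits C).
(* Where the split product vanishes both sides are zero, so signs have to match only on nonzero
   products. *)
have [nz|] := boolP (nz3 C c b a); last first.
  rewrite /nz3 negbK => /eqP s0.
  have -> : OF2 C (twist x) (twist y) = 0.
    by rewrite (OF2_closed C (twist x) (twist y)) (split_prod_base _ C) s0 ext_base0 wedge0l.
  by rewrite !scaler0.
have := sign_eq (OH_degree c b j) (OH_degree b a l) nz.
by rewrite !mulrA => ->.
Qed.

Lemma comp_map_twisted c b a (x : ext gaussInt (circ c b)) (y : ext gaussInt (circ b a)) :
  comp_map (twisted_comp C tau x y) = twisted_comp C' tau' (comp_map x) (comp_map y).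
Proof.
rewrite /twisted_comp comp_map_sum; apply: eq_bigr => j _.
rewrite comp_map_sum; apply: eq_bigr => l _.
have hx : homog j (ext_part j x) by exact: homog_part.
have hy : homog l (ext_part l y) by exact: homog_part.
apply: etrans (comp_mapZ _ _) (etrans (@comp_map_OF2 c b a j l _ _ hx hy) _).
exact (f_equal2 (fun u v => _ *: OF2 C' u v)
  (esym (comp_map_part j x)) (esym (comp_map_part l y))).
Qed.

Lemma comp_map_isomorphism : exists f : {linear OH n -> OH n},
  bijective f /\
  forall x y : OH n, f (twisted_mul C tau x y) = twisted_mul C' tau' (f x) (f y).
Proof.
pose f := OH_map comp_map.
have f_linear : linear f.
  move=> t x y; apply: OH_comp_ext => c b.
  by rewrite OH_compD OH_compZ !OH_comp_map OH_compD OH_compZ comp_mapD comp_mapZ.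
have fM x y : f (twisted_mul C tau x y) = twisted_mul C' tau' (f x) (f y).
  apply: OH_comp_ext => c a; apply: etrans (esym (OH_comp_mul C' tau' (f x) (f y) c a)).
  apply: etrans (OH_comp_map _ _ c a) _.
  apply: etrans (congr1 (@comp_map c a) (OH_comp_mul C tau x y c a)) _.
  apply: etrans (comp_map_sum _) _.
  apply: eq_bigr => b _; rewrite (OH_comp_map _ x c b) (OH_comp_map _ y b a).
  exact: comp_map_twisted.
pose F := GRing.isLinear.Build gaussInt (OH n) (OH n) *:%R f f_linear.
pose fl : {linear OH n -> OH n} := HB.pack f F.
exists fl; split=> //.
by exists (OH_map comp_map_inv) => x; apply: OH_comp_ext => c b;
  rewrite !OH_comp_map ?comp_mapK ?comp_map_invK.
Qed.

End Components.
End Assembly.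

Theorem proposition5p18 (n : nat) (C C' : choices n)
    (phi phi' : matching n -> matching n -> matching n -> matching n -> 'Z_2)
    (phiC : is_phi_ch C phi) (phiC' : is_phi_ch C' phi')
    (tau tau' : cochain2 n)
    (dtau : forall (d c b a : matching n) (k l m : int),
       coboundary tau d c b a k l m = psi C phi d c b a k l m)
    (dtau' : forall (d c b a : matching n) (k l m : int),
       coboundary tau' d c b a k l m = psi C' phi' d c b a k l m) :
  exists f : {linear OH n -> OH n},
    bijective f /\
    forall x y : OH n,
      f (twisted_mul C tau x y) = twisted_mul C' tau' (f x) (f y).
Proof.
(* Twice $\varphi-\varphi'$ modulo 4 depends only on parities, which [chi] and [X] record. *)
pose chi d c b a := odd (phi d c b a) (+) odd (phi' d c b a).
pose X d c b a : 'Z_4 := (chi d c b a).*2%:R.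
have dxi d c b a (p q r : int) :
    tau d c b p q - tau' d c b p q - (tau d c a p (q + r) - tau' d c a p (q + r)) +
    (tau d b a (p + q) r - tau' d b a (p + q) r) - (tau c b a q r - tau' c b a q r) =
    X d c b a.
  have dt := dtau d c b a p q r; have dt' := dtau' d c b a p q r.
  transitivity (psi C phi d c b a p q r - psi C' phi' d c b a p q r).
    by rewrite -dt -dt' /coboundary; ring.
  (* The commutation terms cancel because the number of splits does not depend on the choice. *)
  rewrite /psi /phi_com (splits_indep C C') opprD addrACA subrr addr0 /X /chi.
  by case: (phi d c b a) (phi' d c b a) => [[|[|?]] ?] [[|[|?]] ?] //; apply: val_inj.
have [A _] := exists_outer n.
pose xi d c b p q := tau d c b p q - tau' d c b p q.
have [la xiE] := @coboundary_degree_free _ _ xi X dxi A.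
have XE := @coboundary_cocycle _ _ xi X dxi A.
(* [X] is the coboundary of its values with last object [A]; halving this in $\mathbb{Z}/4$ gives
   [de0]. *)
pose e0 d c b := chi d c b A.
have de0 d c b a : e0 d c b (+) e0 d c a (+) e0 d b a (+) e0 c b a =
    odd (phi d c b a) (+) odd (phi' d c b a).
  have := XE d c b a; rewrite /X /e0 -/(chi d c b a).
  by case: (chi d c b a); case: (chi d c b A); case: (chi d c a A); case: (chi d b a A);
    case: (chi c b a A).
have [k [mu muE]] := trivializing_cochain phiC phiC' de0.
apply: (@comp_map_isomorphism n C C' tau tau' la k mu) => c b a p q nz.
have -> : tau c b a p q = tau' c b a p q + X c b a A + la c b p + la b a q - la c a (p + q).
  by have := xiE c b a p q; rewrite /xi => /eqP; rewrite subr_eq => /eqP->; ring.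
have := muE c b a nz; rewrite /e0 => /eqP; rewrite -addbA => me.
have {me}-> : mu c a = mu c b (+) mu b a (+)
    (chi c b a A (+) (eps C C' c b a (+) (k && twist_sign C c b a))).
  by rewrite (eqP me); case: (mu c b); case: (mu b a); case: (mu c a).
rewrite -!gaussI_add -mulrA subrK !gaussI_add /X gaussI_double.
move: (gaussI ^+ _) (gaussI ^+ la c b p) (gaussI ^+ la b a q) => g1 g2 g3.
move: (chi c b a A) (eps C C' c b a) (k && _) (mu c b) (mu b a).
by case; case; case; case; case => /=; ring.
Qed.
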